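(* Assume $L$ belongs to Class 3 (as defined in the context, together with $k_i,a,b,c,u,v$ and $\mathcal{D}_{\mathcal{H}}$). Then there exist functions $\mathcal{G},\mathcal{K},\mathcal{M}$ of $(t,r)$ satisfying $$2(k_1-k_4a)=\partial_t\mathcal{G},\quad 2(k_2-k_6a)=\partial_r\mathcal{G},\quad k_8=\partial_t\mathcal{K},\quad k_9=\partial_r\mathcal{K},$$ $$e^{-(\mathcal{G}-2\mathcal{K})}bk_6=\tfrac12\partial_r\mathcal{M},\quad e^{-(\mathcal{G}-2\mathcal{K})}bk_4=\tfrac12\partial_t\mathcal{M},$$ such that: 1. $L$ must be of the form $$L=(e^{\mathcal{G}}u^2)\,\Theta\left(ze^{-(\mathcal{G}-2\mathcal{K})}+\mathcal{M}\right),\qquad z:=\frac{v}{u^2},$$ where $\Theta$ is a (free) function of a single variable. 2. $L$ is affinely equivalent to the spatially spherically symmetric pseudo-Riemannian metric $$\mathbf{A}=ve^{2\mathcal{K}}+(e^{\mathcal{G}}\mathcal{M})u^2.$$ 3. $\dim\mathcal{V}(\mathcal{D}_{\mathcal{H}})\leq2$ and the Ricci tensor of the canonical affine connection of $L$ is symmetric.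
   Context: $M\subset\mathbb{R}^4\setminus\{0\}$ is open, with spherical coordinates $(x^a)=(t,r,\theta,\phi)$; $(x^a,\dot x^a)$ are the induced coordinates on $TM$, $\partial_a=\partial/\partial x^a$, $\dot\partial_a=\partial/\partial\dot x^a$, $w^2=\dot\theta^2+\dot\phi^2\sin^2\theta$. A conic subbundle is an open $\mathcal{A}\subset TM\setminus0$ projecting onto $M$ and stable under positive rescaling of vectors. A (pseudo-)Finsler function is a smooth $L:\mathcal{A}\to\mathbb{R}$, positively 2-homogeneous in $\dot x$, with nonsingular Hessian $g_{ab}=\frac12\dot\partial_a\dot\partial_bL$ (any signature). It is (pseudo-)Riemannian if $L=a_{ab}(x)\dot x^a\dot x^b$, non-Riemannian otherwise. With $G^a=\frac14g^{ab}(\dot x^c\partial_c\dot\partial_bL-\partial_bL)$, $L$ is Berwald if $2G^c=\Gamma^c_{ab}(x)\dot x^a\dot x^b$ for a torsion-free affine connection $\nabla$ on $M$ (its canonical affine connection). Two Berwald metrics are affinely equivalent if they have the same canonical connection (for a pseudo-Riemannian metric this is the Levi-Civita connection). $\delta_a=\partial_a-\Gamma^c_{ab}\dot x^b\dot\partial_c$; $\mathcal{D}_{\mathcal{H}}=\mathrm{Span}\{\delta_a,[\delta_a,\delta_b],[\delta_a,[\delta_b,\delta_c]],\dots\}=\mathrm{Span}\{\delta_a\}\oplus\mathcal{V}(\mathcal{D}_{\mathcal{H}})$ on $\mathcal{A}$, where $\mathcal{V}(\mathcal{D}_{\mathcal{H}})\subset\mathrm{Span}\{\dot\partial_a\}$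 is the vertical part; dimension means fibre dimension. Curvature: $[\delta_b,\delta_c]=R^a{}_{bc}\dot\partial_a$, $R_b{}^a{}_{cd}=\dot\partial_bR^a{}_{cd}$; Ricci tensor $R_{bc}=R_b{}^a{}_{ca}$. $L$ is spatially spherically symmetric if $L=L(t,r,\dot t,\dot r,w)$ (invariance under $SO(3)$ rotations fixing $t$). Its canonical connection has the coefficients, with $k_i=k_i(t,r)$: $\Gamma^t_{tt}=k_1$, $\Gamma^t_{tr}=k_2$, $\Gamma^t_{rr}=k_3$, $\Gamma^r_{tt}=k_4$, $\Gamma^r_{rr}=k_5$, $\Gamma^r_{tr}=k_6$, $\Gamma^t_{\theta\theta}=\Gamma^t_{\phi\phi}/\sin^2\theta=k_7$, $\Gamma^\phi_{\phi t}=\Gamma^\theta_{\theta t}=k_8$, $\Gamma^\phi_{\phi r}=\Gamma^\theta_{\theta r}=k_9$, $\Gamma^r_{\theta\theta}=\Gamma^r_{\phi\phi}/\sin^2\theta=k_{10}$, $\Gamma^\theta_{\phi\phi}=-\sin\theta\cos\theta$, $\Gamma^\phi_{\theta\phi}=\cot\theta$, the remaining ones (up to lower-index symmetry) being zero. Curvature functions (commas are partial derivatives): $a_1=k_{1,r}-k_{2,t}+k_3k_4-k_2k_6$, $a_2=k_{2,r}-k_{3,t}+k_2^2+k_3k_6-k_1k_3-k_2k_5$, $a_3=k_{4,r}-k_{6,t}+k_1k_6+k_4k_5-k_2k_4-k_6^2$, $a_4=k_{6,r}-k_{5,t}+k_2k_6-k_3k_4$, $a_5=k_{8,r}-k_{9,t}$,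 $a_6=-k_{7,t}+k_7k_8-k_1k_7-k_2k_{10}$, $a_7=-k_{10,t}+k_8k_{10}-k_4k_7-k_6k_{10}$, $a_8=-k_{8,t}+k_1k_8+k_4k_9-k_8^2$, $a_9=-k_{9,t}+k_2k_8+k_6k_9-k_8k_9$, $a_{10}=-k_{7,r}+k_7k_9-k_2k_7-k_3k_{10}$, $a_{11}=-k_{10,r}+k_9k_{10}-k_6k_7-k_5k_{10}$, $a_{12}=-k_{8,r}+k_2k_8+k_6k_9-k_8k_9$, $a_{13}=-k_{9,r}+k_3k_8+k_5k_9-k_9^2$. Class 3: non-Riemannian spatially spherically symmetric Berwald metrics $L$ whose canonical connection has $k_7,\dots,k_{10}$ not all zero, with $k_{10}\neq0$ (the paper's convention), and, with $a=k_7/k_{10}$, $b=k_8/k_{10}$, $c=(k_9k_{10}-k_7k_8)/k_{10}^2$, satisfies $D=E=F=0$, where $D=aa_3-a_1+a_5$, $E=ba_3$, $F=aa_3-a_1$. As for all non-Riemannian metrics with $k_{10}\ne0$, the connection satisfies $b(aa_1+a_2)+(ab+c)(aa_3+a_4)-a_5(2ab+c)=0$, $a(aa_3+a_4)-(aa_1+a_2)=0$, $(ab+c)a_3+b(aa_3+a_4)+b(a_1-2a_5)=0$, $a_6=aa_7$, $a_8=ba_7$, $a_9=(ab+c)a_7$, $a_{10}=aa_{11}$, $a_{12}=ba_{11}$, $a_{13}=(ab+c)a_{11}$. In this class $[\delta_t,\delta_r]=0$, and $b$ and $c$ cannot simultaneously vanish. Notation: $u=\dot t-a\dot r$, $v=c\dot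 r^2+2b\dot t\dot r-w^2$.
   Formalization: G, K, M are asserted over open (t,r)-rectangles; one Θ is asserted only locally or where level sets of its argument are connected, off u=0 and off points where the fibre derivative of z vanishes, since a single global Θ fails, e.g. with different Θ on ṫ>0 and ṫ<0. *)

(* Defs.v *)
(* MathComp / MathComp-Analysis, over an arbitrary R : realType. *)
From mathcomp Require Export all_boot all_order all_algebra.
From mathcomp Require Export all_classical all_reals all_analysis.

Set Implicit Arguments.
Unset Strict Implicit.
Unset Printing Implicit Defensive.

Export Order.TTheory GRing.Theory Num.Theory.
Export numFieldNormedType.Exports.

Local Open Scope classical_set_scope.
Local Open Scope ring_scope.

(* The base manifold is described by its coordinate image: a point is the
   4-tuple x = (t, r, theta, phi), and a tangent vector is p = (x, y) with
   y the 4-tuple of its components in the coordinate frame. *)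
Notation TM R := ('rV[R]_4 * 'rV[R]_4)%type.

Definition i_t : 'I_4 := @Ordinal 4 0 isT.
Definition i_r : 'I_4 := @Ordinal 4 1 isT.
Definition i_th : 'I_4 := @Ordinal 4 2 isT.
Definition i_ph : 'I_4 := @Ordinal 4 3 isT.

Section Calculus.
Variable R : realType.

(* C^n at the points of S (meant for open S): Frechet differentiable, with all
   directional derivatives of class C^(n-1). *)
Fixpoint Cn (V : normedModType R) (n : nat) (S : set V) (f : V -> R) : Prop :=
  match n with
  | 0 => forall x, S x -> {for x, continuous f}
  | n'.+1 => (forall x, S x -> differentiable f x) /\
             (forall v : V, Cn n' S (fun x => 'D_v f x))
  end.

Definition smooth_on (V : normedModType R) (S : set V) (f : V -> R) : Prop :=
  forall n, Cn n S f.

Definition basis (a : 'I_4) : 'rV[R]_4 := delta_mx 0 a.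
Definition pd (a : 'I_4) (f : TM R -> R) (p : TM R) : R := 'D_(basis a, 0) f p.
Definition vd (a : 'I_4) (f : TM R -> R) (p : TM R) : R := 'D_(0, basis a) f p.

Definition d_t (f : R * R -> R) (q : R * R) : R := 'D_(1, 0) f q.
Definition d_r (f : R * R -> R) (q : R * R) : R := 'D_(0, 1) f q.

Definition lie_bracket (X Y : TM R -> TM R) : TM R -> TM R :=
  fun p => 'D_(X p) Y p - 'D_(Y p) X p.

End Calculus.

Section Finsler.
Variable R : realType.

Definition conic_subbundle (M : set 'rV[R]_4) (A : set (TM R)) : Prop :=
  [/\ open A,
      (forall p, A p -> M p.1 /\ p.2 != 0),
      (forall x, M x -> exists y, A (x, y)) &
      (forall x y (l : R), 0 < l -> A (x, y) -> A (x, l *: y))].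

Definition slit_tangent (M : set 'rV[R]_4) : set (TM R) :=
  [set p | M p.1 /\ p.2 != 0].

Definition restr_over (M : set 'rV[R]_4) (A : set (TM R)) : set (TM R) :=
  [set p | A p /\ M p.1].

Definition hessian (L : TM R -> R) (p : TM R) : 'M[R]_4 :=
  \matrix_(a, b) (2^-1 * vd a (vd b L) p).

Definition pseudo_finsler (M : set 'rV[R]_4) (A : set (TM R))
    (L : TM R -> R) : Prop :=
  [/\ conic_subbundle M A,
      smooth_on A L,
      (forall x y (l : R), 0 < l -> A (x, y) ->
         L (x, l *: y) = l ^+ 2 * L (x, y)) &
      (forall p, A p -> hessian L p \in unitmx)].

Definition riemannian (A : set (TM R)) (L : TM R -> R) : Prop :=
  exists g : 'rV[R]_4 -> 'M[R]_4, forall p, A p ->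
    L p = \sum_(a < 4) \sum_(b < 4) g p.1 a b * p.2 0 a * p.2 0 b.

Definition spray (L : TM R -> R) (a : 'I_4) (p : TM R) : R :=
  4^-1 * \sum_(b < 4) invmx (hessian L p) a b *
    (\sum_(c < 4) p.2 0 c * pd c (vd b L) p - pd b L p).

(* Gam x c a b stands for Gamma^c_{ab}(x). *)
Definition connection := 'rV[R]_4 -> 'I_4 -> 'I_4 -> 'I_4 -> R.

Definition torsion_free_connection (M : set 'rV[R]_4) (Gam : connection) :=
  (forall c a b, smooth_on M (fun x => Gam x c a b)) /\
  (forall x c a b, M x -> Gam x c a b = Gam x c b a).

Definition berwald_with (M : set 'rV[R]_4) (A : set (TM R)) (L : TM R -> R)
    (Gam : connection) : Prop :=
  [/\ pseudo_finsler M A L,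
      torsion_free_connection M Gam &
      (forall p c, A p -> 2 * spray L c p =
         \sum_(a < 4) \sum_(b < 4) Gam p.1 c a b * p.2 0 a * p.2 0 b)].

Definition affinely_equivalent (M : set 'rV[R]_4)
    (A1 : set (TM R)) (L1 : TM R -> R)
    (A2 : set (TM R)) (L2 : TM R -> R) : Prop :=
  exists Gam, berwald_with M A1 L1 Gam /\ berwald_with M A2 L2 Gam.

Definition delta_h (Gam : connection) (a : 'I_4) (p : TM R) : TM R :=
  (basis R a, - \row_(c < 4) \sum_(b < 4) Gam p.1 c a b * p.2 0 b).

Inductive horizontal_bracket (Gam : connection) : (TM R -> TM R) -> Prop :=
| hb_delta a : horizontal_bracket Gam (delta_h Gam a)
| hb_bracket a Y : horizontal_bracket Gam Y ->
    horizontal_bracket Gam (lie_bracket (delta_h Gam a) Y).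

Definition DH (Gam : connection) (p : TM R) : set (TM R) :=
  [set X | exists (n : nat) (Y : 'I_n -> TM R -> TM R) (c : 'I_n -> R),
     (forall i, horizontal_bracket Gam (Y i)) /\
     X = \sum_(i < n) c i *: Y i p].

Definition VDH (Gam : connection) (p : TM R) : set (TM R) :=
  [set X | DH Gam p X /\ X.1 = 0].

Definition dim_le (S : set (TM R)) (n : nat) : Prop :=
  exists W : {vspace (TM R)}, (forall X, S X <-> X \in W) /\ (\dim W <= n)%N.

(* R^a_{bc}, where [delta_b, delta_c] = R^a_{bc} vd_a *)
Definition curvature (Gam : connection) (a b c : 'I_4) (p : TM R) : R :=
  (lie_bracket (delta_h Gam b) (delta_h Gam c) p).2 0 a.

Definition ricci (Gam : connection) (b c : 'I_4) (p : TM R) : R :=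
  \sum_(a < 4) vd b (curvature Gam a c a) p.

End Finsler.

Section Spherical.
Variable R : realType.

(* The polar angle lies in ]0, pi[; no branch of the azimuth is fixed. *)
Definition spherical_domain (M : set 'rV[R]_4) : Prop :=
  open M /\
  forall x, M x -> [/\ 0 < x 0 i_r, 0 < x 0 i_th & x 0 i_th < pi].

Definition tr_proj (x : 'rV[R]_4) : R * R := (x 0 i_t, x 0 i_r).

Definition wsq (p : TM R) : R :=
  p.2 0 i_th ^+ 2 + p.2 0 i_ph ^+ 2 * sin (p.1 0 i_th) ^+ 2.

Definition spherically_symmetric (A : set (TM R)) (L : TM R -> R) : Prop :=
  exists l : R -> R -> R -> R -> R -> R, forall p, A p ->
    L p = l (p.1 0 i_t) (p.1 0 i_r) (p.2 0 i_t) (p.2 0 i_r)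
            (Num.sqrt (wsq p)).

Record coeffs := Coeffs {
  k1 : R * R -> R; k2 : R * R -> R; k3 : R * R -> R; k4 : R * R -> R;
  k5 : R * R -> R; k6 : R * R -> R; k7 : R * R -> R; k8 : R * R -> R;
  k9 : R * R -> R; k10 : R * R -> R }.

Implicit Types (k : coeffs) (q : R * R).

Definition sph_conn k : connection R := fun x c a b =>
  let q := tr_proj x in
  let th := x 0 i_th in
  (match nat_of_ord c, nat_of_ord a, nat_of_ord b with
   | 0, 0, 0 => k1 k q
   | 0, 0, 1 | 0, 1, 0 => k2 k q
   | 0, 1, 1 => k3 k q
   | 1, 0, 0 => k4 k q
   | 1, 1, 1 => k5 k q
   | 1, 0, 1 | 1, 1, 0 => k6 k q
   | 0, 2, 2 => k7 k q
   | 0, 3, 3 => (k7 k q * sin th ^+ 2)%R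
   | 2, 2, 0 | 2, 0, 2 | 3, 3, 0 | 3, 0, 3 => k8 k q
   | 2, 2, 1 | 2, 1, 2 | 3, 3, 1 | 3, 1, 3 => k9 k q
   | 1, 2, 2 => k10 k q
   | 1, 3, 3 => (k10 k q * sin th ^+ 2)%R
   | 2, 3, 3 => (- (sin th * cos th))%R
   | 3, 2, 3 | 3, 3, 2 => (cos th / sin th)%R
   | _, _, _ => 0%R
   end)%N.

Definition a1 k q := d_r (k1 k) q - d_t (k2 k) q + k3 k q * k4 k q - k2 k q * k6 k q.
Definition a2 k q := d_r (k2 k) q - d_t (k3 k) q + k2 k q ^+ 2 + k3 k q * k6 k q
  - k1 k q * k3 k q - k2 k q * k5 k q.
Definition a3 k q := d_r (k4 k) q - d_t (k6 k) q + k1 k q * k6 k q + k4 k q * k5 k q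
  - k2 k q * k4 k q - k6 k q ^+ 2.
Definition a4 k q := d_r (k6 k) q - d_t (k5 k) q + k2 k q * k6 k q - k3 k q * k4 k q.
Definition a5 k q := d_r (k8 k) q - d_t (k9 k) q.
Definition a6 k q := - d_t (k7 k) q + k7 k q * k8 k q - k1 k q * k7 k q
  - k2 k q * k10 k q.
Definition a7 k q := - d_t (k10 k) q + k8 k q * k10 k q - k4 k q * k7 k q
  - k6 k q * k10 k q.
Definition a8 k q := - d_t (k8 k) q + k1 k q * k8 k q + k4 k q * k9 k q - k8 k q ^+ 2.
Definition a9 k q := - d_t (k9 k) q + k2 k q * k8 k q + k6 k q * k9 k q
  - k8 k q * k9 k q.
Definition a10 k q := - d_r (k7 k) q + k7 k q * k9 k q - k2 k q * k7 k q
  - k3 k q * k10 k q.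
Definition a11 k q := - d_r (k10 k) q + k9 k q * k10 k q - k6 k q * k7 k q
  - k5 k q * k10 k q.
Definition a12 k q := - d_r (k8 k) q + k2 k q * k8 k q + k6 k q * k9 k q
  - k8 k q * k9 k q.
Definition a13 k q := - d_r (k9 k) q + k3 k q * k8 k q + k5 k q * k9 k q - k9 k q ^+ 2.

Definition fa k q := k7 k q / k10 k q.
Definition fb k q := k8 k q / k10 k q.
Definition fc k q := (k9 k q * k10 k q - k7 k q * k8 k q) / k10 k q ^+ 2.

Definition curvature_relations k q : Prop :=
  let a := fa k q in let b := fb k q in let c := fc k q in
  [/\ b * (a * a1 k q + a2 k q) + (a * b + c) * (a * a3 k q + a4 k q)
        - a5 k q * (2 * a * b + c) = 0,
      a * (a * a3 k q + a4 k q) - (a * a1 k q + a2 k q) = 0 &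
      (a * b + c) * a3 k q + b * (a * a3 k q + a4 k q)
        + b * (a1 k q - 2 * a5 k q) = 0] /\
  [/\ a6 k q = a * a7 k q, a8 k q = b * a7 k q & a9 k q = (a * b + c) * a7 k q] /\
  [/\ a10 k q = a * a11 k q, a12 k q = b * a11 k q &
      a13 k q = (a * b + c) * a11 k q].

Definition fD k q := fa k q * a3 k q - a1 k q + a5 k q.
Definition fE k q := fb k q * a3 k q.
Definition fF k q := fa k q * a3 k q - a1 k q.

(* The k_i are functions on the image tr_proj @` M of M in the (t, r)-plane. *)
Definition class3 (M : set 'rV[R]_4) (A : set (TM R)) (L : TM R -> R) k : Prop :=
  [/\ spherical_domain M,
      berwald_with M A L (sph_conn k),
      spherically_symmetric A L &
      ~ riemannian A L] /\
  (forall q, (tr_proj @` M) q ->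
     [/\ k10 k q != 0, curvature_relations k q &
         [/\ fD k q = 0, fE k q = 0 & fF k q = 0]]).

Definition u_ k (p : TM R) : R := p.2 0 i_t - fa k (tr_proj p.1) * p.2 0 i_r.
Definition v_ k (p : TM R) : R :=
  fc k (tr_proj p.1) * p.2 0 i_r ^+ 2
  + 2 * fb k (tr_proj p.1) * p.2 0 i_t * p.2 0 i_r - wsq p.
Definition z_ k (p : TM R) : R := v_ k p / u_ k p ^+ 2.

Definition potentials k (U : set (R * R)) (G K Mf : R * R -> R) : Prop :=
  [/\ smooth_on U G, smooth_on U K & smooth_on U Mf] /\
  forall q, U q ->
  [/\ 2 * (k1 k q - k4 k q * fa k q) = d_t G q,
      2 * (k2 k q - k6 k q * fa k q) = d_r G q,
      k8 k q = d_t K q & k9 k q = d_r K q] /\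
  [/\ expR (- (G q - 2 * K q)) * fb k q * k6 k q = 2^-1 * d_r Mf q &
      expR (- (G q - 2 * K q)) * fb k q * k4 k q = 2^-1 * d_t Mf q].

(* The argument of the free function Theta; meaningful where u != 0. *)
Definition sarg k (G K Mf : R * R -> R) (p : TM R) : R :=
  let q := tr_proj p.1 in z_ k p * expR (- (G q - 2 * K q)) + Mf q.

Definition Lform k (G K Mf : R * R -> R) (Theta : R -> R) (p : TM R) : R :=
  (expR (G (tr_proj p.1)) * u_ k p ^+ 2) * Theta (sarg k G K Mf p).

Definition has_form k (G K Mf : R * R -> R) (L : TM R -> R) (W : set (TM R)) :=
  exists Theta : R -> R,
    smooth_on (sarg k G K Mf @` W) Theta /\
    forall p, W p -> L p = Lform k G K Mf Theta p.

(* The points of A where z is defined and not fibrewise critical.  At a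
   fibrewise critical point of z the level sets of z may separate every
   neighbourhood (like the two nappes of a cone), and two different functions
   Theta may then occur on the two sides of a single smooth L.  The excluded
   points form a closed nowhere dense subset of A. *)
Definition regular_part k (A : set (TM R)) : set (TM R) :=
  [set p | [/\ A p, u_ k p != 0 & exists y : 'rV[R]_4, 'D_(0, y) (z_ k) p != 0]].

Definition level_connected (f : TM R -> R) (W : set (TM R)) : Prop :=
  forall s : R, connected [set p | W p /\ f p = s].

Definition Ametric k (G K Mf : R * R -> R) (p : TM R) : R :=
  let q := tr_proj p.1 in
  v_ k p * expR (2 * K q) + (expR (G q) * Mf q) * u_ k p ^+ 2.

End Spherical.

(* Main.v *)
(** Vanishing of b and c would mean k_8 = k_9 = 0; invariance of L along the
    angular horizontal fields would then annihilate its derivative along the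
    constant fibre direction (k_7, k_10, 0, 0), against the nonsingular Hessian.
    As (b, c) is not 0, the relations with D = E = F = 0 force
    a_1 = ... = a_5 = 0.  Hence the one-forms
    2(k_1 - k_4 a) dt + 2(k_2 - k_6 a) dr, k_8 dt + k_9 dr and
    2 e^(-(G - 2K)) b (k_4 dt + k_6 dr) are closed, and G, K, M are their
    primitives on a rectangle.  The relations on a_6, ..., a_13 are structure
    equations for the derivatives of a, b, c, and they make both the linear form
    e^(G/2) u and the quadratic form A parallel.

    A parallel function which is rotationally invariant and homogeneous of
    degree 0 is constrained by the Euler field, the rotation field and the
    angular horizontal fields: its differential is determined up to a factor off
    u = 0.  So L / (e^G u^2) and A / (e^G u^2) have proportional differentials,
    and the former is locally a function Theta of the latter.

    The constant of integration in M is chosen so that A is nondegenerate.  An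
    iterated bracket of the delta_a is a field of the form (c, y B(x)) which
    annihilates e^(G/2) u and A.  When it is vertical, B is skew for A and kills
    the fixed covector of u, so y B ranges in a space of dimension at most 2 and
    tr B = 0; by the first Bianchi identity tr B = 0 is the symmetry of the
    Ricci tensor. *)

From HB Require Import structures.
From mathcomp Require Import ring lra.
Require Import Defs.
Set Implicit Arguments.
Unset Strict Implicit.
Unset Printing Implicit Defensive.
Local Open Scope classical_set_scope.
Local Open Scope ring_scope.

(** * Derivatives and functions of class C^n *)

(** Everything is reduced to the first-order equations [delta_a f = 0]. For a 2-homogeneous function
    with nonsingular Hessian they are equivalent to having the given torsion-free connection as
    canonical connection. This turns the hypothesis on [L] into parallelism, and turns parallelism
    of the metric [A] and of the functions built from a free [Theta] back into the Berwald property.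

    The main obstacle is the passage from proportional differentials to a function [Theta].
    Proportionality only makes L / (e^G u^2) constant along curves inside a level set, so one
    [Theta] is found near each noncritical point, or on an open set whose level sets are connected.
    Smoothness of [Theta] follows by induction on the order: its derivative is a quotient of
    derivatives that factors through the same function.

    For the nondegeneracy of [A], one point of a rectangle is enough. The determinant of its
    (t,r)-block, multiplied by e^(-P) with dP twice the trace of the connection on that block, is
    constant; P exists since a_1 + a_4 = 0. *)

Section DerivativeRules.
Variables (R : realType) (V : normedModType R).
Implicit Types (f g : V -> R) (x v : V).

Lemma is_derive_unique f x v (d e : R) :
  is_derive x v f d -> is_derive x v f e -> d = e.
Proof. by move=> [_ <-] [_ <-]. Qed.

Lemma is_derive_add f g x v (df dg : R) : is_derive x v f df -> is_derive x v g dg ->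
  is_derive x v (fun y => f y + g y) (df + dg).
Proof. by move=> ? ?; exact: is_deriveD. Qed.

Lemma is_derive_opp f x v (df : R) : is_derive x v f df ->
  is_derive x v (fun y => - f y) (- df).
Proof. by move=> ?; exact: is_deriveN. Qed.

Lemma is_derive_mul f g x v (df dg : R) : is_derive x v f df -> is_derive x v g dg ->
  is_derive x v (fun y => f y * g y) (df * g x + f x * dg).
Proof.
move=> hf hg; apply: (@is_derive_eq _ _ _ _ _ _ _ (f x *: dg + g x *: df)).
  have := @is_deriveM _ _ f g x v df dg hf hg.
  rewrite (_ : f * g = fun y => f y * g y) //.
by rewrite addrC /GRing.scale/= [g x * _]mulrC.
Qed.

Lemma is_derive_sum_fun n (F : 'I_n -> V -> R) x v (dF : 'I_n -> R) :
  (forall i, is_derive x v (F i) (dF i)) ->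
  is_derive x v (fun y => \sum_i F i y) (\sum_i dF i).
Proof.
move=> h; rewrite [X in is_derive _ _ X _](_ : _ = \sum_i F i); last first.
  by apply/funext => y; rewrite fct_sumE.
exact: is_derive_sum.
Qed.

Lemma is_derive_expn f n x v (df : R) : is_derive x v f df ->
  is_derive x v (fun y => f y ^+ n) (n%:R * f x ^+ n.-1 * df).
Proof.
move=> ?; rewrite [X in is_derive _ _ X _](_ : _ = f ^+ n); last first.
  by apply/funext => y; rewrite exprfctE.
exact: is_deriveX.
Qed.

Lemma is_derive_inv f x v (df : R) : f x != 0 -> is_derive x v f df ->
  is_derive x v (fun y => (f y)^-1) (- (f x) ^- 2 * df).
Proof.
move=> fx [dfx <-]; apply: DeriveDef; first exact: derivableV.
by rewrite deriveV.
Qed.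

(** Only a directional derivative of [f] is given, so both sides are restricted to the line through
    [x] along [v], where the one-variable chain rule applies. *)
Lemma is_derive_comp1 (phi : R -> R) (dphi df : R) f x v :
  is_derive (f x) 1 phi dphi -> is_derive x v f df ->
  is_derive x v (fun y => phi (f y)) (dphi * df).
Proof.
move=> dp [dfx <-].
have d1 : derivable (fun h : R => f (h *: v + x)) 0 1.
  by move/derivable1P: dfx.
have e (g : V -> R) : 'D_v g x = 'D_1 (fun h : R => g (h *: v + x)) 0.
  rewrite /derive; set g1 := (fun h => _); set g2 := (fun h : R => h^-1 *: _ in RHS).
  suff -> : g1 = g2 by [].
  by apply/funext => h; rewrite /g1 /g2 /= addr0 scale0r add0r [_%:A]mulr1.
have dp' : is_derive ((fun h : R => f (h *: v + x)) 0) 1 phi dphi.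
  by rewrite scale0r add0r.
have := is_derive1_comp dp' (derivableP d1).
rewrite -e => -[dc ec]; apply: DeriveDef.
  exact/derivable1P.
by rewrite -ec e.
Qed.

Lemma is_derive_diff f x v : differentiable f x -> is_derive x v f ('D_v f x).
Proof. by move=> fx; apply/derivableP/diff_derivable. Qed.

Lemma derive_lin f x (a : R) v w : differentiable f x ->
  'D_(a *: v + w) f x = a * 'D_v f x + 'D_w f x.
Proof. by move=> fx; rewrite !deriveE// linearP. Qed.

Lemma derive_addv f x v w : differentiable f x ->
  'D_(v + w) f x = 'D_v f x + 'D_w f x.
Proof. by move=> fx; rewrite !deriveE// linearD. Qed.

Lemma derive_scalev f x (a : R) v : differentiable f x ->
  'D_(a *: v) f x = a * 'D_v f x.
Proof. by move=> fx; rewrite !deriveE// linearZ. Qed.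

Lemma derive_sumv n f x (a : 'I_n -> R) (v : 'I_n -> V) : differentiable f x ->
  'D_(\sum_i a i *: v i) f x = \sum_i a i * 'D_(v i) f x.
Proof.
move=> fx; rewrite deriveE// linear_sum; apply: eq_bigr => i _.
by rewrite linearZ deriveE.
Qed.

End DerivativeRules.

Lemma is_derive_comp (R : realType) (U V : normedModType R) (g : U -> V)
    (f : V -> R) (x v : U) : differentiable g x -> differentiable f (g x) ->
  is_derive x v (fun y => f (g y)) ('D_('D_v g x) f (g x)).
Proof.
move=> dg df; have dfg : differentiable (f \o g) x by exact: differentiable_comp.
apply: DeriveDef; first exact/diff_derivable.
by rewrite deriveE// diff_comp//= !deriveE.
Qed.

Lemma is_derive_line (R : realType) (V : normedModType R) (f : V -> R) (x v : V)
    (t : R) : differentiable f (x + t *: v) ->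
  is_derive t 1 (fun s : R => f (x + s *: v)) ('D_v f (x + t *: v)).
Proof.
move=> df; have dz : is_diff t (fun s : R => s *: v) ( *:%R^~ v).
  exact: is_diff_scalel.
have dg : is_diff t (fun s : R => x + s *: v) ( *:%R^~ v).
  have := is_diffD (is_diff_cst x t) dz.
  by rewrite add0r.
case: dg => dg eg; have := is_derive_comp (1 : R) dg df.
have e1 : 'D_(1 : R^o) (fun s : R^o => x + s *: v) t = v.
  by rewrite (@deriveE _ R^o V _ _ _ dg) eg scale1r.
move=> h; apply: is_derive_eq h _; congr ('D_ _ f _); exact: e1.
Qed.

Section Differentiability.
Variables (R : realType) (V : normedModType R).
Implicit Types (f g : V -> R) (x : V).

(** The epsilon form of Fréchet differentiability, through which functions known only by explicit
    bounds, such as [Theta], become differentiable. *)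
Lemma differentiable_of_estimate f (df : {linear V -> R}) x : continuous df ->
  (forall e : R, 0 < e -> \forall h \near (0 : V), `|f (h + x) - (f x + df h)| <= e * `|h|) ->
  differentiable f x.
Proof.
move=> cdf H; have E : f \o shift x = cst (f x) + df +o_ (0 : V) id.
  by apply/eqaddoP => e e0; exact: H.
have D := diff_unique cdf E.
by apply/diff_locallyP; rewrite D.
Qed.

Lemma differentiable_estimate f x : differentiable f x ->
  forall e : R, 0 < e ->
  \forall h \near (0 : V), `|f (h + x) - (f x + 'd f x h)| <= e * `|h|.
Proof.
move=> /diff_locally /eqaddoP H e e0; exact: H.
Qed.

Lemma near_differentiable f g x : (\near x, f x = g x) ->
  differentiable f x -> differentiable g x.
Proof.
move=> fg dfx; apply: (@differentiable_of_estimate _ ('d f x)).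
  by have /diff_locallyP[] := dfx.
move=> e e0; rewrite -(nbhs_singleton fg).
move: fg; rewrite (near_shift 0) => fg.
near=> h.
have <- : f (h + x) = g (h + x).
  near: h; move: fg; rewrite /= subr0; apply: filterS => h /=.
  by rewrite /= ?subr0.
near: h; exact: differentiable_estimate.
Unshelve. all: by end_near. Qed.

End Differentiability.

Section Cn_theory.
Variables (R : realType) (V : normedModType R).
Implicit Types (f g : V -> R) (S T : set V) (n : nat).

Lemma Cn_le n S f : Cn n.+1 S f -> Cn n S f.
Proof.
elim: n f => [|n ih] f [fd fD].
  by move=> x Sx; apply/differentiable_continuous/fd.
by split=> // v; apply: ih; exact: fD.
Qed.

Lemma Cn_sub n S T f : T `<=` S -> Cn n S f -> Cn n T f.
Proof.
move=> TS; elim: n f => [|n ih] f /=; first by move=> h x /TS; exact: h.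
by move=> [fd fD]; split=> [x /TS|v]; [exact: fd|exact/ih].
Qed.

Lemma Cn_eq n S f g : open S -> (forall x, S x -> f x = g x) -> Cn n S f -> Cn n S g.
Proof.
move=> oS; elim: n f g => [|n ih] f g fg.
  move=> fc x Sx; have xS : nbhs x S by apply: open_nbhs_nbhs.
  have e : \near x, f x = g x by apply: filterS xS => y; exact: fg.
  have := fc x Sx; rewrite /prop_for /continuous_at (fg x Sx) => h.
  by apply: cvg_trans h; exact: near_eq_cvg.
move=> [fd fD]; split=> [x Sx|v].
  have xS : nbhs x S by apply: open_nbhs_nbhs.
  by apply: near_differentiable (fd x Sx); apply: filterS xS => y; exact: fg.
apply: ih (fD v) => x Sx; apply: near_eq_derive.
have xS : nbhs x S by apply: open_nbhs_nbhs.
by apply: filterS xS => y; exact: fg.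
Qed.

(** Each clause of [Cn] concerns [f] at single points of the set, so it passes to arbitrary unions;
    regularity can therefore be checked on a different set around each point. *)
Lemma Cn_bigcup n (I : Type) (F : I -> set V) f :
  (forall i, Cn n (F i) f) -> Cn n (\bigcup_i F i) f.
Proof.
elim: n f => [|n ih] f h; first by move=> x [i _ Fx]; exact: h Fx.
split=> [x [i _ Fx]|v]; first exact: (h i).1.
by apply: (ih (fun x => 'D_v f x)) => i; apply: (h i).2.
Qed.

Lemma Cn_local n S f : (forall x, S x -> exists T, T x /\ Cn n T f) -> Cn n S f.
Proof.
move=> h; apply: (@Cn_sub _ (\bigcup_(T : {T : set V | Cn n T f}) proj1_sig T)).
  by move=> x /h[T [Tx fT]]; exists (exist _ T fT).
by apply: Cn_bigcup => -[T fT].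
Qed.

Lemma Cn_cst n S (c : R) : Cn n S (fun=> c).
Proof.
elim: n c => [|n ih] c; first by move=> x _; exact: cvg_cst.
split=> [x _|v]; first exact: differentiable_cst.
have -> : 'D_v (fun=> c) = (fun=> 0) :> (V -> R).
  by apply/funext => x; rewrite derive_cst.
exact: ih.
Qed.

Lemma Cn_add n S f g : open S -> Cn n S f -> Cn n S g -> Cn n S (fun x => f x + g x).
Proof.
move=> oS; elim: n f g => [|n ih] f g; first by move=> fc gc x Sx; apply: cvgD; [exact: fc|exact: gc].
move=> [fd fD] [gd gD]; split=> [x Sx|v]; first by apply: differentiableD; auto.
apply: (Cn_eq oS _ (ih _ _ (fD v) (gD v))) => x Sx /=.
have df := is_derive_diff v (fd x Sx); have dg := is_derive_diff v (gd x Sx).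
by case: (is_derive_add df dg) => _ ->.
Qed.

Lemma Cn_opp n S f : open S -> Cn n S f -> Cn n S (fun x => - f x).
Proof.
move=> oS; elim: n f => [|n ih] f; first by move=> fc x Sx; apply: cvgN; exact: fc.
move=> [fd fD]; split=> [x Sx|v]; first by apply: differentiableN; auto.
apply: (Cn_eq oS _ (ih _ (fD v))) => x Sx /=.
have df := is_derive_diff v (fd x Sx).
by case: (is_derive_opp df) => _ ->.
Qed.

Lemma Cn_sub_fun n S f g : open S -> Cn n S f -> Cn n S g -> Cn n S (fun x => f x - g x).
Proof. by move=> oS Sf Sg; apply: Cn_add => //; exact: Cn_opp. Qed.

Lemma Cn_mul n S f g : open S -> Cn n S f -> Cn n S g -> Cn n S (fun x => f x * g x).
Proof.
move=> oS; elim: n f g => [|n ih] f g; first by move=> fc gc x Sx; apply: cvgM; [exact: fc|exact: gc].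
move=> fC gC; have [fd fD] := fC; have [gd gD] := gC.
split=> [x Sx|v]; first by apply: differentiableM; auto.
apply: (Cn_eq oS _ (Cn_add oS (ih _ _ (fD v) (Cn_le gC)) (ih _ _ (Cn_le fC) (gD v)))) => x Sx /=.
have df := is_derive_diff v (fd x Sx); have dg := is_derive_diff v (gd x Sx).
by case: (is_derive_mul df dg) => _ ->.
Qed.

Lemma Cn_comp n S (phi : R -> R) f : open S -> Cn n (f @` S) phi -> Cn n S f ->
  Cn n S (fun x => phi (f x)).
Proof.
move=> oS; elim: n phi f => [|n ih] phi f.
  move=> pc fc x Sx; apply: (@cvg_comp _ _ _ f phi); first exact: fc.
  by apply: pc; exists x.
move=> [pd pD] fC; have [fd fD] := fC; split=> [x Sx|v].
  by apply: (@differentiable_comp _ _ _ _ f phi); [exact: fd|apply: pd; exists x].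
apply: (Cn_eq oS _ (Cn_mul oS (ih _ _ (pD 1) (Cn_le fC)) (fD v))) => x Sx /=.
have df := is_derive_diff v (fd x Sx).
have dp := @is_derive_diff _ R^o phi (f x) 1 (pd (f x) (ex_intro2 _ _ x Sx erefl)).
by case: (is_derive_comp1 dp df) => _ ->.
Qed.

Lemma Cn_inv n S f : open S -> (forall x, S x -> f x != 0) -> Cn n S f ->
  Cn n S (fun x => (f x)^-1).
Proof.
move=> oS; elim: n f => [|n ih] f f0.
  by move=> fc x Sx; apply: cvgV; [exact: f0|exact: fc].
move=> fC; have [fd fD] := fC; split=> [x Sx|v]; first by apply: differentiableV; auto.
have fi := ih _ f0 (Cn_le fC).
apply: (Cn_eq oS _ (Cn_mul oS (Cn_opp oS (Cn_mul oS fi fi)) (fD v))) => x Sx /=.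
have df := is_derive_diff v (fd x Sx).
by case: (is_derive_inv (f0 x Sx) df) => _ ->; rewrite expr2 invfM.
Qed.

Lemma Cn_div n S f g : open S -> (forall x, S x -> g x != 0) -> Cn n S f -> Cn n S g ->
  Cn n S (fun x => f x / g x).
Proof. by move=> oS g0 Sf Sg; apply: Cn_mul => //; exact: Cn_inv. Qed.

Lemma Cn_expn n m S f : open S -> Cn n S f -> Cn n S (fun x => f x ^+ m).
Proof.
move=> oS Sf; elim: m => [|m ih].
  by apply: Cn_eq (Cn_cst n S 1) => // x _; rewrite expr0.
by apply: (Cn_eq oS _ (Cn_mul oS Sf ih)) => x _; rewrite exprS.
Qed.

Lemma Cn_sum n m S (F : 'I_m -> V -> R) : open S -> (forall i, Cn n S (F i)) ->
  Cn n S (fun x => \sum_i F i x).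
Proof.
move=> oS; elim: m F => [|m ih] F h.
  by apply: (Cn_eq oS _ (Cn_cst n S 0)) => x _; rewrite big_ord0.
have := Cn_add oS (h ord0) (ih (fun i => F (lift ord0 i)) (fun i => h _)).
by apply: Cn_eq => // x _; rewrite big_ord_recl.
Qed.

End Cn_theory.

(** The derivative of [f (a + A x)] along [v] is ['D_(A v) f] at [a + A x], a function of the same
    shape, so the induction on [n] closes. *)
Lemma Cn_linear (R : realType) (U V : normedModType R) n (A : {linear U -> V})
    (a : V) (S : set U) (f : V -> R) : continuous A -> open S ->
  Cn n ((fun x => a + A x) @` S) f -> Cn n S (fun x => f (a + A x)).
Proof.
move=> cA oS; elim: n f => [|n ih] f.
  move=> fc x Sx; apply: (@cvg_comp _ _ _ (fun x => a + A x) f).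
    by apply: cvgD; [exact: cvg_cst|exact: cA].
  by apply: fc; exists x.
have dA x : differentiable (fun x => a + A x) x.
  by apply: differentiableD => //; apply: linear_differentiable; exact: cA.
move=> [fd fD]; split=> [x Sx|v].
  by apply: (@differentiable_comp _ _ _ _ (fun x => a + A x) f) => //; apply: fd; exists x.
apply: (Cn_eq oS _ (ih _ (fD (A v)))) => x Sx /=.
have [_ ->] := is_derive_comp v (dA x) (fd _ (ex_intro2 _ _ x Sx erefl)).
have dAx : is_diff x A A.
  by apply: DiffDef; [apply: linear_differentiable; exact: cA|exact: diff_lin].
have [_ e] := is_diffD (is_diff_cst a x) dAx.
by congr ('D_ _ f _); rewrite deriveE// e add0r.
Qed.

Lemma Cn_expR (R : realType) n (S : set R) : open S -> Cn n S (@expR R).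
Proof.
move=> oS; elim: n => [|n ih]; first by move=> x _; exact: continuous_expR.
split=> [x _|v]; first by apply/derivable1_diffP; exact: derivable_expR.
apply: (Cn_eq oS _ (Cn_mul oS (Cn_cst n S v) ih)) => x Sx /=.
have d : differentiable (@expR R) x by apply/derivable1_diffP; exact: derivable_expR.
by rewrite -[in RHS](mulr1 v) derive_scalev// derive_val.
Qed.

Lemma Cn_sincos (R : realType) n (S : set R) : open S ->
  Cn n S (@sin R) /\ Cn n S (@cos R).
Proof.
move=> oS; elim: n => [|n [ih1 ih2]].
  by split=> x _; [exact: continuous_sin|exact: continuous_cos].
have ds x : differentiable (@sin R) x by apply/derivable1_diffP; exact: derivable_sin.
have dc x : differentiable (@cos R) x by apply/derivable1_diffP; exact: derivable_cos.
split; split=> // v.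
  apply: (Cn_eq oS _ (Cn_mul oS (Cn_cst n S v) ih2)) => x Sx /=.
  by rewrite -[in RHS](mulr1 v) derive_scalev// derive_val.
apply: (Cn_eq oS _ (Cn_mul oS (Cn_cst n S v) (Cn_opp oS ih1))) => x Sx /=.
by rewrite -[in RHS](mulr1 v) derive_scalev// derive_val.
Qed.

Section smooth_theory.
Variables (R : realType) (V : normedModType R).
Implicit Types (f g : V -> R) (S T : set V).

Lemma smooth_cst S (c : R) : smooth_on S (fun=> c).
Proof. by move=> n; exact: Cn_cst. Qed.

Lemma smooth_add S f g : open S -> smooth_on S f -> smooth_on S g ->
  smooth_on S (fun x => f x + g x).
Proof. by move=> oS sf sg n; exact: Cn_add. Qed.

Lemma smooth_opp S f : open S -> smooth_on S f -> smooth_on S (fun x => - f x).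
Proof. by move=> oS sf n; exact: Cn_opp. Qed.

Lemma smooth_mul S f g : open S -> smooth_on S f -> smooth_on S g ->
  smooth_on S (fun x => f x * g x).
Proof. by move=> oS sf sg n; exact: Cn_mul. Qed.

Lemma smooth_div S f g : open S -> (forall x, S x -> g x != 0) ->
  smooth_on S f -> smooth_on S g -> smooth_on S (fun x => f x / g x).
Proof. by move=> oS g0 sf sg n; exact: Cn_div. Qed.

Lemma smooth_expn S f m : open S -> smooth_on S f -> smooth_on S (fun x => f x ^+ m).
Proof. by move=> oS sf n; exact: Cn_expn. Qed.

Lemma smooth_expR S f : open S -> smooth_on S f -> smooth_on S (fun x => expR (f x)).
Proof.
move=> oS sf n; apply: Cn_comp => //.
by apply: (Cn_sub (S := setT)) => //; apply: Cn_expR; exact: openT.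
Qed.

Lemma smooth_sin S f : open S -> smooth_on S f -> smooth_on S (fun x => sin (f x)).
Proof.
move=> oS sf n; apply: Cn_comp => //.
by apply: (Cn_sub (S := setT)) => //; apply: (Cn_sincos n openT).1.
Qed.

Lemma smooth_sub S T f : T `<=` S -> smooth_on S f -> smooth_on T f.
Proof. by move=> TS sf n; exact: Cn_sub TS (sf n). Qed.

Lemma smooth_differentiable S f x : smooth_on S f -> S x -> differentiable f x.
Proof. by move=> sf Sx; have [+ _] := sf 1%N; apply. Qed.

End smooth_theory.

(** * Functions with proportional differentials *)

Section MeanValue.
Variables (R : realType) (V : normedModType R).
Implicit Types (f g : V -> R) (x v w : V) (S : set V).

Lemma continuous_line f x v (t : R) : differentiable f (x + t *: v) ->
  {for t, continuous (fun s : R => f (x + s *: v))}.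
Proof.
move=> /is_derive_line[d _].
exact/differentiable_continuous/derivable1_diffP.
Qed.

Lemma mvt_line f x v :
  (forall t : R, 0 <= t <= 1 -> differentiable f (x + t *: v)) ->
  exists2 c : R, 0 <= c <= 1 & f (x + v) - f x = 'D_v f (x + c *: v).
Proof.
move=> h; pose k (s : R) := f (x + s *: v).
have [] := @MVT_segment R k (fun s => 'D_v f (x + s *: v)) 0 1 ler01.
- move=> t; rewrite in_itv/= => /andP[t0 t1]; apply: is_derive_line; apply: h.
  by rewrite !ltW.
- apply: continuous_in_subspaceT => t; rewrite inE/= in_itv/= => t01.
  exact: continuous_line (h _ t01).
move=> c; rewrite in_itv/= => c01; rewrite /k scale1r scale0r addr0 subr0 mulr1.
by exists c.
Qed.

(** The mean value theorem is used twice: for [F y = f (y + h *: w) - f y] along [h *: v], then for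
    ['D_v f] along [h *: w]. This gives [h ^+ 2] times the mixed derivative at a nearby point, and
    its continuity at [x] yields the bound. *)
Lemma second_difference S f x v w : open S -> Cn 2 S f -> S x ->
  forall e : R, 0 < e -> \forall h \near (0 : R),
  `|f (x + h *: v + h *: w) - f (x + h *: v) - f (x + h *: w) + f x
    - h ^+ 2 * 'D_w ('D_v f) x| <= e * h ^+ 2.
Proof.
move=> oS [fd fD] Sx e e0.
have [fvd fvD] := fD v; have cD := fvD w x Sx.
have [d /= d0 hd] : exists2 d : R, 0 < d & forall y, `|x - y| < d ->
    S y /\ `|'D_w ('D_v f) x - 'D_w ('D_v f) y| <= e.
  have xS : nbhs x S by apply: open_nbhs_nbhs.
  have xc : \forall y \near x, `|'D_w ('D_v f) x - 'D_w ('D_v f) y| <= e.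
    by move/cvgrPdist_le : cD => /(_ e e0).
  have [d d0 hd] := (nbhs_normP _ _).1 (filterI xS xc).
  by exists d => // y yd; exact: hd.
near=> h.
have hh : `|h| * (`|v| + `|w|) < d.
  near: h; exists (d / (`|v| + `|w| + 1)) => /=.
    by rewrite divr_gt0// ltr_wpDl// addr_ge0.
  move=> h; rewrite /= sub0r normrN ltr_pdivlMr; last by rewrite ltr_wpDl// addr_ge0.
  by apply: le_lt_trans; rewrite ler_wpM2l// lerDl.
have close (c c' : R) : 0 <= c <= 1 -> 0 <= c' <= 1 ->
    `|x - (x + c *: (h *: v) + c' *: (h *: w))| < d.
  move=> /andP[c0 c1] /andP[c0' c1']; rewrite -addrA opprD addrA subrr sub0r normrN.
  apply: le_lt_trans hh; rewrite (le_trans (ler_normD _ _))// mulrDr.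
  by rewrite lerD// !normrZ ger0_norm// ler_piMl// mulr_ge0.
have dS (c c' : R) : 0 <= c <= 1 -> 0 <= c' <= 1 ->
    S (x + c *: (h *: v) + c' *: (h *: w)).
  by move=> c01 c01'; have [] := hd _ (close _ _ c01 c01').
have z01 : 0 <= (0 : R) <= 1 by rewrite lexx ler01.
have o01 : 0 <= (1 : R) <= 1 by rewrite lexx ler01.
pose F y := f (y + h *: w) - f y.
have dF (c : R) : 0 <= c <= 1 ->
    is_derive (x + c *: (h *: v)) (h *: v) F
    ('D_(h *: v) f (x + c *: (h *: v) + h *: w) - 'D_(h *: v) f (x + c *: (h *: v))).
  move=> c01; have := dS _ _ c01 z01; rewrite scale0r addr0 => S0.
  have := dS _ _ c01 o01; rewrite scale1r => S1.
  apply: is_derive_add; last first.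
    by apply: is_derive_opp; apply: is_derive_diff; exact: fd.
  have dsh : is_diff (x + c *: (h *: v)) (fun y => y + h *: w) id.
    have := is_diffD (is_diff_id (x + c *: (h *: v))) (is_diff_cst (h *: w) _).
    by rewrite addr0.
  case: dsh => dsh esh.
  have := is_derive_comp (h *: v) dsh (fd _ S1).
  move=> H; apply: is_derive_eq H _; congr ('D_ _ f _).
  by rewrite deriveE// esh.
have dFd (c : R) : 0 <= c <= 1 -> differentiable F (x + c *: (h *: v)).
  move=> c01; have := dS _ _ c01 z01; rewrite scale0r addr0 => S0.
  have := dS _ _ c01 o01; rewrite scale1r => S1.
  apply: differentiableB; last exact: fd.
  apply: (@differentiable_comp _ _ _ _ (fun y => y + h *: w) f); last exact: fd.
  exact: differentiableD.
have [c c01 Ec] := mvt_line dFd.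
have [c' c01' Ec'] : exists2 c' : R, 0 <= c' <= 1 &
    'D_v f (x + c *: (h *: v) + h *: w) - 'D_v f (x + c *: (h *: v)) =
    'D_(h *: w) ('D_v f) (x + c *: (h *: v) + c' *: (h *: w)).
  by apply: (@mvt_line ('D_v f)) => t t01; apply: fvd; exact: dS.
have S0 : S (x + c *: (h *: v)) by have := dS _ _ c01 z01; rewrite scale0r addr0.
have S1 : S (x + c *: (h *: v) + h *: w) by have := dS _ _ c01 o01; rewrite scale1r.
have [_ eF] := dF _ c01.
have -> : f (x + h *: v + h *: w) - f (x + h *: v) - f (x + h *: w) + f x =
    F (x + h *: v) - F x by rewrite /F; ring.
rewrite Ec eF !derive_scalev; [|exact: fd..].
rewrite -mulrBr Ec' derive_scalev; last by apply: fvd; exact: dS.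
rewrite mulrA -expr2 -mulrBr normrM [X in X * _]ger0_norm ?sqr_ge0//.
rewrite [leRHS]mulrC ler_wpM2l ?sqr_ge0// distrC.
by have [] := hd _ (close _ _ c01 c01').
Unshelve. all: by end_near. Qed.

(** The second difference is symmetric in [v] and [w]; divided by [h ^+ 2] it tends to either mixed
    derivative. *)
Lemma derive_comm S f x v w : open S -> Cn 2 S f -> S x ->
  'D_w ('D_v f) x = 'D_v ('D_w f) x.
Proof.
move=> oS fC Sx; apply/eqP; rewrite -subr_eq0 -normr_le0; apply/ler_addgt0Pl => e e0.
rewrite addr0; have e2 : 0 < e / 2 by rewrite divr_gt0.
have [h [[h0 H1] H2]] := filter_ex
  (filterI (filterI (nbhs_dnbhs_neq (0 : R))
     (nbhs_dnbhs (@second_difference S f x v w oS fC Sx _ e2)))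
     (nbhs_dnbhs (@second_difference S f x w v oS fC Sx _ e2))).
have h2 : 0 < h ^+ 2 by rewrite exprn_even_gt0.
rewrite -(ler_pM2r h2) -[X in _ * X <= _]ger0_norm ?(ltW h2)// -normrM.
have -> : e * h ^+ 2 = e / 2 * h ^+ 2 + e / 2 * h ^+ 2 by field.
rewrite [x + h *: w + h *: v]addrAC in H2.
move: H1 H2; move: (f (x + h *: v + h *: w)) (f (x + h *: v)) (f (x + h *: w)) (f x).
move: ('D_w ('D_v f) x) ('D_v ('D_w f) x) => D1 D2 A B C D H1 H2.
apply: le_trans (lerD H2 H1); apply: le_trans (ler_normB _ _).
by rewrite le_eqVlt; apply/orP; left; apply/eqP; congr (`| _ |); ring.
Qed.

Lemma line_lower g x v (a m : R) : 0 <= a -> 0 <= m ->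
  (forall t : R, `|t| <= a -> differentiable g (x + t *: v)
     /\ m <= 'D_v g (x + t *: v)) ->
  forall s t : R, `|s| <= a -> `|t| <= a -> s <= t ->
  m * (t - s) <= g (x + t *: v) - g (x + s *: v).
Proof.
move=> a0 m0 h s t sa ta st.
have [] := @MVT_segment R (fun r => g (x + r *: v)) (fun r => 'D_v g (x + r *: v)) s t st.
- move=> r; rewrite in_itv/= => /andP[sr rt]; apply: is_derive_line; apply: (h _ _).1.
  move: sa ta; rewrite !ler_norml => /andP[? ?] /andP[? ?].
  by rewrite (le_trans _ (ltW sr))//= (le_trans (ltW rt)).
- apply: continuous_in_subspaceT => r; rewrite inE/= in_itv/= => /andP[sr rt].
  apply: continuous_line; apply: (h _ _).1.
  move: sa ta; rewrite !ler_norml => /andP[? ?] /andP[? ?].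
  by rewrite (le_trans _ sr)//= (le_trans rt).
move=> c; rewrite in_itv/= => /andP[sc ct] ->; rewrite ler_wpM2r ?subr_ge0//.
apply: (h _ _).2; move: sa ta; rewrite !ler_norml => /andP[? ?] /andP[? ?].
by rewrite (le_trans _ sc)//= (le_trans ct).
Qed.

(** A slope of at least [m] over a length [a] on each side of [x] sweeps all values within [m * a]
    of [g x]. This quantitative intermediate value statement replaces the implicit function
    theorem. *)
Lemma line_reach g x v (a m : R) : 0 <= a -> 0 < m ->
  (forall t : R, `|t| <= a -> differentiable g (x + t *: v)
     /\ m <= 'D_v g (x + t *: v)) ->
  forall y : R, `|y - g x| <= m * a ->
  exists2 t : R, `|t| <= a & g (x + t *: v) = y.
Proof.
move=> a0 m0 h y ya; have aa : `|a| <= a by rewrite ger0_norm.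
have Na : `|- a| <= a by rewrite normrN.
have z : `|0 : R| <= a by rewrite normr0.
have lo := line_lower a0 (ltW m0) h Na z; have up := line_lower a0 (ltW m0) h z aa.
rewrite oppr_le0 scale0r addr0 in lo; rewrite scale0r addr0 in up.
have {}lo := lo a0; have {}up := up a0.
have Naa : - a <= a by rewrite (le_trans _ a0)// oppr_le0.
have [||t tI <-] := @IVT R (fun r => g (x + r *: v)) (- a) a y Naa.
- apply: continuous_in_subspaceT => r; rewrite inE/= in_itv/= -ler_norml => ra.
  exact: continuous_line (h _ ra).1.
- rewrite ge_min le_max; move: lo up ya.
  move: (g x) (g _) (g _) => A B C lo up; rewrite ler_norml => /andP[? ?].
  by apply/andP; split; apply/orP; [left|right]; lra.
- by exists t => //; move: tI; rewrite in_itv/= ler_norml.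
Qed.

(** The hypothesis is a vanishing derivative in epsilon form. It is checked for a composite
    containing a chosen shift that satisfies a Lipschitz bound but is not known to be
    differentiable. *)
Lemma constant_of_estimate (k : R -> R) :
  (forall t : R, 0 <= t <= 1 -> forall e : R, 0 < e ->
     \forall s \near t, `|k s - k t| <= e * `|s - t|) -> k 0 = k 1.
Proof.
move=> h; have dk (t : R) : 0 <= t <= 1 -> is_derive t 1 k 0.
  move=> t01; have H : differentiable k t /\ 'd k t = 0 :> (R -> R).
    have ex : k \o shift t = cst (k t) + 0 +o_ (0 : R) id.
      apply/eqaddoP => e e0; have := h t t01 e e0; rewrite (near_shift 0) subr0.
      by apply: filterS => u /=; rewrite !fctE /= addr0 addrK.
    have d0 : 'd k t = \0 :> (R -> R).
      by apply: diff_unique => //; exact: cst_continuous.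
    split=> //; apply/diff_locallyP; rewrite d0; split=> //; exact: cst_continuous.
  by case: H => dk d0; have := @is_derive_diff _ R^o k t 1 dk; rewrite deriveE// d0.
have [||c _] := @MVT_segment R k (fun=> 0) 0 1 ler01.
- by move=> t; rewrite in_itv/= => /andP[? ?]; apply: dk; rewrite !ltW.
- apply: continuous_in_subspaceT => t; rewrite inE/= in_itv/= => /dk[d _].
  exact/differentiable_continuous/derivable1_diffP.
by rewrite mul0r => /eqP; rewrite subr_eq0 => /eqP.
Qed.

(* Two points of a level set of [g] are joined by the curve
   [x1 + t (x2 - x1) + s(t) v] inside that level set, along which [f] has zero
   derivative; only a pointwise Lipschitz bound on [s] is needed, not its
   differentiability. *)
Lemma locally_constant_on_levels S f g x v : open S -> Cn 1 S f -> Cn 1 S g -> S x ->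
  'D_v g x != 0 ->
  (forall y w, S y -> 'D_w f y * 'D_v g y = 'D_v f y * 'D_w g y) ->
  exists W, [/\ open W, W x, W `<=` S &
    forall x1 x2, W x1 -> W x2 -> g x1 = g x2 -> f x1 = f x2].
Proof.
move=> oS fC gC Sx.
wlog gv : v / 0 < 'D_v g x.
  move=> H gv fg; have := gv; rewrite neq_lt => /orP[|] gv0; last exact: (H v).
  have dN h y : Cn 1 S h -> S y -> 'D_(- v) h y = - 'D_v h y.
    by move=> [hd _] Sy; rewrite -scaleN1r derive_scalev ?mulN1r//; exact: hd.
  apply: (H (- v)); rewrite ?dN ?oppr_eq0 ?oppr_gt0// => y w Sy.
  by rewrite !dN// mulrN mulNr fg.
move=> _ fg; have [fd fD] := fC; have [gd gD] := gC.
pose m := 'D_v g x / 2; have m0 : 0 < m by rewrite divr_gt0.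
have [d /= d0 hd] : exists2 d : R, 0 < d & forall y, `|x - y| < d -> S y /\ m <= 'D_v g y.
  have xS : nbhs x S by apply: open_nbhs_nbhs.
  have xc : \forall y \near x, m <= 'D_v g y.
    have := gD v x Sx; move/cvgrPdist_le => /(_ m m0); apply: filterS => y.
    rewrite ler_norml => /andP[_]; rewrite /m; lra.
  have [d d0 hd] := (nbhs_normP _ _).1 (filterI xS xc).
  by exists d => // y yd; exact: hd.
(* Half-length of the segments along [v]: since [a * |v| <= d / 2], the segments issued from points
   within [d / 2] of [x] stay in the ball of radius [d]. The [+ 1] keeps the denominator
   positive. *)
pose a := d / (2 * (`|v| + 1)).
have v1 : 0 < `|v| + 1 by rewrite ltr_wpDl.
have a0 : 0 < a by rewrite divr_gt0// mulr_gt0.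
have av : a * `|v| <= d / 2.
  rewrite /a mulrAC ler_pdivrMr ?mulr_gt0//.
  by move: `|v| => n; clear -d0; lra.
have [d' /= d'0 hd'] : exists2 d' : R, 0 < d' & forall y, `|x - y| < d' ->
    `|g x - g y| <= m * a / 2.
  have c : {for x, continuous g} by apply/differentiable_continuous/gd.
  have ma : 0 < m * a / 2 by rewrite divr_gt0// mulr_gt0.
  have [d' d'0 hd'] := (nbhs_normP _ _).1 ((cvgrPdist_le _ _).1 c _ ma).
  by exists d' => // y yd; exact: hd'.
(* Within [d'] of [x] the function [g] deviates from [g x] by at most [m * a / 2], so two values
   differ by at most [m * a], which is the range of [line_reach]. *)
pose r := Num.min (d / 2) d'; have r0 : 0 < r by rewrite lt_min d'0 divr_gt0.
have tube y (s : R) : `|x - y| < r -> `|s| <= a ->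
    S (y + s *: v) /\ m <= 'D_v g (y + s *: v).
  rewrite lt_min => /andP[yd _] sa; apply: hd; rewrite opprD addrA.
  apply: le_lt_trans (ler_normB _ _) _; rewrite normrZ.
  have : `|s| * `|v| <= d / 2 by apply: le_trans av; rewrite ler_wpM2r.
  by lra.
have tubed y : `|x - y| < r -> forall s : R, `|s| <= a ->
    differentiable g (y + s *: v) /\ m <= 'D_v g (y + s *: v).
  by move=> yr s sa; have [? ?] := tube y s yr sa; split=> //; exact: gd.
exists [set y | `|x - y| < r]; split.
- have -> : [set y | `|x - y| < r] = ball x r by rewrite -ball_normE.
  exact: ball_open.
- by rewrite /= subrr normr0.
- move=> y yr; have [] := tube y 0 yr _; first by rewrite normr0 ltW.
  by rewrite scale0r addr0.
move=> x1 x2 /= x1r x2r g12.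
pose p (t : R) := x1 + t *: (x2 - x1).
have cp : continuous p.
  move=> t; apply: cvgD; first exact: cvg_cst.
  by apply: cvgZl; exact: cvg_id.
have pr (t : R) : 0 <= t <= 1 -> `|x - p t| < r.
  move=> /andP[t0 t1]; have -> : x - p t = (1 - t) *: (x - x1) + t *: (x - x2).
    rewrite scalerBl scale1r -[in RHS]addrA [- _ + _]addrC -scalerBr.
    rewrite opprB [x - x2 + _]addrC subrKA /p opprD addrA; congr (_ + _).
    by rewrite -scalerN opprB.
  apply: (@le_lt_trans _ _ (Num.max `|x - x1| `|x - x2|)); last by rewrite gt_max x1r.
  have t1' : 0 <= 1 - t by rewrite subr_ge0.
  apply: le_trans (ler_normD _ _) _; rewrite !normrZ !ger0_norm//.
  set A := `|x - x1|; set B := `|x - x2|.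
  have A1 : A <= Num.max A B by rewrite le_max lexx.
  have B1 : B <= Num.max A B by rewrite le_max lexx orbT.
  have := ler_wpM2l t1' A1; have := ler_wpM2l t0 B1; lra.
pose T := [set t : R | `|x - p t| < r].
have oT : open T.
  have -> : T = p @^-1` (ball x r) by rewrite -ball_normE.
  by apply: open_comp => [t _|]; [exact: cp|exact: ball_open].
(* [s t] is the shift along [v] bringing [p t] back to the level of [x1]. The open set [T] contains
   a neighbourhood of every point of the unit interval; the value 0 outside it is a default. *)
have /choice[s hs] : forall t, exists s : R, T t -> `|s| <= a /\ g (p t + s *: v) = g x1.
  move=> t; have [Tt|nTt] := pselect (T t); last by exists 0.
  have [|s sa gs] := line_reach (ltW a0) m0 (tubed _ Tt) (y := g x1).
  - have h1 : `|g x - g x1| <= m * a / 2.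
      by apply: hd'; move: x1r; rewrite lt_min => /andP[].
    have h2 : `|g x - g (p t)| <= m * a / 2.
      by apply: hd'; move: Tt; rewrite /T/= lt_min => /andP[].
    have := ler_normB (g x - g (p t)) (g x - g x1).
    by rewrite opprB addrC subrKA => /le_trans; apply; lra.
  - by exists s.
(* Along [v] the function [g] grows at rate at least [m], so the shift is determined by the level
   and depends on it in a Lipschitz way. *)
have inj y (b c : R) : `|x - y| < r -> `|b| <= a -> `|c| <= a ->
    m * `|b - c| <= `|g (y + b *: v) - g (y + c *: v)|.
  move=> yr; wlog bc : b c / c <= b.
    move=> H ba ca; have [cb|/ltW bc] := leP c b; first exact: H.
    by rewrite distrC [leRHS]distrC; exact: H.
  move=> ba ca; have := line_lower (ltW a0) (ltW m0) (tubed _ yr) ca ba bc.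
  rewrite [X in m * X]ger0_norm ?subr_ge0// => /le_trans; apply; exact: ler_norm.
have s0 (t : R) : 0 <= t <= 1 -> g (p t) = g x1 -> s t = 0.
  move=> t01 gt; have [sa st] := hs t (pr t t01).
  have z : `|0 : R| <= a by rewrite normr0 ltW.
  have := inj _ _ _ (pr t t01) sa z.
  rewrite st scale0r addr0 gt !subrr subr0 normr0 pmulr_rle0// normr_le0.
  by move/eqP.
have p0 : p 0 = x1 by rewrite /p scale0r addr0.
have p1 : p 1 = x2 by rewrite /p scale1r addrC subrK.
suff : f (p 0 + s 0 *: v) = f (p 1 + s 1 *: v).
  have z01 : 0 <= (0 : R) <= 1 by rewrite lexx ler01.
  have o01 : 0 <= (1 : R) <= 1 by rewrite ler01 lexx.
  by rewrite (s0 _ z01) ?p0// (s0 _ o01) ?p1// !scale0r !addr0.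
apply: (@constant_of_estimate (fun t => f (p t + s t *: v))) => t t01 e e0.
have Tt := pr t t01; have [st gt] := hs t Tt.
set P := p t + s t *: v; have [SP mP] := tube _ _ Tt st; rewrite -/P in SP mP.
pose G (b : R) := g (x1 + s t *: v + b *: (x2 - x1)).
have PE b : p b + s t *: v = x1 + s t *: v + b *: (x2 - x1) by rewrite /p addrAC.
have dG : differentiable G t.
  have [] := @is_derive_line _ _ g (x1 + s t *: v) (x2 - x1) t.
    by rewrite -PE; exact: gd.
  by move=> /derivable1_diffP.
have [C C0 hC] : exists2 C : R, 0 < C & \forall b \near t, `|G b - G t| <= C * `|b - t|.
  pose D := 'd G t (1 : R).
  exists (`|D| + 1); first by rewrite ltr_wpDl ?normr_ge0.
  have := differentiable_estimate dG ltr01; rewrite (near_shift t) sub0r.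
  apply: filterS => b /=; rewrite subrK mul1r => H.
  have E : 'd G t (b - t) = (b - t) * D.
    by rewrite -[X in 'd G t X]mulr1 -[_ * 1]/((b - t) *: (1 : R^o)) linearZ.
  rewrite E in H; rewrite mulrDl mul1r.
  have -> : G b - G t = (G b - (G t + (b - t) * D)) + D * (b - t).
    by move: (G b) (G t) => ? ?; ring.
  by apply: le_trans (ler_normD _ _) _; rewrite addrC lerD// normrM.
pose K := `|x2 - x1| + C / m * `|v| + 1.
have K0 : 0 < K by rewrite ltr_wpDl// addr_ge0// mulr_ge0// divr_ge0// ltW.
have hK : \forall b \near t, T b /\ `|(p b + s b *: v) - P| <= K * `|b - t|.
  have nT : \forall b \near t, T b by apply: open_nbhs_nbhs.
  apply: filterS2 nT hC => b Tb Gb; split=> //.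
  have [sb gb] := hs b Tb.
  have := inj _ _ _ Tb sb st.
  rewrite gb PE -/(G b) -gt PE -/(G t) [leRHS]distrC => /le_trans /(_ Gb) ms.
  have {}ms : `|s b - s t| <= C / m * `|b - t|.
    by rewrite mulrAC ler_pdivlMr// mulrC.
  have -> : p b + s b *: v - P = (b - t) *: (x2 - x1) + (s b - s t) *: v.
    by rewrite /P opprD addrACA -scalerBl /p opprD addrACA subrr add0r -scalerBl.
  apply: le_trans (ler_normD _ _) _; rewrite !normrZ /K !mulrDl mul1r.
  rewrite -addrA lerD//; first by rewrite mulrC.
  by apply: ler_wpDr => //; rewrite [leRHS]mulrAC ler_wpM2r.
(* By hypothesis ['d f P] is [l] times ['d g P]. As [g] keeps its value along the curve, ['d g P] of
   the displacement is of smaller order, and so is the change of [f]. *)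
pose l := 'D_v f P / 'D_v g P.
have gP0 : 'D_v g P != 0 by rewrite gt_eqF// (lt_le_trans m0).
have dfg h : 'd f P h = l * 'd g P h.
  rewrite -!deriveE; [|exact: gd|exact: fd].
  by rewrite /l mulrAC -fg// mulfK.
pose e1 := e / ((1 + `|l|) * K).
have l1 : 0 < 1 + `|l| by rewrite ltr_wpDr.
have e10 : 0 < e1 by rewrite divr_gt0// mulr_gt0.
have cP : (p b + s b *: v) - P @[b --> t] --> (0 : V).
  apply/cvgr0Pnorm_le => e' e'0; near=> b.
  have [_ Kb] : T b /\ `|(p b + s b *: v) - P| <= K * `|b - t| by near: b.
  apply: le_trans Kb _; rewrite mulrC -ler_pdivlMr//.
  near: b; exists (e' / K) => /=; first by rewrite divr_gt0.
  by move=> b; rewrite /= distrC => /ltW.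
pose q b := (p b + s b *: v) - P.
have ef : \forall b \near t, `|f (q b + P) - (f P + 'd f P (q b))| <= e1 * `|q b|.
  exact: (cP _ (differentiable_estimate (fd _ SP) e10)).
have eg : \forall b \near t, `|g (q b + P) - (g P + 'd g P (q b))| <= e1 * `|q b|.
  exact: (cP _ (differentiable_estimate (gd _ SP) e10)).
apply: filterS3 hK ef eg => b [Tb Kb]; rewrite /q.
set h := (p b + s b *: v) - P in Kb * => Ef Eg.
have hP : h + P = p b + s b *: v by rewrite /h subrK.
rewrite hP dfg in Ef; rewrite hP (hs b Tb).2 gt in Eg.
have {}Eg : `|'d g P h| <= e1 * `|h|.
  by move: Eg; rewrite opprD addrA subrr sub0r normrN.
have -> : f (p b + s b *: v) - f P =
  f (p b + s b *: v) - (f P + l * 'd g P h) + l * 'd g P h.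
  by rewrite opprD addrA subrK.
apply: le_trans (ler_normD _ _) _; rewrite normrM.
apply: (@le_trans _ _ ((1 + `|l|) * (e1 * `|h|))).
  by rewrite mulrDl mul1r lerD// ler_wpM2l.
rewrite /e1 invfM mulrA; apply: (@le_trans _ _ (e / K * `|h|)).
  rewrite le_eqVlt; apply/orP; left; apply/eqP; field.
  by rewrite gt_eqF//= gt_eqF.
by rewrite mulrAC ler_pdivrMr// mulrAC -mulrA ler_pM2l.
Unshelve. all: by end_near. Qed.

End MeanValue.

(** * Regularity of a function factored through another one *)

Section Factorization.
Variables (R : realType) (V : normedModType R).
Implicit Types (f g : V -> R) (x v w : V) (W : set V) (Theta : R -> R).

(** A value [h + g x] is reached at [x + t *: v] with [|t| <= |h| / m]. There the remainder of
    [Theta] at order one equals the increment of [f - l * g], whose differential kills [v]. *)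
Lemma factor_derive W f g Theta x v : open W -> Cn 1 W f -> Cn 1 W g -> W x ->
  'D_v g x != 0 -> (forall y, W y -> Theta (g y) = f y) ->
  differentiable Theta (g x) /\ 'D_(1 : R^o) Theta (g x) = 'D_v f x / 'D_v g x.
Proof.
move=> oW fC gC Wx; have [fd fD] := fC; have [gd gD] := gC.
wlog gv : v / 0 < 'D_v g x.
  move=> H gv fg; have := gv; rewrite neq_lt => /orP[|] gv0; last exact: (H v).
  have dN (h : V -> R) : differentiable h x -> 'D_(- v) h x = - 'D_v h x.
    by move=> hd; rewrite -scaleN1r derive_scalev ?mulN1r.
  have := H (- v); rewrite !dN; [|exact: fd|exact: gd].
  by rewrite oppr_gt0 oppr_eq0 invrN mulrNN; apply.
move=> g0 Tf; pose m := 'D_v g x / 2; have m0 : 0 < m by rewrite divr_gt0.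
pose l := 'D_v f x / 'D_v g x; pose F y := f y + (- l) * g y.
have [d /= d0 hd] : exists2 d : R, 0 < d & forall y, `|x - y| < d -> W y /\ m <= 'D_v g y.
  have xS : nbhs x W by apply: open_nbhs_nbhs.
  have xc : \forall y \near x, m <= 'D_v g y.
    have := gD v x Wx; move/cvgrPdist_le => /(_ m m0); apply: filterS => y.
    by rewrite ler_norml => /andP[_]; rewrite /m; move: ('D_v g x) ('D_v g y) => ? ?; lra.
  have [d d0 hd] := (nbhs_normP _ _).1 (filterI xS xc).
  by exists d => // y yd; exact: hd.
have dF : differentiable F x.
  apply: differentiableD; first exact: fd.
  by apply: differentiableM => //; exact: gd.
have dF0 : 'd F x v = 0.
  rewrite -deriveE//; have df := is_derive_diff v (fd x Wx).
  have dg := is_derive_diff v (gd x Wx).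
  have [_ ->] := is_derive_add df (is_derive_mul (is_derive_cst (- l) x v) dg).
  by rewrite mul0r add0r /l mulNr divfK// subrr.
have v1 : 0 < `|v| + 1 by rewrite ltr_wpDl.
have est (e : R) : 0 < e -> \forall h \near (0 : R),
    `|Theta (h + g x) - (Theta (g x) + ( *:%R l : R^o -> R^o) h)| <= e * `|h|.
  move=> e0; pose e1 := e * m / (`|v| + 1).
  have e10 : 0 < e1 by rewrite divr_gt0// mulr_gt0.
  have [d' /= d'0 hd'] := (nbhs_normP _ _).1 (differentiable_estimate dF e10).
  pose D := Num.min d d'; have D0 : 0 < D by rewrite lt_min d0.
  exists (m * (D / (`|v| + 1))) => /=; first by rewrite mulr_gt0// divr_gt0.
  move=> h; rewrite /= sub0r normrN => hD.
  have tv (t : R) : `|t| <= `|h| / m -> `|t *: v| < D.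
    rewrite normrZ => th; move: hD; rewrite mulrC -ltr_pdivrMr// => hD.
    have := le_lt_trans th hD; rewrite ltr_pdivlMr//; apply: le_lt_trans.
    by rewrite ler_wpM2l// lerDl.
  have [t th gt] : exists2 t : R, `|t| <= `|h| / m & g (x + t *: v) = h + g x.
    apply: (@line_reach _ _ g x v (`|h| / m) m).
    - by rewrite divr_ge0// ltW.
    - by [].
    - move=> t th; have [] := hd (x + t *: v).
        rewrite opprD addrA subrr sub0r normrN.
        by apply: lt_le_trans (tv t th) _; rewrite ge_min lexx.
      by move=> Wt; split=> //; exact: gd.
    - by rewrite addrK mulrC divfK// gt_eqF.
  have Wt : W (x + t *: v).
    have [] := hd (x + t *: v) => //; rewrite opprD addrA subrr sub0r normrN.
    by apply: lt_le_trans (tv t th) _; rewrite ge_min lexx.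
  have := hd' (t *: v); rewrite /= sub0r normrN => /(_ _).
  have -> : 'd F x (t *: v) = 0 by rewrite linearZ dF0; exact: mulr0.
  rewrite addr0 [t *: v + x]addrC => H.
  have {}H : `|F (x + t *: v) - F x| <= e1 * `|t *: v|.
    by apply: H; apply: lt_le_trans (tv t th) _; rewrite ge_min lexx orbT.
  have -> : Theta (h + g x) - (Theta (g x) + l *: h) = F (x + t *: v) - F x.
    rewrite -gt Tf// Tf// /F -[l *: h]/(l * h).
    have -> : h = g (x + t *: v) - g x by rewrite gt addrK.
    by move: (f _) (f x) (g _) (g x) => ? ? ? ?; ring.
  apply: le_trans H _; rewrite /e1 normrZ.
  have {}th : `|t| * m <= `|h| by rewrite -ler_pdivlMr.
  rewrite mulrAC ler_pdivrMr//; move: th v1.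
  move: (`|t|) (normr_ge0 t) (`|v|) (normr_ge0 v) => T T0 n n0 th n1.
  have : e * (T * m) * n <= e * `|h| * (n + 1).
    apply: ler_pM => //; last by rewrite lerDl.
      by rewrite !mulr_ge0// ltW.
    by rewrite ler_wpM2l// ltW.
  by apply: le_trans; rewrite le_eqVlt; apply/orP; left; apply/eqP; ring.
have dT : differentiable Theta (g x).
  apply: (@differentiable_of_estimate _ R^o Theta ( *:%R l) (g x)) => //.
  exact: scaler_continuous.
split=> //; rewrite (@deriveE _ R^o _ _ _ _ dT).
have -> : 'd Theta (g x) = *:%R l :> (R^o -> R^o).
  apply: diff_unique; first exact: scaler_continuous.
  by apply/eqaddoP => e e0; exact: est.
by rewrite -[_ *: _]/(l * 1) mulr1.
Qed.

(** The derivative of [Theta] composed with [g] is ['D_v f / 'D_v g], which again factors through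
    [g], so induction applies. The direction [v] depends on the point, hence the passage to the open
    set where this [v] is noncritical. *)
Lemma factor_Cn n W f g Theta : open W -> smooth_on W f -> smooth_on W g ->
  (forall y, W y -> exists v, 'D_v g y != 0) ->
  (forall y, W y -> Theta (g y) = f y) -> Cn n (g @` W) Theta.
Proof.
elim: n W f Theta => [|n ih] W f Theta oW fS gS gv Tf.
  move=> _ [x Wx <-]; have [v gvx] := gv x Wx.
  apply: differentiable_continuous.
  by have [] := factor_derive oW (fS 1%N) (gS 1%N) Wx gvx Tf.
split=> [_ [x Wx <-]|w].
  have [v gvx] := gv x Wx.
  by have [] := factor_derive oW (fS 1%N) (gS 1%N) Wx gvx Tf.
apply: Cn_local => _ [x Wx <-]; have [v gvx] := gv x Wx.
pose T := W `&` [set y | 'D_v g y != 0].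
have oT : open T.
  have gc : forall y, W y -> {for y, continuous ('D_v g)} by have [_ /(_ v)] := gS 1%N.
  rewrite openE => y [Wy gy]; apply: filterI; first exact: open_nbhs_nbhs.
  exact: (cvgr_neq0 _ (gc y Wy) gy).
exists (g @` T); split; first by exists x.
have TW : T `<=` W by move=> y [].
have fT : smooth_on T f by move=> j; exact: Cn_sub TW (fS j).
have gT : smooth_on T g by move=> j; exact: Cn_sub TW (gS j).
apply: (ih T (fun y => w * ('D_v f y / 'D_v g y)) _ oT) => //.
- move=> j; apply: Cn_mul => //; first exact: Cn_cst.
  apply: Cn_div => //; first by move=> y [].
  + by have [_] := fT j.+1; apply.
  + by have [_] := gT j.+1; apply.
- by move=> y [_ gy]; exists v.
- move=> y [Wy gy]; have [dT <-] := factor_derive oW (fS 1%N) (gS 1%N) Wy gy Tf.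
  by rewrite -[in LHS](mulr1 w) (@derive_scalev _ R^o).
Qed.

End Factorization.

(** * Closed forms on rectangles *)

Section Antiderivative.
Variable R : realType.
Implicit Types (I J : set R) (f k : R -> R).

(** Parametrised by the unit interval, so that [y] may lie on either side of [x]. *)
Lemma mvt_between k (dk : R -> R) (x y : R) :
  (forall t : R, 0 <= t <= 1 -> is_derive (x + t * (y - x)) 1 k (dk (x + t * (y - x)))) ->
  exists2 c : R, 0 <= c <= 1 & k y - k x = dk (x + c * (y - x)) * (y - x).
Proof.
move=> h; have [t t01|c c01] := @mvt_line R R^o k x (y - x).
  by apply/derivable1_diffP; have [] := h t t01.
move=> E; exists c => //; have [/derivable1_diffP d e] := h c c01.
have xy : x + (y - x) = y by rewrite addrC subrK.
transitivity (k (x + (y - x)) - k x); first by rewrite xy.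
rewrite {}E -e; transitivity ('D_((y - x) *: (1 : R^o)) k (x + c * (y - x))).
  by congr ('D_ _ k _); rewrite [RHS]mulr1.
by rewrite (@derive_scalev _ R^o)// mulrC.
Qed.

Lemma is_derive_of_estimate k (t L : R) :
  (forall e : R, 0 < e -> \forall h \near (0 : R), `|k (h + t) - (k t + L * h)| <= e * `|h|) ->
  is_derive t 1 k L.
Proof.
move=> est; have dk : differentiable k t.
  by apply: (@differentiable_of_estimate _ R^o k ( *:%R L) t) => //; exact: scaler_continuous.
have dkL : 'd k t = *:%R L :> (R^o -> R^o).
  apply: diff_unique; first exact: scaler_continuous.
  by apply/eqaddoP => e e0; exact: est.
apply: DeriveDef; first exact/derivable1_diffP.
by rewrite (@deriveE _ R^o _ _ _ _ dk) dkL -[_ *: _]/(L * 1) mulr1.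
Qed.

Lemma interval_between I (x y t : R) : is_interval I -> I x -> I y -> 0 <= t <= 1 ->
  I (x + t * (y - x)).
Proof.
move=> iI Ix Iy /andP[t0 t1]; have [xy|/ltW yx] := leP x y.
  by apply: (iI x y) => //; apply/andP; split; nra.
by apply: (iI y x) => //; apply/andP; split; nra.
Qed.

Lemma open_room I (t : R) : open I -> I t -> exists a b : R, [/\ a < t, t < b, I a & I b].
Proof.
move=> oI It; have [e /= e0 he] := (nbhs_normP _ _).1 (open_nbhs_nbhs (conj oI It)).
exists (t - e / 2), (t + e / 2); split; [lra|lra|apply: he|apply: he] => /=.
  by rewrite opprB addrC subrK ger0_norm; lra.
by rewrite opprD addrA subrr sub0r normrN ger0_norm; lra.
Qed.

Lemma antiderivative_segment f (a b : R) :
  (forall t, a <= t <= b -> {for t, continuous f}) ->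
  exists F : R -> R, forall t, a < t < b -> is_derive t 1 F (f t).
Proof.
move=> fc; pose mu := @lebesgue_measure R.
exists (fun x => \int[mu]_(t in [set` `[a, x]]) (f t))%R => t /andP[at_ tb].
have [||||d e] := @continuous_FTC1_closed R f a t b.
- by [].
- apply: continuous_compact_integrable; first exact: segment_compact.
  by apply: continuous_in_subspaceT => s; rewrite inE/= in_itv/=; exact: fc.
- by [].
- by apply: fc; rewrite !ltW.
by apply: DeriveDef; [exact: d|rewrite -derive1E; exact: e].
Qed.

(** The interval may be unbounded, whereas the integral gives primitives on bounded segments. For
    each [t] a primitive vanishing at [t0] is chosen on a segment around [t0] and [t], and the
    choices are glued. *)
Lemma antiderivative I f : open I -> is_interval I ->
  (forall t, I t -> {for t, continuous f}) ->
  forall t0, I t0 ->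
  exists2 F : R -> R, F t0 = 0 & forall t, I t -> is_derive t 1 F (f t).
Proof.
move=> oI iI fc t0 It0.
have H t : exists abF : R * R * (R -> R), I t ->
    [/\ abF.1.1 < t < abF.1.2, abF.1.1 < t0 < abF.1.2, abF.2 t0 = 0 &
        forall s, abF.1.1 < s < abF.1.2 -> is_derive s 1 abF.2 (f s)].
  have [It|nIt] := pselect (I t); last by exists (0, 0, id).
  have [a [b [at_ tb Ia Ib]]] := open_room oI It.
  have [a' [b' [at' tb' Ia' Ib']]] := open_room oI It0.
  pose A := Num.min a a'; pose B := Num.max b b'.
  have IA : I A by rewrite /A minEle; case: ifP.
  have IB : I B by rewrite /B maxEle; case: ifP.
  have [F hF] : exists F : R -> R, forall s, A < s < B -> is_derive s 1 F (f s).
    by apply: antiderivative_segment => s sAB; apply: fc; apply: (iI A B).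
  exists (A, B, fun s => F s - F t0) => _ /=; split.
  - by rewrite gt_min lt_max at_ tb.
  - by rewrite gt_min lt_max at' tb' !orbT.
  - by rewrite subrr.
  - move=> s sAB; have := is_derive_add (hF s sAB) (is_derive_cst (- F t0) s 1).
    by rewrite addr0.
have {H}/choice[E hE] := H.
exists (fun t => (E t).2 t); first by have [] := hE t0 It0.
move=> t It; have [tE t0E E0 dE] := hE t It.
apply: (near_eq_is_derive _ (dE t tE)).
have : \forall s \near t, (E t).1.1 < s < (E t).1.2.
  have tE' : t \in `](E t).1.1, (E t).1.2[ by rewrite in_itv.
  by apply: filterS (near_in_itvoo tE') => s; rewrite in_itv.
have : \forall s \near t, I s by apply: open_nbhs_nbhs.
apply: filterS2 => s Is sE; have [sE' t0E' E0' dE'] := hE s Is.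
apply/eqP; rewrite -subr_eq0; apply/eqP.
(* Two chosen primitives vanish at [t0] and have the same derivative between [t0] and [s], so they
   agree at [s]. *)
pose D r := (E t).2 r - (E s).2 r.
have [r r01|c _] := @mvt_between D (fun=> 0) t0 s; last first.
  by rewrite mul0r /D E0 E0' !subr0.
have iE (a b : R) : is_interval [set r | a < r < b].
  move=> x y /= /andP[ax xb] /andP[ay yb] z /andP[xz zy].
  by rewrite (lt_le_trans ax)//= (le_lt_trans zy).
have d1 := dE _ (interval_between (iE _ _) t0E sE r01).
have d2 := dE' _ (interval_between (iE _ _) t0E' sE' r01).
by have := is_derive_add d1 (is_derive_opp d2); rewrite subrr.
Qed.

End Antiderivative.

(** * The Poincaré lemma on a rectangle *)

Section Plane.
Variable R : realType.
Implicit Types (f : R * R -> R) (q : R * R).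

Lemma is_derive_fst f q (d : R) :
  is_derive q (1, 0) f d <-> is_derive q.1 1 (fun t => f (t, q.2)) d.
Proof.
case: q => t r; have E : (fun h : R => h^-1 *: ((f \o shift (t, r)) (h *: (1, 0)) - f (t, r))) =
  (fun h : R => h^-1 *: (((fun s => f (s, r)) \o shift t) (h *: 1) - f (t, r))).
  apply/funext => h /=; congr (_ *: (f _ - _)).
  by congr pair; rewrite /= ?scaler0 ?add0r.
by split=> -[d1 d2]; (apply: DeriveDef; [move: d1|move: d2]);
  rewrite /derivable /derive E.
Qed.

Lemma is_derive_snd f q (d : R) :
  is_derive q (0, 1) f d <-> is_derive q.2 1 (fun r => f (q.1, r)) d.
Proof.
case: q => t r; have E : (fun h : R => h^-1 *: ((f \o shift (t, r)) (h *: (0, 1)) - f (t, r))) =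
  (fun h : R => h^-1 *: (((fun s => f (t, s)) \o shift r) (h *: 1) - f (t, r))).
  apply/funext => h /=; congr (_ *: (f _ - _)).
  by congr pair; rewrite /= ?scaler0 ?add0r.
by split=> -[d1 d2]; (apply: DeriveDef; [move: d1|move: d2]);
  rewrite /derivable /derive E.
Qed.

(** The increment is split into a horizontal and a vertical one. The mean value theorem turns each
    into a partial derivative at a nearby point, and the continuity of both partials at [q] controls
    the error. *)
Lemma differentiable_of_partials f (al be : R * R -> R) (U : set (R * R)) q :
  open U -> U q ->
  (forall p, U p -> is_derive p (1, 0) f (al p)) ->
  (forall p, U p -> is_derive p (0, 1) f (be p)) ->
  {for q, continuous al} -> {for q, continuous be} -> differentiable f q.
Proof.
move=> oU Uq fa fb ca cb.
pose l (h : R * R) : R := h.1 * al q + h.2 * be q.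
have ll : linear l.
  move=> a [x1 x2] [y1 y2]; rewrite /l/= /GRing.scale/=.
  by move: (al q) (be q) => ? ?; ring.
pose ls : {linear (R * R)%type -> R} := HB.pack l (GRing.isLinear.Build _ _ _ _ l ll).
apply: (@differentiable_of_estimate _ _ f ls q).
  move=> h; apply: cvgD; apply: cvgM; try exact: cvg_cst; [exact: cvg_fst|exact: cvg_snd].
move=> e e0; have e2 : 0 < e / 2 by rewrite divr_gt0.
have xa : \forall y \near q, `|al q - al y| <= e / 2 by move/cvgrPdist_le : ca; apply.
have xb : \forall y \near q, `|be q - be y| <= e / 2 by move/cvgrPdist_le : cb; apply.
have xU : \forall y \near q, U y by apply: open_nbhs_nbhs.
have [d /= d0 hd] := (nbhs_normP _ _).1 (filterI xU (filterI xa xb)).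
apply/nbhs_normP; exists d => //= -[h1 h2]; rewrite /= sub0r normrN => hdd.
have [h1d h2d] : `|h1| < d /\ `|h2| < d.
  by move: hdd; rewrite prod_normE/= gt_max => /andP[].
have h1h : `|h1| <= `|(h1, h2)| by rewrite prod_normE/= le_max lexx.
have h2h : `|h2| <= `|(h1, h2)| by rewrite prod_normE/= le_max lexx orbT.
have near1 (c c' : R) : 0 <= c <= 1 -> 0 <= c' <= 1 ->
    U (q.1 + c * h1, q.2 + c' * h2) /\
    `|al q - al (q.1 + c * h1, q.2 + c' * h2)| <= e / 2 /\
    `|be q - be (q.1 + c * h1, q.2 + c' * h2)| <= e / 2.
  move=> /andP[c0 c1] /andP[c0' c1']; apply: hd => /=.
  have -> : q - (q.1 + c * h1, q.2 + c' * h2) = (- (c * h1), - (c' * h2)).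
    by case: (q) => q1 q2; congr pair; rewrite /= opprD addrA subrr sub0r.
  rewrite prod_normE/= !normrN !normrM (ger0_norm c0) (ger0_norm c0') gt_max.
  apply/andP; split; [apply: le_lt_trans h1d|apply: le_lt_trans h2d]; exact: ler_piMl.
have z01 : 0 <= (0 : R) <= 1 by rewrite lexx ler01.
have o01 : 0 <= (1 : R) <= 1 by rewrite ler01 lexx.
have [c c01 Ec] : exists2 c : R, 0 <= c <= 1 &
    f (q.1 + h1, q.2 + h2) - f (q.1, q.2 + h2) = al (q.1 + c * h1, q.2 + h2) * h1.
  have [t t01|c c01 Ec] := @mvt_between _ (fun t => f (t, q.2 + h2))
     (fun t => al (t, q.2 + h2)) q.1 (q.1 + h1).
    rewrite [q.1 + h1]addrC addrK; apply/(is_derive_fst f (_, _)); apply: fa.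
    by have [] := near1 _ _ t01 o01; rewrite mul1r.
  by exists c => //; rewrite Ec [q.1 + h1]addrC addrK.
have [c' c01' Ec'] : exists2 c : R, 0 <= c <= 1 &
    f (q.1, q.2 + h2) - f (q.1, q.2) = be (q.1, q.2 + c * h2) * h2.
  have [t t01|c' c01' Ec'] := @mvt_between _ (fun t => f (q.1, t))
     (fun t => be (q.1, t)) q.2 (q.2 + h2).
    rewrite [q.2 + h2]addrC addrK; apply/(is_derive_snd f (_, _)); apply: fb.
    by have [] := near1 _ _ z01 t01; rewrite mul0r addr0.
  by exists c' => //; rewrite Ec' [q.2 + h2]addrC addrK.
have [_ [A _]] := near1 _ _ c01 o01; rewrite mul1r in A.
have [_ [_ B]] := near1 _ _ z01 c01'; rewrite mul0r addr0 in B.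
have -> : (h1, h2) + q = (q.1 + h1, q.2 + h2).
  by case: (q) => q1 q2; congr pair => /=; rewrite addrC.
have -> : f q = f (q.1, q.2) by case: (q).
have -> : f (q.1 + h1, q.2 + h2) - (f (q.1, q.2) + ls (h1, h2)) =
  h1 * (al (q.1 + c * h1, q.2 + h2) - al q) + h2 * (be (q.1, q.2 + c' * h2) - be q).
  rewrite /ls/= /l/=; move: Ec Ec'.
  move: (al (q.1 + c * h1, _)) (be (q.1, q.2 + c' * h2)) (al q) (be q) => ? ? ? ?.
  move: (f (q.1 + h1, _)) (f (q.1, q.2 + h2)) (f (q.1, q.2)) => F1 F2 F3 E1 E2.
  have -> : F1 = F1 - F2 + (F2 - F3) + F3 by ring.
  by rewrite E1 E2; ring.
apply: le_trans (ler_normD _ _) _; rewrite !normrM.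
have -> : e * `|(h1, h2)| = `|(h1, h2)| * (e / 2) + `|(h1, h2)| * (e / 2).
  by move: `|(h1, h2)| => n; field.
by rewrite distrC in A; rewrite distrC in B; apply: lerD; apply: ler_pM.
Qed.

Lemma plane_basis (v : R * R) : v = v.1 *: ((1, 0) : R * R) + v.2 *: ((0, 1) : R * R).
Proof.
by case: (v) => v1 v2; congr pair; rewrite /GRing.scale/=; [rewrite -[LHS]addr0 -[X in X + _]mulr1 -[X in _ + X](mulr0 v2)|rewrite -[LHS]add0r -[X in _ + X]mulr1 -[X in X + _](mulr0 v1)].
Qed.

Lemma smooth_of_partials f (al be : R * R -> R) (U : set (R * R)) :
  open U ->
  (forall p, U p -> is_derive p (1, 0) f (al p)) ->
  (forall p, U p -> is_derive p (0, 1) f (be p)) ->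
  smooth_on U al -> smooth_on U be -> smooth_on U f.
Proof.
move=> oU fa fb sa sb.
have df p : U p -> differentiable f p.
  by move=> Up; apply: (differentiable_of_partials oU Up fa fb);
    [exact: (sa 0%N)|exact: (sb 0%N)].
case=> [|n]; first by move=> p Up; exact/differentiable_continuous/df.
split=> // v; have s : Cn n U (fun p => v.1 * al p + v.2 * be p).
  by apply: Cn_add => //; apply: Cn_mul => //; exact: Cn_cst.
apply: Cn_eq s => // p Up.
have [_ <-] := fa p Up; have [_ <-] := fb p Up; have dfp := df p Up.
by rewrite [v in RHS]plane_basis derive_addv// !derive_scalev.
Qed.

Lemma open_rectangle (I J : set R) : open I -> open J -> open (I `*` J).
Proof.
move=> oI oJ; rewrite openE => -[x y] [/= Ix Jy]; exists (I, J) => //=.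
by split; apply: open_nbhs_nbhs.
Qed.

(** The primitive is [A t + B t r]: [A] integrates [al] along the line [r = r0], and [B t]
    integrates [be] upwards from [r0]. Closedness enters only in the [t]-derivative of [B]. *)
Lemma poincare (I J : set R) (al be : R * R -> R) :
  open I -> is_interval I -> open J -> is_interval J ->
  smooth_on (I `*` J) al -> smooth_on (I `*` J) be ->
  (forall q, (I `*` J) q -> d_r al q = d_t be q) ->
  exists2 G : R * R -> R, smooth_on (I `*` J) G &
    forall q, (I `*` J) q -> d_t G q = al q /\ d_r G q = be q.
Proof.
move=> oI iI oJ iJ sa sb cl; have oU : open (I `*` J) by exact: open_rectangle.
have [[[t0 r0] [/= It0 Jr0]]|nU] := pselect ((I `*` J) !=set0); last first.
  by exists (fun=> 0) => [n|q Uq]; [exact: Cn_cst|case: nU; exists q].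
have ad p : (I `*` J) p -> differentiable al p by have [+ _] := sa 1%N; apply.
have bd p : (I `*` J) p -> differentiable be p by have [+ _] := sb 1%N; apply.
have acont p : (I `*` J) p -> {for p, continuous al} by exact: (sa 0%N).
have bcont p : (I `*` J) p -> {for p, continuous be} by exact: (sb 0%N).
have [A A0 dA] : exists2 F : R -> R, F t0 = 0 &
    forall t, I t -> is_derive t 1 F (al (t, r0)).
  apply: (antiderivative oI iI) => // t It.
  apply: (@continuous_comp _ _ _ (fun t => (t, r0)) al); last exact: acont.
  by apply: (@cvg_pair _ _ _ _ (nbhs t) (nbhs r0)); [exact: cvg_id|exact: cvg_cst].
have /choice[B hB] : forall t, exists F : R -> R, I t -> F r0 = 0 /\
    forall r, J r -> is_derive r 1 F (be (t, r)).
  move=> t; have [It|] := pselect (I t); last by exists id.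
  have [|F F0 dF] := @antiderivative R J (fun r => be (t, r)) oJ iJ _ r0 Jr0.
    move=> r Jr.
    apply: (@continuous_comp _ _ _ (fun r => (t, r)) be); last exact: bcont.
    by apply: (@cvg_pair _ _ _ _ (nbhs t) (nbhs r)); [exact: cvg_cst|exact: cvg_id].
  by exists F.
(* Differentiation under the integral sign, without writing an integral: [B t] is used only through
   its derivative and its value at [r0]. *)
have dB t r : I t -> J r -> is_derive t 1 (fun t => B t r) (al (t, r) - al (t, r0)).
  move=> It Jr; apply: is_derive_of_estimate => e e0.
  (* Chosen so that [2 * e1 * |r - r0| <= e]. *)
  pose e1 := e / (2 * (`|r - r0| + 1)).
  have n1 : 0 < `|r - r0| + 1 by rewrite ltr_wpDl.
  have e10 : 0 < e1 by rewrite divr_gt0// mulr_gt0.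
  pose rho (s : R) := r0 + s * (r - r0).
  have crho : continuous rho.
    by move=> s; apply: cvgD; [exact: cvg_cst|apply: cvgM; [exact: cvg_id|exact: cvg_cst]].
  have Jrho (s : R) : 0 <= s <= 1 -> J (rho s) by exact: interval_between.
  have [d /= d0 hd] := (nbhs_normP _ _).1 (open_nbhs_nbhs (conj oI It)).
  have dbc p : (I `*` J) p -> {for p, continuous (d_t be)}.
    by have [_ /(_ (1, 0))] := sb 1%N; apply.
  pose P (h s : R) : Prop := `|d_t be (t + h, rho s) - d_t be (t, rho s)| <= 2 * e1.
  (* Compactness of the segment from [r0] to [r] makes the continuity of [d_t be] uniform. The
     factor 2 comes from comparing both points with one centre of the cover. *)
  have cover : \forall h \near (0 : R), `[0, 1] `<=` P h.
    apply: ((compact_near_coveringP _).1 (@segment_compact R 0 1) R (nbhs (0 : R)) P _).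
    move=> s /=.
    rewrite in_itv/= => s01.
    have cs := dbc (t, rho s) (conj It (Jrho s s01)).
    have c1 : d_t be (t + z.2, rho z.1) @[z --> (s, 0 : R)] --> d_t be (t, rho s).
      apply: (@cvg_comp _ _ _ (fun z : R * R => (t + z.2, rho z.1)) (d_t be) _ _ _ _ cs).
      apply: (@cvg_pair _ _ _ _ (nbhs t) (nbhs (rho s))); last by apply: (@cvg_comp _ _ _ (fun z : R * R => z.1) rho _ _ _ _ (crho s)); exact: cvg_fst.
      have : t + z.2 @[z --> (s, 0 : R)] --> t + 0.
        by apply: cvgD; [exact: cvg_cst|exact: cvg_snd].
      by rewrite addr0.
    have c2 : d_t be (t, rho z.1) @[z --> (s, 0 : R)] --> d_t be (t, rho s).
      apply: (@cvg_comp _ _ _ (fun z : R * R => (t, rho z.1)) (d_t be) _ _ _ _ cs).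
      apply: (@cvg_pair _ _ _ _ (nbhs t) (nbhs (rho s))); first exact: cvg_cst.
      by apply: (@cvg_comp _ _ _ (fun z : R * R => z.1) rho _ _ _ _ (crho s)); exact: cvg_fst.
    move/cvgrPdist_le : c1 => /(_ _ e10) c1; move/cvgrPdist_le : c2 => /(_ _ e10) c2.
    apply: filterS2 c1 c2 => z /= A1 A2.
    rewrite distrC in A1; rewrite /P mulrDl mul1r.
    have -> : d_t be (t + z.2, rho z.1) - d_t be (t, rho z.1) =
      (d_t be (t + z.2, rho z.1) - d_t be (t, rho s)) + (d_t be (t, rho s) - d_t be (t, rho z.1)).
      by rewrite addrA subrK.
    by apply: le_trans (ler_normD _ _) _; rewrite lerD.
  have [d' /= d'0 hd'] := (nbhs_normP _ _).1 cover.
  exists (Num.min d d') => /=; first by rewrite lt_min d0.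
  move=> h; rewrite /= sub0r normrN lt_min => /andP[h1 h2].
  have ch (c : R) : 0 <= c <= 1 -> `|c * h| <= `|h|.
    by move=> /andP[c0 c1]; rewrite normrM ger0_norm// ler_piMl.
  have Ith (c : R) : 0 <= c <= 1 -> I (t + c * h).
    move=> c01; apply: hd; rewrite /= opprD addrA subrr sub0r normrN.
    exact: le_lt_trans (ch c c01) h1.
  have o01 : 0 <= (1 : R) <= 1 by rewrite ler01 lexx.
  have Ith1 : I (t + h) by have := Ith _ o01; rewrite mul1r.
  (* [D r - D r0] is the error to be bounded. By closedness the derivative of [D] in [s] is [h]
     times an increment of [d_t be], which is uniformly small. *)
  pose D s := B (t + h) s - B t s - h * al (t, s).
  pose dD s := be (t + h, s) - be (t, s) - h * d_r al (t, s).
  have [s s01|c c01] := @mvt_between _ D dD r0 r.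
    have Js := Jrho s s01; apply: is_derive_add; last first.
      apply: is_derive_opp; have da : is_derive (rho s) 1 (fun s => al (t, s)) (d_r al (t, rho s)).
        by apply/(is_derive_snd al (t, rho s))/is_derive_diff/ad; split.
      have := is_derive_mul (is_derive_cst h (rho s) 1) da.
      by rewrite mul0r add0r.
    apply: is_derive_add; first by apply: (hB _ Ith1).2.
    by apply: is_derive_opp; apply: (hB _ It).2.
  rewrite -/(rho c) => ED.
  have Jc := Jrho c c01.
  have [c' c01' Ec] : exists2 c' : R, 0 <= c' <= 1 &
      be (t + h, rho c) - be (t, rho c) = d_t be (t + c' * h, rho c) * h.
    have [b b01|c' c01' Ec'] := @mvt_between _ (fun t => be (t, rho c))
        (fun t => d_t be (t, rho c)) t (t + h).
      rewrite [t + h]addrC addrK; apply/(is_derive_fst be (_, _))/is_derive_diff/bd.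
      by split=> //=; exact: Ith.
    by exists c' => //; rewrite Ec' [t + h]addrC addrK.
  have close : `|d_t be (t + c' * h, rho c) - d_t be (t, rho c)| <= 2 * e1.
    have := hd' (c' * h); apply; last by rewrite /= in_itv.
    by rewrite /= sub0r normrN; exact: le_lt_trans (ch _ c01') h2.
  have B0 : B (t + h) r0 = 0 by apply: (hB _ Ith1).1.
  have B0' : B t r0 = 0 by apply: (hB _ It).1.
  have -> : B (h + t) r - (B t r + (al (t, r) - al (t, r0)) * h) = D r - D r0.
    rewrite /D B0 B0' [h + t]addrC.
    by move: (B _ _) (B _ _) (al _) (al _) => ? ? ? ?; ring.
  rewrite ED /dD Ec cl; last by split.
  have -> : d_t be (t + c' * h, rho c) * h - h * d_t be (t, rho c) =
    h * (d_t be (t + c' * h, rho c) - d_t be (t, rho c)).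
    by rewrite mulrBr mulrC.
  rewrite !normrM -mulrA [leRHS]mulrC; apply: ler_wpM2l => //.
  apply: (@le_trans _ _ (2 * e1 * `|r - r0|)); first exact: ler_wpM2r.
  rewrite /e1; move: n1; move: (`|r - r0|) (normr_ge0 (r - r0)) => n n0 n1.
  have -> : 2 * (e / (2 * (n + 1))) * n = e * (n / (n + 1)) by field; rewrite gt_eqF.
  by rewrite ler_piMr ?(ltW e0)// ler_pdivrMr// mul1r lerDl.
pose G q := A q.1 + B q.1 q.2.
have Gt p : (I `*` J) p -> is_derive p (1, 0) G (al p).
  move=> [Ip Jp]; apply/is_derive_fst.
  have := is_derive_add (dA _ Ip) (dB _ _ Ip Jp).
  by rewrite addrC subrK -surjective_pairing.
have Gr p : (I `*` J) p -> is_derive p (0, 1) G (be p).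
  move=> [Ip Jp]; apply/is_derive_snd.
  have := is_derive_add (is_derive_cst (A p.1) p.2 1) ((hB _ Ip).2 _ Jp).
  by rewrite add0r -surjective_pairing.
exists G; first exact: (smooth_of_partials oU Gt Gr).
by move=> q Uq; have [_ ?] := Gt q Uq; have [_ ?] := Gr q Uq.
Qed.

End Plane.

(** * Sprays and horizontally constant functions *)

Section Coordinates.
Variable R : realType.
Implicit Types (p w : TM R) (x v : 'rV[R]_4) (i : 'I_4).

Lemma Cn_linear_form (V : normedModType R) (A : {linear V -> R}) n (S : set V) :
  continuous A -> Cn n S A.
Proof.
move=> cA; case: n => [|n]; first by move=> x _; exact: cA.
have dA (z : V) : differentiable A z by apply: linear_differentiable; exact: cA.
split=> // v; rewrite (_ : 'D_v A = fun=> A v); first exact: Cn_cst.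
by apply/funext => z; rewrite deriveE// diff_lin.
Qed.

Definition base_coord i p : R := p.1 0 i.
Definition fibre_coord i p : R := p.2 0 i.

Lemma base_coord_linear i : linear (base_coord i).
Proof. by move=> a p w; rewrite /base_coord/= !mxE. Qed.
HB.instance Definition _ i :=
  GRing.isLinear.Build R (TM R) R _ (base_coord i) (base_coord_linear i).

Lemma fibre_coord_linear i : linear (fibre_coord i).
Proof. by move=> a p w; rewrite /fibre_coord/= !mxE. Qed.
HB.instance Definition _ i :=
  GRing.isLinear.Build R (TM R) R _ (fibre_coord i) (fibre_coord_linear i).

Lemma base_coord_continuous i : continuous (base_coord i).
Proof.
move=> p; apply: (@continuous_comp _ _ _ (fun p : TM R => p.1) (fun x : 'rV[R]_4 => x 0 i)).
  exact: cvg_fst.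
exact: coord_continuous.
Qed.

Lemma fibre_coord_continuous i : continuous (fibre_coord i).
Proof.
move=> p; apply: (@continuous_comp _ _ _ (fun p : TM R => p.2) (fun x : 'rV[R]_4 => x 0 i)).
  exact: cvg_snd.
exact: coord_continuous.
Qed.

Lemma is_derive_linear_form (V : normedModType R) (A : {linear V -> R}) (x v : V) :
  continuous A -> is_derive x v A (A v).
Proof.
move=> cA; have dA : differentiable A x by apply: linear_differentiable; exact: cA.
by apply: DeriveDef; [exact: diff_derivable|rewrite deriveE// diff_lin].
Qed.

Lemma is_derive_base p w i : is_derive p w (fun p : TM R => p.1 0 i) (w.1 0 i).
Proof. exact: (@is_derive_linear_form _ (base_coord i) p w (@base_coord_continuous i)). Qed.

Lemma is_derive_fibre p w i : is_derive p w (fun p : TM R => p.2 0 i) (w.2 0 i).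
Proof. exact: (@is_derive_linear_form _ (fibre_coord i) p w (@fibre_coord_continuous i)). Qed.

Lemma Cn_base n (S : set (TM R)) i : Cn n S (fun p : TM R => p.1 0 i).
Proof. exact: (@Cn_linear_form _ (base_coord i) n S (@base_coord_continuous i)). Qed.

Lemma Cn_fibre n (S : set (TM R)) i : Cn n S (fun p : TM R => p.2 0 i).
Proof. exact: (@Cn_linear_form _ (fibre_coord i) n S (@fibre_coord_continuous i)). Qed.

Lemma is_derive_vertical (h : 'rV[R]_4 -> R) p v : is_derive p (0, v) (fun p => h p.1) 0.
Proof.
have E : (fun s : R => s^-1 *: (((fun p : TM R => h p.1) \o shift p) (s *: (0, v)) - h p.1))
    = fun=> 0.
  by apply/funext => s /=; rewrite scaler0 add0r subrr scaler0.
apply: DeriveDef; rewrite /derivable /derive E; first exact: is_cvg_cst.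
exact: lim_cst.
Qed.

Lemma vectE x : x = \sum_i x 0 i *: basis R i.
Proof. by rewrite [LHS]row_sum_delta. Qed.

Lemma derive_vertical (f : TM R -> R) p v : differentiable f p ->
  'D_(0, v) f p = \sum_i v 0 i * vd i f p.
Proof.
move=> fp; rewrite {1}(vectE v).
have -> : (0, \sum_i v 0 i *: basis R i) = \sum_i v 0 i *: ((0, basis R i) : TM R).
  elim/big_ind2 : _ => // [a y1 c y2 <- <-|i _].
    by congr pair; rewrite /= ?addr0.
  by congr pair; rewrite /= scaler0.
exact: derive_sumv.
Qed.

Lemma derive_horizontal (Gam : connection R) (f : TM R -> R) a p : differentiable f p ->
  'D_(delta_h Gam a p) f p =
  pd a f p - \sum_c (\sum_b Gam p.1 c a b * p.2 0 b) * vd c f p.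
Proof.
move=> fp; rewrite /delta_h.
have -> : (basis R a, - \row_c \sum_b Gam p.1 c a b * p.2 0 b) =
  (basis R a, 0) + (0, - \row_c \sum_b Gam p.1 c a b * p.2 0 b) :> TM R.
  by congr pair; rewrite /= ?addr0 ?add0r.
rewrite derive_addv// derive_vertical// -sumrN; congr (_ + _).
by apply: eq_bigr => c _; rewrite !mxE mulNr.
Qed.

Lemma is_derive_homog2 (L : TM R -> R) p : differentiable L p ->
  (\forall s \near (0 : R), L (p + s *: (0, p.2)) = (1 + s) ^+ 2 * L p) ->
  \sum_i p.2 0 i * vd i L p = 2 * L p.
Proof.
move=> dL hL; rewrite -derive_vertical//.
have dL0 : differentiable L (p + (0 : R) *: ((0, p.2) : TM R)) by rewrite scale0r addr0.
have [_ e1] := is_derive_line dL0.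
have : is_derive (0 : R) 1 (fun s : R => L (p + s *: (0, p.2))) (2 * L p).
  have h : is_derive (0 : R) 1 (fun s : R => (1 + s) ^+ 2 * L p) (2 * L p).
    have d1 := is_derive_add (is_derive_cst (1 : R) (0 : R) (1 : R)) (is_derive_id (0 : R) (1 : R)).
    have := is_derive_mul (is_derive_expn 2 d1) (is_derive_cst (L p) (0 : R) (1 : R)).
    by rewrite mulr0 addr0 addr0 add0r expr1 !mulr1.
  by apply: near_eq_is_derive h; apply: filterS hL => s.
by case=> _; rewrite e1 scale0r addr0.
Qed.

(** Differentiated Euler relation. The direction [w] is arbitrary because both vertical and base
    derivatives of the relation for [L] are used. *)
Lemma vd_homog1 (f : 'I_4 -> TM R -> R) (S : set (TM R)) (h : TM R -> R) w p :
  open S -> S p -> (forall i q, S q -> differentiable (f i) q) ->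
  (forall q, S q -> \sum_i q.2 0 i * f i q = h q) ->
  'D_w h p = \sum_i (w.2 0 i * f i p + p.2 0 i * 'D_w (f i) p).
Proof.
move=> oS Sp df fh.
have D : is_derive p w (fun q => \sum_i q.2 0 i * f i q)
    (\sum_i (w.2 0 i * f i p + p.2 0 i * 'D_w (f i) p)).
  exact: (is_derive_sum_fun
    (fun i => is_derive_mul (is_derive_fibre p w i) (is_derive_diff w (df i p Sp)))).
have [_ <-] := D; apply: near_eq_derive.
have : \forall q \near p, S q by apply: open_nbhs_nbhs.
by apply: filterS => q Sq; rewrite fh.
Qed.

End Coordinates.

(** The index bookkeeping at the end of [horizontal_of_spray]. There [F i] is [pd i L], [V i] is
    [vd i L], primes and [H] are their derivatives along [b], [N i] is the nonlinear connection and
    [G i] the spray; the spray equation makes [F b] occur twice. *)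
Lemma vertical_derivative_sum (R : realType) (y F F' N V G H : 'I_4 -> R) (b : 'I_4) :
  \sum_i (basis R b 0 i * F i + y i * F' i) + - \sum_i (2 * N i * V i + G i * H i) = 0 ->
  \sum_i y i * F' i = \sum_i H i * G i + F b -> F b - \sum_i N i * V i = 0.
Proof.
rewrite !big_split/= (bigD1 b)//= big1 ?addr0 => [|i ib]; last first.
  by rewrite mxE eqxx/= (negbTE ib) mul0r.
rewrite mxE !eqxx mul1r => + E; rewrite E.
have -> : \sum_(i < 4) 2 * N i * V i = 2 * \sum_i N i * V i.
  by rewrite big_distrr/=; apply: eq_bigr => i _; rewrite mulrA.
have -> : \sum_(i < 4) G i * H i = \sum_i H i * G i.
  by apply: eq_bigr => i _; rewrite mulrC.
by move: (\sum_(i < 4) H i * G i) (\sum_(i < 4) N i * V i) => C D; lra.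
Qed.

(** * Berwald metrics as horizontally constant functions *)

Section Berwald.
Variable R : realType.
Implicit Types (p : TM R) (Gam : connection R) (L : TM R -> R) (S : set (TM R)).

Definition horizontally_constant Gam S L :=
  forall p, S p -> forall a, 'D_(delta_h Gam a p) L p = 0.

Section spray_data.
Variables (Gam : connection R) (S : set (TM R)) (L : TM R -> R).
Hypotheses (oS : open S) (sL : smooth_on S L)
  (symG : forall p c a b, S p -> Gam p.1 c a b = Gam p.1 c b a).

Let dL p : S p -> differentiable L p.
Proof. by have [+ _] := sL 1%N; apply. Qed.

Let dDL v p : S p -> differentiable ('D_v L) p.
Proof. by have [_ /(_ v) [+ _]] := sL 2%N; apply. Qed.

Let comm v w p : S p -> 'D_w ('D_v L) p = 'D_v ('D_w L) p.
Proof. by move=> Sp; apply: (derive_comm v w oS (sL 2%N) Sp). Qed.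

Let comm_pv a b p : S p -> pd a (vd b L) p = vd b (pd a L) p.
Proof. exact: (comm (0, basis R b) (basis R a, 0)). Qed.

Let comm_vv a b p : S p -> vd a (vd b L) p = vd b (vd a L) p.
Proof. exact: (comm (0, basis R b) (0, basis R a)). Qed.

Let N c a p := \sum_b Gam p.1 c a b * p.2 0 b.
Let Gq c p := \sum_a p.2 0 a * N c a p.

Lemma Gq_E c p : \sum_(a < 4) \sum_(b < 4) Gam p.1 c a b * p.2 0 a * p.2 0 b = Gq c p.
Proof.
apply: eq_bigr => a _; rewrite /N big_distrr/=; apply: eq_bigr => b _.
by rewrite mulrAC mulrC mulrA mulrAC mulrC mulrA mulrAC.
Qed.

Lemma vd_N c a p d : is_derive p (0, basis R d) (N c a) (Gam p.1 c a d).
Proof.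
apply: is_derive_eq (is_derive_sum_fun
  (fun b => is_derive_mul (is_derive_vertical (fun x => Gam x c a b) p (basis R d))
       (is_derive_fibre p (0, basis R d) b))) _.
rewrite (bigD1 d)//= big1 ?addr0 => [|b bd].
  by rewrite mxE !eqxx mul0r add0r mulr1.
by rewrite mxE eqxx/= (negbTE bd) mul0r add0r mulr0.
Qed.

Lemma vd_Gq c p d : S p -> is_derive p (0, basis R d) (Gq c) (2 * N c d p).
Proof.
move=> Sp; apply: is_derive_eq (is_derive_sum_fun
  (fun a => is_derive_mul (is_derive_fibre p (0, basis R d) a) (vd_N c a p d))) _.
rewrite big_split/= (bigD1 d)//= big1 ?addr0 => [|b bd]; last first.
  by rewrite mxE eqxx/= (negbTE bd) mul0r.
rewrite mxE !eqxx mul1r mulr2n mulrDl mul1r; congr (_ + _).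
by apply: eq_bigr => b _; rewrite symG// mulrC.
Qed.

Let r b p := \sum_(e < 4) p.2 0 e * pd e (vd b L) p - pd b L p.

Lemma sprayE p c : spray L c p = 4^-1 * (invmx (hessian L p) *m \col_b r b p) c 0.
Proof. by rewrite /spray mxE; congr (_ * _); apply: eq_bigr => b _; rewrite mxE. Qed.

Lemma hessian_GqE p : hessian L p *m \col_c Gq c p =
  \col_b (2^-1 * \sum_e vd b (vd e L) p * Gq e p).
Proof.
apply/matrixP => b j; rewrite !mxE big_distrr/=; apply: eq_bigr => e _.
by rewrite !mxE mulrA.
Qed.

(** Differentiate [delta_a L = 0] along the fibre and contract with [y]. The terms containing the
    coefficients [Gam] cancel against [pd b L], and what remains is the Hessian applied to [Gq]. *)
Lemma spray_of_horizontal p : horizontally_constant Gam S L -> S p ->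
  hessian L p \in unitmx -> forall c, 2 * spray L c p = Gq c p.
Proof.
move=> hc Sp uH c.
have E a q : S q -> pd a L q = \sum_c N c a q * vd c L q.
  move=> Sq; have := hc q Sq a; rewrite derive_horizontal; last exact: dL.
  by move/eqP; rewrite subr_eq0 => /eqP.
have DE a b : vd b (pd a L) p =
    \sum_c (Gam p.1 c a b * vd c L p + N c a p * vd b (vd c L) p).
  have := is_derive_sum_fun (fun c => is_derive_mul (vd_N c a p b)
    (is_derive_diff (0, basis R b) (dDL (0, basis R c) Sp))).
  case=> _ <-; apply: near_eq_derive.
  have : \forall q \near p, S q by apply: open_nbhs_nbhs.
  by apply: filterS => q Sq; exact: E.
have key : \col_b r b p = 2 *: (hessian L p *m \col_c Gq c p).
  apply/matrixP => b j; rewrite hessian_GqE !mxE mulrA divff// mul1r /r.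
  rewrite (eq_bigr (fun e => \sum_c p.2 0 e * (Gam p.1 c e b * vd c L p) +
      \sum_c p.2 0 e * (N c e p * vd b (vd c L) p))); last first.
    move=> e _; rewrite -big_split/= comm_pv// DE.
    by rewrite big_distrr/=; apply: eq_bigr => c' _; rewrite mulrDr.
  rewrite big_split/= (E b p Sp).
  rewrite [X in X + _ - _]exchange_big/= [X in _ + X - _]exchange_big/=.
  have -> : \sum_(c' < 4) \sum_(i < 4) p.2 0 i * (Gam p.1 c' i b * vd c' L p) =
      \sum_c' N c' b p * vd c' L p.
    apply: eq_bigr => c' _; rewrite /N big_distrl/=; apply: eq_bigr => a _.
    by rewrite symG// mulrA [X in X * _]mulrC.
  rewrite addrAC subrr add0r; apply: eq_bigr => c' _.
  rewrite /Gq big_distrr/=; apply: eq_bigr => a _.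
  by rewrite mulrA mulrC.
rewrite sprayE key -scalemxAr mulmxA mulVmx// mul1mx !mxE.
by move: (Gq c p) => G; field.
Qed.

(** Contracting the spray equation with [y] and using Euler's relation shows that the spray
    annihilates [L]. The vertical derivative of this identity, combined with the spray equation once
    more, is twice [delta_b L = 0]. *)
Lemma horizontal_of_spray :
  (forall p, S p -> \sum_i p.2 0 i * vd i L p = 2 * L p) ->
  (forall p, S p -> hessian L p \in unitmx) ->
  (forall p c, S p -> 2 * spray L c p = Gq c p) ->
  horizontally_constant Gam S L.
Proof.
move=> euler uH sp.
have key p b : S p -> r b p = \sum_e vd b (vd e L) p * Gq e p.
  move=> Sp; have /matrixP/(_ b 0) : \col_b r b p = 2 *: (hessian L p *m \col_c Gq c p).
    have -> : \col_c Gq c p = 2^-1 *: (invmx (hessian L p) *m \col_b r b p).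
      apply/matrixP => c j; rewrite [j]ord1 mxE -sp// sprayE mulrA [in RHS]mxE; congr (_ * _).
      by field.
    by rewrite -scalemxAr scalerA divff// scale1r mulmxA mulmxV ?uH// mul1mx.
  by rewrite hessian_GqE !mxE mulrA divff// mul1r.
have ev p e : S p -> \sum_i p.2 0 i * vd e (vd i L) p = vd e L p.
  move=> Sp; have := vd_homog1 (0, basis R e) oS Sp
    (fun i q (Sq : S q) => dDL (0, basis R i) Sq) euler.
  have [_ ->] := is_derive_mul (is_derive_cst (2 : R) p (0, basis R e))
    (is_derive_diff (0, basis R e) (dL Sp)).
  rewrite mul0r add0r big_split/= (bigD1 e)//= big1 ?addr0 => [|i ie]; last first.
    by rewrite mxE eqxx/= (negbTE ie) mul0r.
  rewrite mxE !eqxx mul1r -/(vd e L p) mulr2n mulrDl mul1r => /addrI ->.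
  by apply: eq_bigr => i _.
have eh p e : S p -> \sum_i p.2 0 i * pd e (vd i L) p = 2 * pd e L p.
  move=> Sp; have := vd_homog1 (basis R e, 0) oS Sp
    (fun i q (Sq : S q) => dDL (0, basis R i) Sq) euler.
  have [_ ->] := is_derive_mul (is_derive_cst (2 : R) p (basis R e, 0))
    (is_derive_diff (basis R e, 0) (dL Sp)).
  rewrite mul0r add0r -/(pd e L p) => ->; apply: eq_bigr => i _.
  by rewrite mxE mul0r add0r.
have S0 p : S p -> \sum_a p.2 0 a * pd a L p - \sum_c Gq c p * vd c L p = 0.
  move=> Sp.
  have : \sum_b p.2 0 b * r b p = \sum_b p.2 0 b * \sum_e vd b (vd e L) p * Gq e p.
    by apply: eq_bigr => b _; rewrite key.
  rewrite (eq_bigr (fun b => \sum_e p.2 0 e * (p.2 0 b * pd e (vd b L) p)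
      - p.2 0 b * pd b L p)); last first.
    move=> b _; rewrite /r mulrBr big_distrr/=; congr (_ - _).
    by apply: eq_bigr => e _; rewrite mulrCA.
  rewrite sumrB exchange_big/=.
  rewrite (eq_bigr (fun e => p.2 0 e * (2 * pd e L p))); last first.
    by move=> e _; rewrite -eh// big_distrr.
  rewrite (eq_bigr (fun e => 2 * (p.2 0 e * pd e L p))) => [|e _]; last by rewrite mulrCA.
  rewrite -big_distrr/= mulr2n mulrDl mul1r addrK => ->.
  apply/eqP; rewrite subr_eq0; apply/eqP.
  rewrite (eq_bigr (fun b => \sum_e p.2 0 b * vd e (vd b L) p * Gq e p)); last first.
    move=> b _; rewrite big_distrr/=; apply: eq_bigr => e _.
    by rewrite mulrA comm_vv.
  rewrite exchange_big/=; apply: eq_bigr => e _.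
  by rewrite -big_distrl/= ev// mulrC.
move=> p Sp b; rewrite derive_horizontal; last exact: dL.
have H1 : is_derive p (0, basis R b)
    (fun p => \sum_a p.2 0 a * pd a L p - \sum_c Gq c p * vd c L p) 0.
  have z : is_derive p (0, basis R b) (fun=> 0 : R) 0 by exact: is_derive_cst.
  apply: near_eq_is_derive z.
  have : \forall q \near p, S q by apply: open_nbhs_nbhs.
  by apply: filterS => q Sq; rewrite S0.
have H2 := is_derive_add (is_derive_sum_fun (fun a => is_derive_mul
    (is_derive_fibre p (0, basis R b) a)
    (is_derive_diff (0, basis R b) (dDL (basis R a, 0) Sp))))
  (is_derive_opp (is_derive_sum_fun (fun c => is_derive_mul (vd_Gq c b Sp)
    (is_derive_diff (0, basis R b) (dDL (0, basis R c) Sp))))).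
apply: (@vertical_derivative_sum R (fun i => p.2 0 i) (fun i => pd i L p)
  (fun i => vd b (pd i L) p) (fun i => N i b p) (fun i => vd i L p) (fun i => Gq i p)
  (fun i => vd b (vd i L) p) b (is_derive_unique H2 H1)).
transitivity (r b p + pd b L p); last by congr (_ + _); exact: key.
rewrite /r subrK.
apply: eq_bigr => i _.
by rewrite comm_pv.
Qed.

End spray_data.
End Berwald.

(** * Structure equations for a, b, c *)

Lemma ord4P (P : 'I_4 -> Prop) : P i_t -> P i_r -> P i_th -> P i_ph -> forall a, P a.
Proof.
move=> Pt Pr Pth Pph a.
have : a \in [:: i_t; i_r; i_th; i_ph] by case: a => -[|[|[|[|//]]]] h.
by rewrite !inE => /or4P[] /eqP ->.
Qed.

Lemma sum4 (R : nmodType) (F : 'I_4 -> R) :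
  \sum_b F b = F i_t + F i_r + F i_th + F i_ph.
Proof.
rewrite !big_ord_recl big_ord0 addr0 !addrA.
by congr (_ + F _ + F _ + F _); [apply: congr1|..]; exact: val_inj.
Qed.

Section TimeRadius.
Variable R : realType.
Implicit Types (h : R * R -> R) (p w : TM R) (M : set 'rV[R]_4) (x : 'rV[R]_4).

(** A linear section of [tr_proj]. Translated to pass through a point of [M], it recovers a function
    of (t,r) from its pullback to [M]. *)
Definition tr_incl (q : R * R) : 'rV[R]_4 := q.1 *: basis R i_t + q.2 *: basis R i_r.

Lemma tr_incl_linear : linear tr_incl.
Proof.
move=> a [q1 q2] [q3 q4]; rewrite /tr_incl/= scalerDr !scalerA !scalerDl.
by rewrite addrACA.
Qed.
HB.instance Definition _ :=
  GRing.isLinear.Build R (R * R)%type 'rV[R]_4 _ tr_incl tr_incl_linear.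

Lemma tr_incl_continuous : continuous tr_incl.
Proof.
by move=> q; apply: cvgD; apply: cvgZl; [exact: cvg_fst|exact: cvg_snd].
Qed.

Lemma tr_proj_shift x (q : R * R) : tr_proj (x - tr_incl (tr_proj x) + tr_incl q) = q.
Proof.
case: q => t r; rewrite /tr_proj !mxE !eqxx/=.
by congr pair; ring.
Qed.

Lemma smooth_tr M h : open M -> smooth_on M (fun x => h (tr_proj x)) ->
  smooth_on (@tr_proj R @` M) h.
Proof.
move=> oM hM n; apply: Cn_local => _ [x Mx <-].
pose s q := x - tr_incl (tr_proj x) + tr_incl q.
have cs : continuous s.
  by move=> q; apply: cvgD; [exact: cvg_cst|exact: tr_incl_continuous].
have oT : open (s @^-1` M) by apply: open_comp => // q _; exact: cs.
exists (s @^-1` M); split; first by rewrite /s/= subrK.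
have : Cn n (s @` (s @^-1` M)) (fun x => h (tr_proj x)).
  by apply: Cn_sub (hM n) => _ [q Mq <-].
move/(Cn_linear tr_incl_continuous oT).
by apply: Cn_eq => // q _; rewrite tr_proj_shift.
Qed.

Lemma tr_proj_open M : open M -> open (@tr_proj R @` M).
Proof.
move=> oM; rewrite openE => _ [x Mx <-].
pose s q := x - tr_incl (tr_proj x) + tr_incl q.
have cs : continuous s.
  by move=> q; apply: cvgD; [exact: cvg_cst|exact: tr_incl_continuous].
have oT : open (s @^-1` M) by apply: open_comp => // q _; exact: cs.
have : nbhs (tr_proj x) (s @^-1` M).
  by apply: open_nbhs_nbhs; split=> //; rewrite /s/= subrK.
by apply: filterS => q sq; exists (s q) => //; rewrite tr_proj_shift.
Qed.

Definition tr_base p : R * R := tr_proj p.1.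

Lemma tr_base_linear : linear tr_base.
Proof. by move=> a p w; rewrite /tr_base /tr_proj/= !mxE. Qed.
HB.instance Definition _ :=
  GRing.isLinear.Build R (TM R) (R * R)%type _ tr_base tr_base_linear.

Lemma tr_base_continuous : continuous tr_base.
Proof.
move=> p; apply: (@cvg_pair _ _ _ _ (nbhs (p.1 0 i_t)) (nbhs (p.1 0 i_r))).
  exact: base_coord_continuous.
exact: base_coord_continuous.
Qed.

Lemma tr_proj_continuous : continuous (@tr_proj R).
Proof.
have c i : continuous (fun x : 'rV[R]_4 => x 0 i) by exact: coord_continuous.
move=> x; apply: (@cvg_pair _ _ _ _ (nbhs (x 0 i_t)) (nbhs (x 0 i_r))).
  exact: (nbhs_filter x).
  exact: (c i_t x).
exact: (c i_r x).
Qed.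

Lemma smooth_tr_base (U : set (R * R)) (S : set (TM R)) h : open S ->
  (forall p, S p -> U (tr_proj p.1)) -> smooth_on U h ->
  smooth_on S (fun p => h (tr_proj p.1)).
Proof.
move=> oS SU hU n; have : Cn n ((fun p => 0 + tr_base p) @` S) h.
  by apply: Cn_sub (hU n) => _ [p Sp <-]; rewrite add0r; exact: SU.
move/(Cn_linear tr_base_continuous oS).
by apply: Cn_eq => // p _; rewrite add0r.
Qed.

Lemma is_derive_tr h p w : differentiable h (tr_proj p.1) ->
  is_derive p w (fun p => h (tr_proj p.1))
    (w.1 0 i_t * d_t h (tr_proj p.1) + w.1 0 i_r * d_r h (tr_proj p.1)).
Proof.
move=> dh; have dA : differentiable tr_base p.
  by apply: linear_differentiable; exact: tr_base_continuous.
apply: is_derive_eq (is_derive_comp w dA dh) _.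
have -> : 'D_w tr_base p = tr_base w.
  by rewrite deriveE// (@diff_lin _ _ _ tr_base p tr_base_continuous).
have -> : tr_base w = w.1 0 i_t *: ((1, 0) : R * R) + w.1 0 i_r *: ((0, 1) : R * R).
  exact: (plane_basis (tr_base w)).
by rewrite derive_addv// !derive_scalev.
Qed.

End TimeRadius.

Section Frame.
Variable R : realType.
Implicit Types (k : coeffs R) (q : R * R) (p w : TM R) (U V : set (R * R)).

Definition smooth_coeffs V k :=
  [/\ smooth_on V (k1 k), smooth_on V (k2 k), smooth_on V (k3 k), smooth_on V (k4 k) &
      smooth_on V (k5 k)] /\
  [/\ smooth_on V (k6 k), smooth_on V (k7 k), smooth_on V (k8 k), smooth_on V (k9 k) &
      smooth_on V (k10 k)].

Lemma smooth_coeffs_of_connection (M : set 'rV[R]_4) k : open M ->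
  (forall c a b, smooth_on M (fun x => sph_conn k x c a b)) ->
  smooth_coeffs (@tr_proj R @` M) k.
Proof.
move=> oM h; split; split; apply: smooth_tr => //.
- exact: (h i_t i_t i_t).
- exact: (h i_t i_t i_r).
- exact: (h i_t i_r i_r).
- exact: (h i_r i_t i_t).
- exact: (h i_r i_r i_r).
- exact: (h i_r i_t i_r).
- exact: (h i_t i_th i_th).
- exact: (h i_th i_th i_t).
- exact: (h i_th i_th i_r).
- exact: (h i_r i_th i_th).
Qed.

(* The relations on [a6], ..., [a13], solved for the derivatives of [a], [b], [c]. *)
Definition frame_t k q :=
  let a := fa k q in let b := fb k q in let c := fc k q in
  [/\ d_t (fa k) q = a ^+ 2 * k4 k q + a * k6 k q - a * k1 k q - k2 k q,
      d_t (fb k) q = b * (k1 k q + k6 k q - 2 * k8 k q) + k4 k q * (2 * a * b + c) &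
      d_t (fc k) q = 2 * b * k2 k q + 2 * c * (k6 k q - k8 k q) - 2 * a ^+ 2 * b * k4 k q].

Definition frame_r k q :=
  let a := fa k q in let b := fb k q in let c := fc k q in
  [/\ d_r (fa k) q = a ^+ 2 * k6 k q + a * k5 k q - a * k2 k q - k3 k q,
      d_r (fb k) q = b * (k2 k q + k5 k q - 2 * k9 k q) + k6 k q * (2 * a * b + c) &
      d_r (fc k) q = 2 * b * k3 k q + 2 * c * (k5 k q - k9 k q) - 2 * a ^+ 2 * b * k6 k q].

Lemma is_derive_div (V : normedModType R) (f g : V -> R) (x v : V) (df dg : R) :
  g x != 0 -> is_derive x v f df -> is_derive x v g dg ->
  is_derive x v (fun y => f y / g y) ((df * g x - f x * dg) / g x ^+ 2).
Proof.
move=> gx hf hg; apply: is_derive_eq (is_derive_mul hf (is_derive_inv gx hg)) _.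
by move: (f x) (g x) gx => F G G0; field.
Qed.

Lemma frame_derivatives V k q v : smooth_coeffs V k -> V q -> k10 k q != 0 ->
  let D f := 'D_v f q in
  [/\ D (fa k) = (D (k7 k) * k10 k q - k7 k q * D (k10 k)) / k10 k q ^+ 2,
      D (fb k) = (D (k8 k) * k10 k q - k8 k q * D (k10 k)) / k10 k q ^+ 2 &
      D (fc k) = ((D (k9 k) * k10 k q + k9 k q * D (k10 k)
          - (D (k7 k) * k8 k q + k7 k q * D (k8 k))) * k10 k q ^+ 2
        - (k9 k q * k10 k q - k7 k q * k8 k q) * (2 * k10 k q * D (k10 k))) / (k10 k q ^+ 2) ^+ 2].
Proof.
move=> [[_ _ _ _ _] [_ s7 s8 s9 s10]] Vq k0 D.
have d7 := is_derive_diff v (smooth_differentiable s7 Vq).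
have d8 := is_derive_diff v (smooth_differentiable s8 Vq).
have d9 := is_derive_diff v (smooth_differentiable s9 Vq).
have d10 := is_derive_diff v (smooth_differentiable s10 Vq).
split.
- by have [_ e] := is_derive_div k0 d7 d10; exact: e.
- by have [_ e] := is_derive_div k0 d8 d10; exact: e.
have k02 : k10 k q ^+ 2 != 0 by rewrite expf_neq0.
have [_ e] := @is_derive_div _ (fun y => k9 k y * k10 k y - k7 k y * k8 k y)
  (fun y => k10 k y ^+ 2) _ _ _ _ k02
  (is_derive_add (is_derive_mul d9 d10) (is_derive_opp (is_derive_mul d7 d8)))
  (is_derive_expn 2 d10).
by rewrite expr1 in e; exact: e.
Qed.

(** The relations give the derivatives of [k7], [k8], [k9] modulo multiples of the derivative of
    [k10], which stays undetermined. The multipliers are [a], [b] and [ab + c], so it drops out of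
    the quotients [fa], [fb], [fc]. *)
Lemma frame_of_relations V k q : smooth_coeffs V k -> V q -> k10 k q != 0 ->
  curvature_relations k q -> frame_t k q /\ frame_r k q.
Proof.
move=> sk Vq k0 [_ [[h6 h8 h9] [h10 h12 h13]]].
have [at_ bt ct] := frame_derivatives (1, 0) sk Vq k0.
have [ar br cr] := frame_derivatives (0, 1) sk Vq k0.
rewrite /frame_t /frame_r /d_t /d_r at_ bt ct ar br cr.
move: h6 h8 h9 h10 h12 h13; rewrite /a6 /a7 /a8 /a9 /a10 /a11 /a12 /a13 /fa /fb /fc /d_t /d_r.
move: k0; move: (k1 k q) (k2 k q) (k3 k q) (k4 k q) (k5 k q) (k6 k q) (k7 k q)
  (k8 k q) (k9 k q) (k10 k q) => K1 K2 K3 K4 K5 K6 K7 K8 K9 K10 k0.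
move: ('D_(1, 0) (k7 k) q) ('D_(1, 0) (k8 k) q) ('D_(1, 0) (k9 k) q) ('D_(1, 0) (k10 k) q)
  => T7 T8 T9 T10.
move: ('D_(0, 1) (k7 k) q) ('D_(0, 1) (k8 k) q) ('D_(0, 1) (k9 k) q) ('D_(0, 1) (k10 k) q)
  => S7 S8 S9 S10.
move=> h6 h8 h9 h10 h12 h13.
have -> : T7 = K7 * K8 - K1 * K7 - K2 * K10
  - K7 / K10 * (- T10 + K8 * K10 - K4 * K7 - K6 * K10) by rewrite -h6; ring.
have -> : T8 = K1 * K8 + K4 * K9 - K8 ^+ 2
  - K8 / K10 * (- T10 + K8 * K10 - K4 * K7 - K6 * K10) by rewrite -h8; ring.
have -> : T9 = K2 * K8 + K6 * K9 - K8 * K9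
  - (K7 / K10 * (K8 / K10) + (K9 * K10 - K7 * K8) / K10 ^+ 2)
     * (- T10 + K8 * K10 - K4 * K7 - K6 * K10) by rewrite -h9; ring.
have -> : S7 = K7 * K9 - K2 * K7 - K3 * K10
  - K7 / K10 * (- S10 + K9 * K10 - K6 * K7 - K5 * K10) by rewrite -h10; ring.
have -> : S8 = K2 * K8 + K6 * K9 - K8 * K9
  - K8 / K10 * (- S10 + K9 * K10 - K6 * K7 - K5 * K10) by rewrite -h12; ring.
have -> : S9 = K3 * K8 + K5 * K9 - K9 ^+ 2
  - (K7 / K10 * (K8 / K10) + (K9 * K10 - K7 * K8) / K10 ^+ 2)
     * (- S10 + K9 * K10 - K6 * K7 - K5 * K10) by rewrite -h13; ring.
by split; split; field.
Qed.

Definition flat_tr k q :=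
  [/\ a1 k q = 0, a2 k q = 0, a3 k q = 0, a4 k q = 0 & a5 k q = 0].

(** D - F gives [a5 = 0], F gives [a1 = a * a3], and the second relation then gives [a2 = a * a4].
    If [b] is nonzero, E kills [a3] and the third relation kills [a4]; if [b = 0], then [c] is
    nonzero and the third and first relations do so. *)
Lemma flat_of_relations k q : curvature_relations k q ->
  [/\ fD k q = 0, fE k q = 0 & fF k q = 0] -> (fb k q != 0) || (fc k q != 0) ->
  flat_tr k q.
Proof.
rewrite /flat_tr /curvature_relations /fD /fE /fF.
move: (fa k q) (fb k q) (fc k q) (a1 k q) (a2 k q) (a3 k q) (a4 k q) (a5 k q).
move=> a b c A1 A2 A3 A4 A5 [[h1 h2 h3] _] [hD hE hF] bc.
have e5 : A5 = 0 by lra.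
have e1 : A1 = a * A3 by lra.
have {hD hF} e2 : A2 = a * A4 by rewrite e1 in h2; lra.
have [b0|b0] := eqVneq b 0; last first.
  have e3 : A3 = 0 by move/eqP : hE; rewrite mulf_eq0 (negbTE b0) => /eqP.
  have e4 : A4 = 0.
    have : b * A4 = 0 by rewrite e1 e3 e5 in h3; lra.
    by move/eqP; rewrite mulf_eq0 (negbTE b0) => /eqP.
  by rewrite e2 e1 e3 e4 e5 mulr0.
have c0 : c != 0 by move: bc; rewrite b0 eqxx.
have e3 : A3 = 0.
  have : c * A3 = 0 by rewrite b0 in h3; lra.
  by move/eqP; rewrite mulf_eq0 (negbTE c0) => /eqP.
have e4 : A4 = 0.
  have : c * A4 = 0 by rewrite b0 e3 e5 in h1; lra.
  by move/eqP; rewrite mulf_eq0 (negbTE c0) => /eqP.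
by rewrite e2 e1 e3 e4 e5 mulr0.
Qed.

End Frame.

(** * Horizontal derivatives of u, v and the metric A *)

Section Horizontal.
Variable R : realType.
Implicit Types (k : coeffs R) (q : R * R) (p w : TM R) (U V : set (R * R)).

Lemma delta_tE k p (q := tr_proj p.1) (y := p.2 0) (w := (delta_h (sph_conn k) i_t p).2 0) :
  [/\ w i_t = - (k1 k q * y i_t + k2 k q * y i_r),
      w i_r = - (k4 k q * y i_t + k6 k q * y i_r),
      w i_th = - (k8 k q * y i_th) & w i_ph = - (k8 k q * y i_ph)].
Proof. by split; rewrite /w !mxE sum4 /sph_conn/= ?mul0r ?add0r ?addr0. Qed.

Lemma delta_rE k p (q := tr_proj p.1) (y := p.2 0) (w := (delta_h (sph_conn k) i_r p).2 0) :
  [/\ w i_t = - (k2 k q * y i_t + k3 k q * y i_r),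
      w i_r = - (k6 k q * y i_t + k5 k q * y i_r),
      w i_th = - (k9 k q * y i_th) & w i_ph = - (k9 k q * y i_ph)].
Proof. by split; rewrite /w !mxE sum4 /sph_conn/= ?mul0r ?add0r ?addr0. Qed.

Lemma delta_thE k p (q := tr_proj p.1) (y := p.2 0) (th := p.1 0 i_th)
    (w := (delta_h (sph_conn k) i_th p).2 0) :
  [/\ w i_t = - (k7 k q * y i_th), w i_r = - (k10 k q * y i_th),
      w i_th = - (k8 k q * y i_t + k9 k q * y i_r) & w i_ph = - (cos th / sin th * y i_ph)].
Proof. by split; rewrite /w !mxE sum4 /sph_conn/= ?mul0r ?add0r ?addr0. Qed.

Lemma delta_phE k p (q := tr_proj p.1) (y := p.2 0) (th := p.1 0 i_th)
    (w := (delta_h (sph_conn k) i_ph p).2 0) :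
  [/\ w i_t = - (k7 k q * sin th ^+ 2 * y i_ph), w i_r = - (k10 k q * sin th ^+ 2 * y i_ph),
      w i_th = sin th * cos th * y i_ph &
      w i_ph = - (k8 k q * y i_t + k9 k q * y i_r + cos th / sin th * y i_th)].
Proof.
by split; rewrite /w !mxE sum4 /sph_conn/= ?mul0r ?add0r ?addr0// mulNr opprK.
Qed.

Lemma basisE (a b : 'I_4) : basis R a 0 b = (b == a)%:R.
Proof. by rewrite mxE eqxx. Qed.

Lemma is_derive_u k p w : differentiable (fa k) (tr_proj p.1) ->
  let q := tr_proj p.1 in
  is_derive p w (u_ k) (w.2 0 i_t -
    ((w.1 0 i_t * d_t (fa k) q + w.1 0 i_r * d_r (fa k) q) * p.2 0 i_r + fa k q * w.2 0 i_r)).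
Proof.
move=> da q; apply: is_derive_add; first exact: is_derive_fibre.
by apply: is_derive_opp; apply: is_derive_mul; [exact: is_derive_tr|exact: is_derive_fibre].
Qed.

Lemma is_derive_wsq p w : is_derive p w (@wsq R)
  (2 * p.2 0 i_th * w.2 0 i_th + (2 * p.2 0 i_ph * w.2 0 i_ph * sin (p.1 0 i_th) ^+ 2
    + p.2 0 i_ph ^+ 2 * (2 * sin (p.1 0 i_th) * (cos (p.1 0 i_th) * w.1 0 i_th)))).
Proof.
have f i := is_derive_expn 2 (is_derive_fibre p w i).
have s := is_derive_expn 2 (is_derive_comp1 (is_derive_sin (p.1 0 i_th)) (is_derive_base p w i_th)).
have := is_derive_add (f i_th) (is_derive_mul (f i_ph) s).
by rewrite !expr1.
Qed.

Lemma is_derive_v k p w : differentiable (fb k) (tr_proj p.1) ->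
  differentiable (fc k) (tr_proj p.1) ->
  let q := tr_proj p.1 in
  let db := w.1 0 i_t * d_t (fb k) q + w.1 0 i_r * d_r (fb k) q in
  let dc := w.1 0 i_t * d_t (fc k) q + w.1 0 i_r * d_r (fc k) q in
  is_derive p w (v_ k) (dc * p.2 0 i_r ^+ 2 + fc k q * (2 * p.2 0 i_r * w.2 0 i_r)
    + ((2 * db * p.2 0 i_t + 2 * fb k q * w.2 0 i_t) * p.2 0 i_r
        + 2 * fb k q * p.2 0 i_t * w.2 0 i_r)
    - (2 * p.2 0 i_th * w.2 0 i_th + (2 * p.2 0 i_ph * w.2 0 i_ph * sin (p.1 0 i_th) ^+ 2
    + p.2 0 i_ph ^+ 2 * (2 * sin (p.1 0 i_th) * (cos (p.1 0 i_th) * w.1 0 i_th))))).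
Proof.
move=> dfb dfc q db dc.
have f i := is_derive_fibre p w i.
have c := is_derive_mul (is_derive_tr w dfc) (is_derive_expn 2 (f i_r)).
have b2 := is_derive_mul (is_derive_cst (2 : R) p w) (is_derive_tr w dfb).
have b := is_derive_mul (is_derive_mul b2 (f i_t)) (f i_r).
have := is_derive_add (is_derive_add c b) (is_derive_opp (is_derive_wsq p w)).
by rewrite !expr1 !mul0r !add0r.
Qed.

Lemma smooth_frame V k : open V -> smooth_coeffs V k -> (forall q, V q -> k10 k q != 0) ->
  [/\ smooth_on V (fa k), smooth_on V (fb k) & smooth_on V (fc k)].
Proof.
move=> oV [_ [_ s7 s8 s9 s10]] k0; split=> n.
- exact: Cn_div.
- exact: Cn_div.
apply: Cn_div => //; first by move=> q Vq; rewrite expf_neq0// k0.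
  by apply: Cn_sub_fun => //; apply: Cn_mul.
exact: Cn_expn.
Qed.

Section at_point.
Variables (V : set (R * R)) (k : coeffs R) (p : TM R).
Let q := tr_proj p.1.
Let th := p.1 0 i_th.
Hypotheses (oV : open V) (sk : smooth_coeffs V k) (Vk : forall q, V q -> k10 k q != 0)
  (Vq : V q) (ft : frame_t k q) (fr : frame_r k q) (s0 : sin th != 0).

Let da : differentiable (fa k) q.
Proof. by have [s _ _] := smooth_frame oV sk Vk; exact: smooth_differentiable s Vq. Qed.
Let db : differentiable (fb k) q.
Proof. by have [_ s _] := smooth_frame oV sk Vk; exact: smooth_differentiable s Vq. Qed.
Let dc : differentiable (fc k) q.
Proof. by have [_ _ s] := smooth_frame oV sk Vk; exact: smooth_differentiable s Vq. Qed.

Let k7E : k7 k q = fa k q * k10 k q.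
Proof. by rewrite /fa divfK// Vk. Qed.
Let k8E : k8 k q = fb k q * k10 k q.
Proof. by rewrite /fb divfK// Vk. Qed.
Let k9E : k9 k q = (fa k q * fb k q + fc k q) * k10 k q.
Proof.
rewrite /fa /fb /fc; have := Vk Vq.
by move: (k7 k q) (k8 k q) (k9 k q) (k10 k q) => K7 K8 K9 K10 K0; field.
Qed.

(** Origin of the equations for the potentials: [delta_a] rescales [u] by [- lam] and [v] by
    [- 2 kap], up to a multiple of [u ^+ 2]. Here [lam], [kap], [mu] are the components along [a] of
    dG/2, dK and k_4 dt + k_6 dr; all three vanish in the angular directions. *)
Lemma horizontal_frame (a : 'I_4) : exists lam kap mu : R,
  let w := delta_h (sph_conn k) a p in
  [/\ is_derive p w (u_ k) (- lam * u_ k p),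
      is_derive p w (v_ k) (- (2 * kap) * v_ k p - 2 * fb k q * mu * u_ k p ^+ 2) &
      forall G K Mf, potentials k V G K Mf ->
        let D h := w.1 0 i_t * d_t h q + w.1 0 i_r * d_r h q in
        [/\ D G = 2 * lam, D K = kap &
            D Mf = 2 * (expR (- (G q - 2 * K q)) * fb k q * mu)]].
Proof.
have e x : 2 * (2^-1 * x) = x :> R by rewrite mulrA divff// mul1r.
have pot G K Mf : potentials k V G K Mf -> _ := fun h => h.2 q Vq.
elim/ord4P: a.
- exists (k1 k q - k4 k q * fa k q), (k8 k q), (k4 k q) => w.
  have [wt wr wth wph] := delta_tE k p.
  split; last first.
    move=> G K Mf /pot[[g1 g2 g3 g4] [g5 g6]] D; rewrite /D /w/= !basisE/=.
    by rewrite !mul1r !mul0r !addr0 g1 g3 g6 e.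
  + apply: is_derive_eq (is_derive_v w db dc) _.
    rewrite /w wt wr wth wph/= !basisE/= /v_ /u_ /wsq -/q -/th.
    have [_ -> ->] := ft; move: (fa k q) (fb k q) (fc k q) (sin th) (cos th) => a b c s co.
    by ring.
  + apply: is_derive_eq (is_derive_u w da) _.
    rewrite /w wt wr/= !basisE/= /u_ -/q.
    by have [-> _ _] := ft; move: (fa k q) => a; ring.
- exists (k2 k q - k6 k q * fa k q), (k9 k q), (k6 k q) => w.
  have [wt wr wth wph] := delta_rE k p.
  split; last first.
    move=> G K Mf /pot[[g1 g2 g3 g4] [g5 g6]] D; rewrite /D /w/= !basisE/=.
    by rewrite !mul1r !mul0r !add0r g2 g4 g5 e.
  + apply: is_derive_eq (is_derive_v w db dc) _.
    rewrite /w wt wr wth wph/= !basisE/= /v_ /u_ /wsq -/q -/th.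
    have [_ -> ->] := fr; move: (fa k q) (fb k q) (fc k q) (sin th) (cos th) => a b c s co.
    by ring.
  + apply: is_derive_eq (is_derive_u w da) _.
    rewrite /w wt wr/= !basisE/= /u_ -/q.
    by have [-> _ _] := fr; move: (fa k q) => a; ring.
- exists 0, 0, 0 => w.
  have [wt wr wth wph] := delta_thE k p.
  split; last first.
    by move=> G K Mf _ D; rewrite /D /w/= !basisE/= !mulr0 !mul0r addr0.
  + apply: is_derive_eq (is_derive_v w db dc) _.
    rewrite /w wt wr wth wph/= !basisE/= /v_ /u_ /wsq -/q -/th k7E k8E k9E.
    move: s0; move: (fa k q) (fb k q) (fc k q) (sin th) (cos th) => a b c s co s_.
    by field.
  + apply: is_derive_eq (is_derive_u w da) _.
    rewrite /w wt wr/= !basisE/= /u_ -/q k7E.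
    by move: (fa k q) => a; ring.
- exists 0, 0, 0 => w.
  have [wt wr wth wph] := delta_phE k p.
  split; last first.
    by move=> G K Mf _ D; rewrite /D /w/= !basisE/= !mulr0 !mul0r addr0.
  + apply: is_derive_eq (is_derive_v w db dc) _.
    rewrite /w wt wr wth wph/= !basisE/= /v_ /u_ /wsq -/q -/th k7E k8E k9E.
    move: s0; move: (fa k q) (fb k q) (fc k q) (sin th) (cos th) => a b c s co s_.
    by field.
  + apply: is_derive_eq (is_derive_u w da) _.
    rewrite /w wt wr/= !basisE/= /u_ -/q k7E.
    by move: (fa k q) => a; ring.
Qed.

(* The square root of the factor [e^G u^2] of [L]: being linear in the fibre, it
   gives a parallel covector field on the base. *)
Definition uhalf (G : R * R -> R) (p : TM R) : R := expR (2^-1 * G (tr_proj p.1)) * u_ k p.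

Lemma horizontal_uhalf G K Mf a : potentials k V G K Mf ->
  is_derive p (delta_h (sph_conn k) a p) (uhalf G) 0.
Proof.
move=> pot; have [lam [kap [mu [du _ /(_ G K Mf pot)[gl _ _]]]]] := horizontal_frame a.
have [[sG _ _] _] := pot.
have dG := is_derive_tr (delta_h (sph_conn k) a p) (smooth_differentiable sG Vq).
have d2 := is_derive_mul (is_derive_cst (2^-1 : R) p (delta_h (sph_conn k) a p)) dG.
have := is_derive_mul (is_derive_comp1 (is_derive_expR _) d2) du.
have e : 2^-1 * (2 * lam) = lam by rewrite mulrA mulVf// mul1r.
move=> h; apply: is_derive_eq h _; rewrite gl.
rewrite mul0r add0r e -/q; move: (expR (2^-1 * G q)) (u_ k p) => E u; ring.
Qed.

(** The [u ^+ 2] term produced by [v] cancels against the derivative of [Mf]. The weight in the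
    equation for [Mf] is the quotient of [expR (2 * K q)] by [expR (G q)], exactly what this
    cancellation requires. *)
Lemma horizontal_Ametric G K Mf a : potentials k V G K Mf ->
  is_derive p (delta_h (sph_conn k) a p) (Ametric k G K Mf) 0.
Proof.
move=> pot; have [lam [kap [mu [du dv /(_ G K Mf pot)[gl gk gm]]]]] := horizontal_frame a.
set w := delta_h _ _ _ in du dv gl gk gm *.
have [[sG sK sM] _] := pot.
have dG := is_derive_tr w (smooth_differentiable sG Vq).
have dK := is_derive_tr w (smooth_differentiable sK Vq).
have dM := is_derive_tr w (smooth_differentiable sM Vq).
rewrite gl in dG; rewrite gk in dK; rewrite gm in dM.
have d2 := is_derive_comp1 (is_derive_expR _)
  (is_derive_mul (is_derive_cst (2 : R) p w) dK).
have dE := is_derive_comp1 (is_derive_expR _) dG.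
have := is_derive_add (is_derive_mul dv d2)
  (is_derive_mul (is_derive_mul dE dM) (is_derive_expn 2 du)).
move=> h; apply: is_derive_eq h _; rewrite /= expr1 -/q.
have -> : expR (2 * K q) = expR (G q) * expR (- (G q - 2 * K q)).
  by rewrite -expRD; congr expR; ring.
move: (expR (G q)) (expR (- _)) (u_ k p) (v_ k p) (Mf q) (fb k q) => E F u v m b.
by ring.
Qed.

End at_point.
End Horizontal.

(** * The potentials *)

Section Potentials.
Variable R : realType.
Implicit Types (k : coeffs R) (q : R * R) (U : set (R * R)) (f g : R * R -> R).

Lemma constant_on_rectangle (I J : set R) f : is_interval I -> is_interval J ->
  (forall q, (I `*` J) q -> [/\ differentiable f q, d_t f q = 0 & d_r f q = 0]) ->
  forall q q', (I `*` J) q -> (I `*` J) q' -> f q = f q'.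
Proof.
move=> iI iJ h q q' [Iq Jq] [Iq' Jq'].
have U (t : R) : 0 <= t <= 1 -> (I `*` J) (q' + t *: (q - q')).
  by move=> t01; split; exact: interval_between.
have [t t01|c c01] := @mvt_line R _ f q' (q - q').
  by have [] := h _ (U t t01).
move: (h _ (U c c01)); move: (q' + c *: (q - q')) => z [df ft fr].
rewrite [q' + _]addrC subrK; set v := q - q'.
rewrite (plane_basis v) derive_addv// !derive_scalev//.
rewrite -/(d_t f _) -/(d_r f _) ft fr !mulr0 addr0 => /eqP.
by rewrite subr_eq0 => /eqP.
Qed.

(* The determinant of the (t,r)-block of the metric [A]; it is a parallel
   density, hence vanishes everywhere or nowhere. *)
Definition tr_det k (G K Mf : R * R -> R) q : R :=
  expR (2 * K q) * ((fc k q + 2 * fa k q * fb k q) * (expR (G q) * Mf q)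
    - expR (2 * K q) * fb k q ^+ 2).

Section existence.
Variables (I J : set R) (k : coeffs R).
Let U := I `*` J.
Hypotheses (oI : open I) (iI : is_interval I) (oJ : open J) (iJ : is_interval J)
  (sk : smooth_coeffs U k) (Uk : forall q, U q -> k10 k q != 0)
  (ft : forall q, U q -> frame_t k q) (fr : forall q, U q -> frame_r k q)
  (fl : forall q, U q -> flat_tr k q)
  (bc : forall q, U q -> (fb k q != 0) || (fc k q != 0)).

Let oU : open U. Proof. exact: open_rectangle. Qed.

Let D1 v f q (sf : smooth_on U f) (Uq : U q) := is_derive_diff v (smooth_differentiable sf Uq).

Lemma potentials_exist : exists G K Mf : R * R -> R, potentials k U G K Mf /\
  forall q, U q -> tr_det k G K Mf q != 0.
Proof.
have [[q0 Uq0]|nU] := pselect (U !=set0); last first.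
  exists (fun=> 0), (fun=> 0), (fun=> 0); split; last by move=> q Uq; case: nU; exists q.
  split; first by split; exact: smooth_cst.
  by move=> q Uq; case: nU; exists q.
have [sa sb sc] := smooth_frame oU sk Uk.
have [[s1 s2 s3 s4 s5] [s6 s7 s8 s9 s10]] := sk.
have [G sG dG] : exists2 G : R * R -> R, smooth_on U G & forall q, U q ->
    d_t G q = 2 * (k1 k q - k4 k q * fa k q) /\ d_r G q = 2 * (k2 k q - k6 k q * fa k q).
  apply: poincare => //.
  - apply: smooth_mul; [exact: oU|exact: smooth_cst|apply: smooth_add => //].
    by apply: smooth_opp => //; exact: smooth_mul.
  - apply: smooth_mul; [exact: oU|exact: smooth_cst|apply: smooth_add => //].
    by apply: smooth_opp => //; exact: smooth_mul.
  move=> q Uq; rewrite /d_r /d_t.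
  have [_ ->] := is_derive_mul (is_derive_cst (2 : R) q (0, 1))
    (is_derive_add (D1 (0, 1) s1 Uq) (is_derive_opp (is_derive_mul (D1 (0, 1) s4 Uq) (D1 (0, 1) sa Uq)))).
  have [_ ->] := is_derive_mul (is_derive_cst (2 : R) q (1, 0))
    (is_derive_add (D1 (1, 0) s2 Uq) (is_derive_opp (is_derive_mul (D1 (1, 0) s6 Uq) (D1 (1, 0) sa Uq)))).
  have [e1 e2 e3 e4 e5] := fl Uq; have [at_ _ _] := ft Uq; have [ar _ _] := fr Uq.
  rewrite -/(d_r (fa k) q) -/(d_t (fa k) q) at_ ar.
  move: e1 e3; rewrite /a1 /a3 -/(d_r (k1 k) q) -/(d_r (k4 k) q) -/(d_t (k2 k) q) -/(d_t (k6 k) q).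
  move: (d_r (k1 k) q) (d_r (k4 k) q) (d_t (k2 k) q) (d_t (k6 k) q) (fa k q)
    (k1 k q) (k2 k q) (k3 k q) (k4 k q) (k5 k q) (k6 k q).
  move=> r1 r4 t2 t6 a K1 K2 K3 K4 K5 K6 e1 e3.
  have -> : r1 = t2 - K3 * K4 + K2 * K6 by lra.
  have -> : r4 = t6 - K1 * K6 - K4 * K5 + K2 * K4 + K6 ^+ 2 by lra.
  by ring.
have [K sK dK] : exists2 K : R * R -> R, smooth_on U K & forall q, U q ->
    d_t K q = k8 k q /\ d_r K q = k9 k q.
  apply: poincare => // q Uq; have [_ _ _ _ e5] := fl Uq.
  by apply/eqP; rewrite -subr_eq0; apply/eqP.
(* Auxiliary primitive of twice the trace of the connection on the (t,r)-block, the rate at which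
   the determinant of a parallel metric scales. Its form is closed because [a1 + a4 = 0]. *)
have [P sP dP] : exists2 P : R * R -> R, smooth_on U P & forall q, U q ->
    d_t P q = 2 * (k1 k q + k6 k q) /\ d_r P q = 2 * (k2 k q + k5 k q).
  apply: poincare => //.
  - by apply: smooth_mul; [exact: oU|exact: smooth_cst|exact: smooth_add].
  - by apply: smooth_mul; [exact: oU|exact: smooth_cst|exact: smooth_add].
  move=> q Uq; rewrite /d_r /d_t.
  have [_ ->] := is_derive_mul (is_derive_cst (2 : R) q (0, 1))
    (is_derive_add (D1 (0, 1) s1 Uq) (D1 (0, 1) s6 Uq)).
  have [_ ->] := is_derive_mul (is_derive_cst (2 : R) q (1, 0))
    (is_derive_add (D1 (1, 0) s2 Uq) (D1 (1, 0) s5 Uq)).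
  have [e1 _ _ e4 _] := fl Uq; move: e1 e4; rewrite /a1 /a4 /d_r /d_t.
  move: ('D_(0, 1) (k1 k) q) ('D_(0, 1) (k6 k) q) ('D_(1, 0) (k2 k) q) ('D_(1, 0) (k5 k) q).
  by move=> r1 r6 t2 t5; lra.
pose EF q := expR (- (G q - 2 * K q)).
have sGK : smooth_on U (fun q => - (G q - 2 * K q)).
  apply: smooth_opp => //; apply: smooth_add => //; apply: smooth_opp => //.
  by apply: smooth_mul => //; exact: smooth_cst.
have sEF : smooth_on U EF by exact: smooth_expR.
have dEF v q : U q -> is_derive q v EF (EF q * - ('D_v G q - 2 * 'D_v K q)).
  move=> Uq; have h := is_derive_opp (is_derive_add (D1 v sG Uq)
    (is_derive_opp (is_derive_mul (is_derive_cst (2 : R) q v) (D1 v sK Uq)))).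
  apply: is_derive_eq (is_derive_comp1 (is_derive_expR _) h) _.
  by rewrite mul0r add0r.
(* In the closedness condition the [2ab + c] parts of the derivatives of [b] cancel each other; the
   weight and the rest combine with the derivatives of [k4] and [k6] to a multiple of [a3], which is
   zero. *)
have [M0 sM dM] : exists2 M0 : R * R -> R, smooth_on U M0 & forall q, U q ->
    d_t M0 q = 2 * (EF q * fb k q * k4 k q) /\ d_r M0 q = 2 * (EF q * fb k q * k6 k q).
  apply: poincare => //.
  - apply: smooth_mul; [exact: oU|exact: smooth_cst|].
    by apply: smooth_mul => //; exact: smooth_mul.
  - apply: smooth_mul; [exact: oU|exact: smooth_cst|].
    by apply: smooth_mul => //; exact: smooth_mul.
  move=> q Uq; rewrite /d_r /d_t.
  have [_ ->] := is_derive_mul (is_derive_cst (2 : R) q (0, 1))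
    (is_derive_mul (is_derive_mul (dEF (0, 1) q Uq) (D1 (0, 1) sb Uq)) (D1 (0, 1) s4 Uq)).
  have [_ ->] := is_derive_mul (is_derive_cst (2 : R) q (1, 0))
    (is_derive_mul (is_derive_mul (dEF (1, 0) q Uq) (D1 (1, 0) sb Uq)) (D1 (1, 0) s6 Uq)).
  have [e1 e2 e3 e4 e5] := fl Uq; have [_ bt _] := ft Uq; have [_ br _] := fr Uq.
  have [Gt Gr] := dG q Uq; have [Kt Kr] := dK q Uq.
  rewrite -/(d_r (fb k) q) -/(d_t (fb k) q) bt br -/(d_r G q) -/(d_t G q) Gt Gr.
  rewrite -/(d_r K q) -/(d_t K q) Kt Kr.
  move: e3; rewrite /a3 -/(d_r (k4 k) q) -/(d_t (k6 k) q).
  move: (d_r (k4 k) q) (d_t (k6 k) q) (fa k q) (fb k q) (fc k q) (EF q)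
    (k1 k q) (k2 k q) (k3 k q) (k4 k q) (k5 k q) (k6 k q) (k8 k q) (k9 k q).
  move=> r4 t6 a b c E K1 K2 K3 K4 K5 K6 K8 K9 e3.
  have -> : r4 = t6 - K1 * K6 - K4 * K5 + K2 * K4 + K6 ^+ 2 by lra.
  by ring.
(* This makes [Mf q0] equal to 1 if [b] vanishes at [q0] and to 0 otherwise. Up to positive factors
   [tr_det] at [q0] is then [c] or [- b ^+ 2], nonzero in both cases. *)
pose C := (if fb k q0 == 0 then 1 else 0) - M0 q0.
pose Mf q := M0 q + C.
have sMf : smooth_on U Mf by apply: smooth_add => //; exact: smooth_cst.
have dMf v q : U q -> 'D_v Mf q = 'D_v M0 q.
  move=> Uq; have [_ ->] := is_derive_add (D1 v sM Uq) (is_derive_cst C q v).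
  by rewrite addr0.
have pot : potentials k U G K Mf.
  split=> // q Uq; have [Gt Gr] := dG q Uq; have [Kt Kr] := dK q Uq.
  have [Mt Mr] := dM q Uq; split; first by rewrite Gt Gr Kt Kr.
  have e x : 2^-1 * (2 * x) = x :> R by rewrite mulrA mulVf// mul1r.
  split; first by rewrite /d_r dMf// -/(d_r M0 q) Mr e.
  by rewrite /d_t dMf// -/(d_t M0 q) Mt e.
exists G, K, Mf; split=> // q Uq.
(* The factor [expR (- P q)] turns the parallel density into a constant function, so nonvanishing at
   [q0] spreads over the rectangle. *)
pose X q := tr_det k G K Mf q * expR (- P q).
have dX v q' (Uq' : U q') : is_derive q' v X (expR (- P q') * (
    expR (2 * K q') * (2 * 'D_v K q') * ((fc k q' + 2 * fa k q' * fb k q') * (expR (G q') * Mf q')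
       - expR (2 * K q') * fb k q' ^+ 2)
    + expR (2 * K q') * (('D_v (fc k) q' + 2 * ('D_v (fa k) q' * fb k q' + fa k q' * 'D_v (fb k) q')) * (expR (G q') * Mf q')
      + (fc k q' + 2 * fa k q' * fb k q') * (expR (G q') * 'D_v G q' * Mf q' + expR (G q') * 'D_v Mf q')
      - (expR (2 * K q') * (2 * 'D_v K q') * fb k q' ^+ 2 + expR (2 * K q') * (2 * fb k q' * 'D_v (fb k) q')))
    - tr_det k G K Mf q' * 'D_v P q')).
  have c2 := is_derive_cst (2 : R) q' v.
  have eK := is_derive_comp1 (is_derive_expR _) (is_derive_mul c2 (D1 v sK Uq')).
  have eG := is_derive_comp1 (is_derive_expR _) (D1 v sG Uq').
  have eP := is_derive_comp1 (is_derive_expR _) (is_derive_opp (D1 v sP Uq')).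
  have ee := is_derive_add (D1 v sc Uq') (is_derive_mul (is_derive_mul c2 (D1 v sa Uq')) (D1 v sb Uq')).
  have := is_derive_mul (is_derive_mul eK (is_derive_add
     (is_derive_mul ee (is_derive_mul eG (D1 v sMf Uq')))
     (is_derive_opp (is_derive_mul eK (is_derive_expn 2 (D1 v sb Uq')))))) eP.
  move=> h; apply: is_derive_eq h _; rewrite /= expr1 /tr_det.
  move: ('D_v K q') ('D_v G q') ('D_v P q') ('D_v (fc k) q') ('D_v (fa k) q') ('D_v (fb k) q') ('D_v Mf q').
  move: (expR (2 * K q')) (expR (G q')) (expR (- P q')) (fa k q') (fb k q') (fc k q') (Mf q').
  by move=> *; ring.
have X0 : X q0 != 0.
  have ex x : expR x != 0 :> R by rewrite gt_eqF// expR_gt0.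
  apply: mulf_neq0 => //; apply: mulf_neq0 => //; rewrite /Mf /C [M0 q0 + _]addrC subrK.
  have := bc Uq0; case: eqVneq => [-> /= c0 | b0 _].
    by rewrite expr0n/= !mulr0 addr0 subr0 mulr1 mulf_neq0.
  by rewrite !mulr0 sub0r oppr_eq0 mulf_neq0 ?expf_neq0.
have XE : X q = X q0.
  apply: (@constant_on_rectangle I J X iI iJ _ q q0 Uq Uq0) => q' Uq'.
  have [Gt Gr] := dG q' Uq'; have [Kt Kr] := dK q' Uq'; have [Pt Pr] := dP q' Uq'.
  have [Mt Mr] := dM q' Uq'.
  have E1 : expR (2 * K q') = expR (G q') * EF q' by rewrite -expRD; congr expR; ring.
  split.
  - have : smooth_on U X.
      have sE f : smooth_on U f -> smooth_on U (fun q => expR (f q)) by exact: smooth_expR.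
      have sc2 : smooth_on U (fun=> 2 : R) by exact: smooth_cst.
      apply: smooth_mul => //; last by apply: sE; exact: smooth_opp.
      apply: smooth_mul => //; first by apply: sE; exact: smooth_mul.
      apply: smooth_add => //.
        apply: smooth_mul => //; last by apply: smooth_mul => //; exact: sE.
        by apply: smooth_add => //; apply: smooth_mul => //; exact: smooth_mul.
      apply: smooth_opp => //; apply: smooth_mul => //; first by apply: sE; exact: smooth_mul.
      by move=> n; exact: Cn_expn.
    by move=> /smooth_differentiable; apply.
  - rewrite /d_t; have [_ ->] := dX (1, 0) q' Uq'; rewrite dMf//.
    rewrite -!/(d_t _ _) Gt Kt Pt Mt; have [-> -> ->] := ft Uq'.
    rewrite /tr_det E1.
    move: (expR (G q')) (EF q') (expR (- P q')) (fa k q') (fb k q') (fc k q') (Mf q').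
    move: (k1 k q') (k2 k q') (k4 k q') (k6 k q') (k8 k q') => *; ring.
  - rewrite /d_r; have [_ ->] := dX (0, 1) q' Uq'; rewrite dMf//.
    rewrite -!/(d_r _ _) Gr Kr Pr Mr; have [-> -> ->] := fr Uq'.
    rewrite /tr_det E1.
    move: (expR (G q')) (EF q') (expR (- P q')) (fa k q') (fb k q') (fc k q') (Mf q').
    move: (k2 k q') (k3 k q') (k5 k q') (k6 k q') (k9 k q') => *; ring.
by move: X0; rewrite -XE /X mulf_eq0 negb_or => /andP[].
Qed.

End existence.
End Potentials.

(** * Rotational invariance *)

Section SphericalSymmetry.
Variable R : realType.
Implicit Types (k : coeffs R) (q : R * R) (p w : TM R) (S : set (TM R)) (f : TM R -> R).

(** The symmetry orbits used below move in at most two fixed directions of the tangent bundle, with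
    scalar coefficients differentiable at 0. *)
Lemma curve_differentiable (V : normedModType R) (x v w : V) (al be : R -> R) (a b : R) :
  is_derive (0 : R) 1 al a -> is_derive (0 : R) 1 be b -> al 0 = 0 -> be 0 = 0 ->
  let g t := x + (al t *: v + be t *: w) in
  [/\ g 0 = x, differentiable g 0 & 'D_(1 : R^o) (g : R^o -> V) 0 = a *: v + b *: w].
Proof.
move=> [da ea] [db eb] a0 b0 g.
have g0 : g 0 = x by rewrite /g a0 b0 !scale0r !addr0.
have dz (c : R -> R) (z : V) : derivable c 0 1 ->
    differentiable (fun t => c t *: z) 0 /\
    'd (fun t => c t *: z) (0 : R) (1 : R) = ('D_1 c 0) *: z.
  move=> /derivable1_diffP dc; split; first exact: differentiableZl.
  by rewrite diffZl// [in RHS]deriveE.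
have [d1 e1] := dz al v da; have [d2 e2] := dz be w db.
have dg : differentiable g 0.
  by apply: differentiableD => //; exact: differentiableD.
split=> //.
have D (c : R -> R) (z : V) (e : R) : differentiable (fun t => c t *: z) 0 ->
    'd (fun t => c t *: z) (0 : R) (1 : R) = ('D_1 c 0) *: z -> 'D_1 c 0 = e ->
    is_derive (0 : R^o) 1 (fun t : R^o => c t *: z) (e *: z).
  move=> dc ec <-; apply: DeriveDef; first exact: diff_derivable.
  by rewrite (@deriveE _ R^o V _ _ _ dc).
have := is_deriveD (@is_derive_cst _ R^o V x 0 1) (is_deriveD (D _ _ _ d1 e1 ea) (D _ _ _ d2 e2 eb)).
by rewrite add0r => -[_ e]; exact: e.
Qed.

Lemma is_derive_curve (V : normedModType R) (f : V -> R) (x v w : V) (al be : R -> R) (a b : R) :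
  differentiable f x ->
  is_derive (0 : R) 1 al a -> is_derive (0 : R) 1 be b -> al 0 = 0 -> be 0 = 0 ->
  is_derive (0 : R) 1 (fun t => f (x + (al t *: v + be t *: w))) (a * 'D_v f x + b * 'D_w f x).
Proof.
move=> df da db a0 b0; have [g0 dg Dg] := curve_differentiable x v w da db a0 b0.
have df' : differentiable f (x + (al 0 *: v + be 0 *: w)) by rewrite g0.
apply: is_derive_eq (is_derive_comp (1 : R^o) dg df') _.
by rewrite Dg g0 derive_addv// !derive_scalev.
Qed.

Lemma curve_near (V : normedModType R) (S : set V) (x v w : V) (al be : R -> R) (a b : R) :
  open S -> S x ->
  is_derive (0 : R) 1 al a -> is_derive (0 : R) 1 be b -> al 0 = 0 -> be 0 = 0 ->
  \forall t \near (0 : R), S (x + (al t *: v + be t *: w)).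
Proof.
move=> oS Sx da db a0 b0; have [g0 dg _] := curve_differentiable x v w da db a0 b0.
have nS : nbhs (x + (al 0 *: v + be 0 *: w)) S by rewrite g0; apply: open_nbhs_nbhs.
exact: (differentiable_continuous dg nS).
Qed.

Lemma spherical_eq S f p p' : spherically_symmetric S f -> S p -> S p' ->
  p.1 0 i_t = p'.1 0 i_t -> p.1 0 i_r = p'.1 0 i_r ->
  p.2 0 i_t = p'.2 0 i_t -> p.2 0 i_r = p'.2 0 i_r -> wsq p = wsq p' -> f p = f p'.
Proof. by move=> [l fl] Sp Sp' e1 e2 e3 e4 e5; rewrite !fl// e1 e2 e3 e4 e5. Qed.

Lemma spherical_rotation S f p : open S -> S p -> differentiable f p ->
  spherically_symmetric S f -> sin (p.1 0 i_th) != 0 ->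
  p.2 0 i_ph * sin (p.1 0 i_th) ^+ 2 * vd i_th f p = p.2 0 i_th * vd i_ph f p.
Proof.
move=> oS Sp df sf; set s := sin _ => s0; set y := p.2 0.
(* Rotation by the angle [t] of the angular velocity in the orthonormal components
   [(y i_th, s * y i_ph)]; it preserves [wsq]. *)
pose al (t : R) := y i_th * (cos t - 1) - y i_ph * s * sin t.
pose be (t : R) := y i_ph * (cos t - 1) + y i_th / s * sin t.
have da : is_derive (0 : R) 1 al (- (y i_ph * s)).
  have c (e : R) : is_derive (0 : R) (1 : R) (fun=> e) 0 by exact: is_derive_cst.
  apply: is_derive_eq (is_derive_add
    (is_derive_mul (c (y i_th)) (is_derive_add (is_derive_cos 0) (c (- 1 : R))))
    (is_derive_opp (is_derive_mul (c (y i_ph * s)) (is_derive_sin 0)))) _.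
  by rewrite sin0 cos0; ring.
have db : is_derive (0 : R) 1 be (y i_th / s).
  have c (e : R) : is_derive (0 : R) (1 : R) (fun=> e) 0 by exact: is_derive_cst.
  apply: is_derive_eq (is_derive_add
    (is_derive_mul (c (y i_ph)) (is_derive_add (is_derive_cos 0) (c (- 1 : R))))
    (is_derive_mul (c (y i_th / s)) (is_derive_sin 0))) _.
  by rewrite sin0 cos0; ring.
have a0 : al 0 = 0 by rewrite /al sin0 cos0; ring.
have b0 : be 0 = 0 by rewrite /be sin0 cos0; ring.
have H := is_derive_curve (0, basis R i_th) (0, basis R i_ph) df da db a0 b0.
have H0 : is_derive (0 : R) 1 (fun t => f (p + (al t *: (0, basis R i_th) + be t *: (0, basis R i_ph)))) 0.
  apply: near_eq_is_derive (is_derive_cst (f p) (0 : R) 1).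
  apply: filterS (curve_near (0, basis R i_th) (0, basis R i_ph) oS Sp da db a0 b0) => t St.
  apply: (spherical_eq sf Sp St); rewrite /wsq/= !mxE ?scaler0 ?addr0//= ?mulr0 ?addr0//.
  rewrite -/s -!/(y _) !mulr1 add0r /al /be.
  have sc := cos2Dsin2 t; move: (y i_th) (y i_ph) (sin t) (cos t) s0 sc => A B si co s0 sc.
  have -> : A ^+ 2 + B ^+ 2 * s ^+ 2 = (co ^+ 2 + si ^+ 2) * (A ^+ 2 + B ^+ 2 * s ^+ 2).
    by rewrite sc mul1r.
  by field.
have := is_derive_unique H H0; rewrite -/(vd i_th f p) -/(vd i_ph f p).
move: (vd i_th f p) (vd i_ph f p) (y i_th) (y i_ph) s0 => F1 F2 A B s0 E.
have -> : B * s ^+ 2 * F1 = - s * (- (B * s) * F1 + A / s * F2) + A * F2 by field.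
by rewrite E mulr0 add0r.
Qed.

Lemma spherical_azimuth S f p : open S -> S p -> differentiable f p ->
  spherically_symmetric S f -> pd i_ph f p = 0.
Proof.
move=> oS Sp df sf; have da := is_derive_id (0 : R) (1 : R).
have db := is_derive_cst (0 : R) (0 : R) (1 : R).
have H := is_derive_curve (basis R i_ph, 0) (0, 0) df da db erefl erefl.
have H0 : is_derive (0 : R) 1 (fun t : R => f (p + (t *: (basis R i_ph, 0) + (cst 0 t) *: (0, 0)))) 0.
  apply: near_eq_is_derive (is_derive_cst (f p) (0 : R) 1).
  apply: filterS (curve_near (basis R i_ph, 0) (0, 0) oS Sp da db erefl erefl) => t St.
  by apply: (spherical_eq sf Sp St); rewrite /wsq/= !mxE ?scaler0 ?addr0//= ?mulr0 ?addr0.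
by have := is_derive_unique H H0; rewrite mul1r mul0r addr0.
Qed.

Lemma spherical_polar S f p : open S -> S p -> differentiable f p ->
  spherically_symmetric S f -> sin (p.1 0 i_th) != 0 ->
  pd i_th f p = cos (p.1 0 i_th) / sin (p.1 0 i_th) * p.2 0 i_ph * vd i_ph f p.
Proof.
move=> oS Sp df sf; set th := p.1 0 i_th; set s := sin _ => s0; set y := p.2 0.
have da := is_derive_id (0 : R) (1 : R).
(* When the polar angle moves to [th + t], this correction keeps the product of the azimuthal
   velocity with the sine fixed, hence also [wsq]. *)
pose be (t : R) := y i_ph * (s / sin (th + t) - 1).
have s0' : sin (th + 0) != 0 by rewrite addr0.
have ds : is_derive (0 : R) 1 (fun t => sin (th + t)) (cos th).
  have d1 := is_derive_add (is_derive_cst th (0 : R) (1 : R)) (is_derive_id (0 : R) (1 : R)).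
  apply: is_derive_eq (is_derive_comp1 (is_derive_sin _) d1) _.
  by rewrite add0r mulr1 addr0.
have db : is_derive (0 : R) 1 be (- (cos th / s * y i_ph)).
  have c (e : R) : is_derive (0 : R) (1 : R) (fun=> e) 0 by exact: is_derive_cst.
  apply: is_derive_eq (is_derive_mul (c (y i_ph)) (is_derive_add
    (is_derive_div s0' (c s) ds) (c (- 1 : R)))) _.
  by rewrite addr0 -/s; field.
have b0 : be 0 = 0 by rewrite /be addr0 divff// subrr mulr0.
have H := is_derive_curve (basis R i_th, 0) (0, basis R i_ph) df da db erefl b0.
have H0 : is_derive (0 : R) 1 (fun t => f (p + (t *: (basis R i_th, 0) + be t *: (0, basis R i_ph)))) 0.
  apply: near_eq_is_derive (is_derive_cst (f p) (0 : R) 1).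
  have sn : \forall t \near (0 : R), sin (th + t) != 0.
    have ct : {for (0 : R), continuous (fun t => sin (th + t))}.
      by have [/derivable1_diffP d _] := ds; exact: differentiable_continuous.
    exact: (cvgr_neq0 _ ct s0').
  apply: filterS2 sn (curve_near (basis R i_th, 0) (0, basis R i_ph) oS Sp da db erefl b0) => t st St.
  apply: (spherical_eq sf Sp St); rewrite /wsq/= !mxE ?scaler0 ?addr0//= ?mulr0 ?addr0//.
  rewrite !add0r !mulr1 -/th -/s -!/(y _) /be.
  by move: (y i_th) (y i_ph) (sin (th + t)) st => A B s' s'0; field.
have := is_derive_unique H H0; rewrite mul1r -/(pd i_th f p) -/(vd i_ph f p).
by move: (pd i_th f p) (vd i_ph f p) => F1 F2 E; apply/eqP; rewrite -subr_eq0 -[X in _ == X]E; apply/eqP; ring.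
Qed.

(** On the axis the rotation identity is empty, and [f] depends on the square root of [wsq], which
    is singular there. But [f] is even in each angular velocity, so these derivatives vanish. *)
Lemma spherical_axis S f p : open S -> S p -> differentiable f p ->
  spherically_symmetric S f -> p.2 0 i_th = 0 -> p.2 0 i_ph = 0 ->
  vd i_th f p = 0 /\ vd i_ph f p = 0.
Proof.
move=> oS Sp df sf y1 y2.
have da := is_derive_id (0 : R) (1 : R); have dn := is_derive_opp da.
have db := is_derive_cst (0 : R) (0 : R) (1 : R).
have key i : i = i_th \/ i = i_ph -> vd i f p = 0.
  move=> hi.
  have H1 := is_derive_curve (0, basis R i) (0, 0) df da db erefl erefl.
  have H2 := is_derive_curve (0, basis R i) (0, 0) df dn db (oppr0 _) erefl.
  have : is_derive (0 : R) 1
      (fun t : R => f (p + (t *: (0, basis R i) + cst 0 t *: (0, 0)))) (- 1 * vd i f p).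
    rewrite mul0r addr0 in H2; apply: near_eq_is_derive H2.
    apply: filterS2 (curve_near (0, basis R i) (0, 0) oS Sp da db erefl erefl)
      (curve_near (0, basis R i) (0, 0) oS Sp dn db (oppr0 _) erefl) => t S1 S2.
    by case: hi S1 S2 => -> S1 S2; apply: (spherical_eq sf S2 S1);
      rewrite /wsq/= !mxE ?scaler0 ?addr0//= ?mulr0 ?addr0// ?y1 ?y2 !add0r !mulr1 sqrrN.
  move=> /(is_derive_unique H1); rewrite mul0r addr0 mul1r mulN1r -/(vd i f p).
  by move: (vd i f p) => F E; lra.
by split; apply: key; [left|right].
Qed.

End SphericalSymmetry.

Lemma is_derive_scale (R : realType) (V : normedModType R) (c : R) (f : V -> R) x v (df : R) :
  is_derive x v f df -> is_derive x v (fun y => c * f y) (c * df).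
Proof.
move=> h; apply: is_derive_eq (is_derive_mul (is_derive_cst c x v) h) _.
by rewrite mul0r add0r.
Qed.

Lemma mulmx_tr_col (R : comNzRingType) (H : 'M[R]_4) (c d : R) b j :
  (H *m \col_i (c * (i == i_t)%:R + d * (i == i_r)%:R)) b j = c * H b i_t + d * H b i_r.
Proof. by rewrite !mxE sum4 !mxE/=; ring. Qed.

(** * First-order constraints on rotationally invariant parallel functions *)

Section Invariants.
Variable R : realType.
Implicit Types (k : coeffs R) (q : R * R) (p w : TM R) (S : set (TM R)) (f : TM R -> R).

Lemma derive_delta k f p a : differentiable f p ->
  'D_(delta_h (sph_conn k) a p) f p =
  pd a f p + \sum_c (delta_h (sph_conn k) a p).2 0 c * vd c f p.
Proof.
move=> df; rewrite derive_horizontal// -sumrN; congr (_ + _); apply: eq_bigr => c _.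
by rewrite !mxE mulNr.
Qed.

(** The cotangent term of the connection cancels against the polar derivative dictated by rotational
    symmetry, which leaves a purely vertical equation. *)
Lemma polar_invariance k S f p : open S -> S p -> differentiable f p ->
  spherically_symmetric S f -> sin (p.1 0 i_th) != 0 ->
  'D_(delta_h (sph_conn k) i_th p) f p = 0 ->
  p.2 0 i_th * (k7 k (tr_proj p.1) * vd i_t f p + k10 k (tr_proj p.1) * vd i_r f p)
  + (k8 k (tr_proj p.1) * p.2 0 i_t + k9 k (tr_proj p.1) * p.2 0 i_r) * vd i_th f p = 0.
Proof.
move=> oS Sp df sf s0; rewrite derive_delta// sum4 (spherical_polar oS Sp df sf s0).
have [-> -> -> ->] := delta_thE k p.
move: (vd i_t f p) (vd i_r f p) (vd i_th f p) (vd i_ph f p) => F1 F2 F3 F4.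
move: (p.2 0 i_t) (p.2 0 i_r) (p.2 0 i_th) (p.2 0 i_ph) => y1 y2 y3 y4.
move: (k7 k _) (k8 k _) (k9 k _) (k10 k _) => K7 K8 K9 K10 E.
by apply/eqP; rewrite -oppr_eq0 -[X in _ == X]E; apply/eqP; ring.
Qed.

Lemma azimuth_invariance k S f p : open S -> S p -> differentiable f p ->
  spherically_symmetric S f -> sin (p.1 0 i_th) != 0 ->
  'D_(delta_h (sph_conn k) i_ph p) f p = 0 ->
  p.2 0 i_ph * sin (p.1 0 i_th) ^+ 2 *
     (k7 k (tr_proj p.1) * vd i_t f p + k10 k (tr_proj p.1) * vd i_r f p)
  + (k8 k (tr_proj p.1) * p.2 0 i_t + k9 k (tr_proj p.1) * p.2 0 i_r) * vd i_ph f p = 0.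
Proof.
move=> oS Sp df sf s0; rewrite derive_delta// sum4 (spherical_azimuth oS Sp df sf).
have := spherical_rotation oS Sp df sf s0.
have [-> -> -> ->] := delta_phE k p; move: s0.
move: (vd i_t f p) (vd i_r f p) (vd i_th f p) (vd i_ph f p) => F1 F2 F3 F4.
move: (p.2 0 i_t) (p.2 0 i_r) (p.2 0 i_th) (p.2 0 i_ph) => y1 y2 y3 y4.
move: (k7 k _) (k8 k _) (k9 k _) (k10 k _) (sin _) (cos _) => K7 K8 K9 K10 s co s0 rot E.
have E2 : s * co * y4 * F3 = co / s * (y4 * s ^+ 2 * F3) by field.
by apply/eqP; rewrite -oppr_eq0 -[X in _ == X]E E2 rot; apply/eqP; ring.
Qed.

Lemma frame_nonzero M (A : set (TM R)) (L : TM R -> R) k x :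
  spherical_domain M -> pseudo_finsler M A L -> spherically_symmetric A L ->
  horizontally_constant (sph_conn k) A L -> M x -> k10 k (tr_proj x) != 0 ->
  (fb k (tr_proj x) != 0) || (fc k (tr_proj x) != 0).
Proof.
move=> [oM dM] [[oA AM xA _] sL _ uH] ss hc Mx k0; apply/negP => /negP.
rewrite negb_or !negbK => /andP[b0 c0].
have k8_0 : k8 k (tr_proj x) = 0.
  by move: b0; rewrite /fb mulf_eq0 invr_eq0 (negbTE k0) orbF => /eqP.
have k9_0 : k9 k (tr_proj x) = 0.
  move: c0; rewrite /fc k8_0 mulr0 subr0 mulf_eq0 invr_eq0 expf_eq0/= (negbTE k0) orbF.
  by rewrite mulf_eq0 (negbTE k0) orbF => /eqP.
have s0 : sin (x 0 i_th) != 0.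
  by have [_ t0 tp] := dM x Mx; rewrite gt_eqF// sin_gt0_pi// t0.
have [y0 Ay0] := xA x Mx.
(* The invariance equation carries the factor [y i_th]. Openness of [A] allows a direction where
   this factor is nonzero. *)
have [y Ay yth] : exists2 y, A (x, y) & y 0 i_th != 0.
  have [y00|] := eqVneq (y0 0 i_th) 0; last by exists y0.
  have da := is_derive_id (0 : R) (1 : R); have db := is_derive_cst (0 : R) (0 : R) (1 : R).
  have nA := curve_near (0, basis R i_th) (0, 0) oA Ay0 da db erefl erefl.
  have nz : \forall t \near (0 : R)^', t != 0 by exact: nbhs_dnbhs_neq.
  have [t [t0 At]] := filter_ex (filterI nz (nbhs_dnbhs nA)).
  move: At; have -> : (x, y0) + (t *: (0, basis R i_th) + cst 0 t *: (0, 0)) =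
      (x, y0 + t *: basis R i_th) :> TM R.
    by congr pair; rewrite /= ?scaler0 ?addr0.
  by exists (y0 + t *: basis R i_th) => //; rewrite !mxE y00 add0r !eqxx mulr1.
set K7 := k7 k (tr_proj x); set K10 := k10 k (tr_proj x) in k0.
pose phi p := K7 * vd i_t L p + K10 * vd i_r L p.
have dDL v p : A p -> differentiable ('D_v L) p by have [_ /(_ v) [+ _]] := sL 2%N; apply.
have phi0 y' : A (x, y') -> y' 0 i_th != 0 -> phi (x, y') = 0.
  move=> Ay' yth'; have dL : differentiable L (x, y') by have [+ _] := sL 1%N; apply.
  have := polar_invariance oA Ay' dL ss s0 (hc _ Ay' i_th).
  rewrite /= k8_0 k9_0 !mul0r addr0 mul0r addr0 => /eqP.
  by rewrite mulf_eq0 (negbTE yth') => /eqP.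
have Dphi b : K7 * vd b (vd i_t L) (x, y) + K10 * vd b (vd i_r L) (x, y) = 0.
  have d1 : is_derive (x, y) (0, basis R b) phi
      (K7 * vd b (vd i_t L) (x, y) + K10 * vd b (vd i_r L) (x, y)).
    apply: is_derive_add; apply: is_derive_scale.
      exact: (is_derive_diff (0, basis R b) (dDL (0, basis R i_t) _ Ay)).
    exact: (is_derive_diff (0, basis R b) (dDL (0, basis R i_r) _ Ay)).
  have dphi : differentiable phi (x, y).
    apply: differentiableD; apply: differentiableM => //; exact: dDL.
  have da := is_derive_id (0 : R) (1 : R); have db := is_derive_cst (0 : R) (0 : R) (1 : R).
  have H1 := is_derive_curve (0, basis R b) (0, 0) dphi da db erefl erefl.
  have H0 : is_derive (0 : R) 1
      (fun t : R => phi ((x, y) + (t *: (0, basis R b) + cst 0 t *: (0, 0)))) 0.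
    apply: near_eq_is_derive (is_derive_cst (0 : R) (0 : R) 1).
    pose S : set (TM R) := A `&` [set p : TM R | p.2 0 i_th != 0].
    have oS : open S.
      rewrite openE => p [Ap pth]; apply: filterI; first exact: open_nbhs_nbhs.
      exact: (cvgr_neq0 _ (@fibre_coord_continuous R i_th p) pth).
    have Sxy : S (x, y) by [].
    apply: filterS (curve_near (0, basis R b) (0, 0) oS Sxy da db erefl erefl) => t.
    have -> : (x, y) + (t *: (0, basis R b) + cst 0 t *: (0, 0)) =
      (x, y + t *: basis R b) :> TM R.
      by congr pair; rewrite /= ?scaler0 ?addr0.
    by move=> [At yt]; rewrite phi0.
  have := is_derive_unique H1 H0; case: d1 => _ ->.
  by rewrite mul0r addr0 mul1r.
have Hcol : hessian L (x, y) *m (\col_i (K7 * (i == i_t)%:R + K10 * (i == i_r)%:R)) = 0.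
  apply/matrixP => b j; rewrite mulmx_tr_col !mxE mulrCA [K10 * _]mulrCA -mulrDr.
  by rewrite Dphi mulr0.
have : invmx (hessian L (x, y)) *m (hessian L (x, y) *m (\col_i (K7 * (i == i_t)%:R + K10 * (i == i_r)%:R))) = 0.
  by rewrite Hcol mulmx0.
rewrite mulmxA mulVmx ?uH// mul1mx => /matrixP/(_ i_r 0).
by rewrite !mxE/= mulr0 mulr1 add0r => /eqP; rewrite (negbTE k0).
Qed.

(** Subtracting from [w] its horizontal lift changes nothing, since [f] is horizontally constant,
    and leaves a vertical vector. *)
Lemma vertical_part k f p w : differentiable f p ->
  (forall a, 'D_(delta_h (sph_conn k) a p) f p = 0) ->
  'D_w f p = \sum_i (w.2 0 i - \sum_a w.1 0 a * (delta_h (sph_conn k) a p).2 0 i) * vd i f p.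
Proof.
move=> df hc.
have wE : w = \sum_a w.1 0 a *: delta_h (sph_conn k) a p +
    (0, w.2 - \sum_a w.1 0 a *: (delta_h (sph_conn k) a p).2).
  have -> : \sum_a w.1 0 a *: delta_h (sph_conn k) a p =
     (\sum_a w.1 0 a *: basis R a, \sum_a w.1 0 a *: (delta_h (sph_conn k) a p).2).
    rewrite !sum4; by congr pair.
  rewrite -vectE [RHS]surjective_pairing/= addr0 addrC subrK.
  exact: surjective_pairing.
rewrite {1}wE derive_addv// derive_sumv// big1 ?add0r => [|a _]; last by rewrite hc mulr0.
rewrite derive_vertical//; apply: eq_bigr => i _; congr (_ * _).
rewrite [LHS]mxE; congr (_ + _); rewrite [LHS]mxE; congr (- _).
by rewrite summxE; apply: eq_bigr => a _; rewrite [LHS]mxE.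
Qed.

(* The vertical gradient of an invariant function is orthogonal to the Euler
   field, to the rotation field and to the fields produced by the angular
   horizontal directions; off [u = 0] this leaves one dimension. *)
Lemma gradient_direction (yt yr yh yp s K7 K8 K9 K10 : R) :
  s != 0 -> K10 != 0 -> yt - K7 / K10 * yr != 0 ->
  exists e : R * R * R * R, forall ft fr fh fp : R,
    yt * ft + yr * fr + yh * fh + yp * fp = 0 ->
    yp * s ^+ 2 * fh = yh * fp ->
    yh * (K7 * ft + K10 * fr) + (K8 * yt + K9 * yr) * fh = 0 ->
    yp * s ^+ 2 * (K7 * ft + K10 * fr) + (K8 * yt + K9 * yr) * fp = 0 ->
    (yh = 0 -> yp = 0 -> fh = 0 /\ fp = 0) ->
    exists m, [/\ ft = m * e.1.1.1, fr = m * e.1.1.2, fh = m * e.1.2 & fp = m * e.2].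
Proof.
move=> s0 K0; set a := K7 / K10; set u := yt - a * yr => u0.
have k7E : K7 = a * K10 by rewrite /a divfK.
pose B := K8 * yt + K9 * yr.
(* [n] is a nonzero angular factor and [m] the matching gradient component. Euler's relation and the
   invariance equation form a linear system in [ft], [fr] with determinant [n * K10 * u]. *)
have solve (n m ft fr C : R) : n != 0 -> yt * ft + yr * fr = - (C * m) ->
    n * (K7 * ft + K10 * fr) + B * m = 0 ->
    ft = m * ((yr * B / (n * K10) - C) / u) /\
    fr = m * (- (B / (n * K10)) - a * ((yr * B / (n * K10) - C) / u)).
  move=> n0 E1 E2.
  have e2 : fr = - (B * m / (n * K10)) - a * ft.
    apply: (mulfI (mulf_neq0 n0 K0)); rewrite mulrBr mulrN.
    rewrite [n * K10 * (_ / _)]mulrC divfK ?mulf_neq0//.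
    by move: E2; rewrite k7E => E2; lra.
  have e1 : ft * u = m * (yr * B / (n * K10) - C).
    move: E1; rewrite e2 /u => E1.
    have -> : ft * (yt - a * yr) = (yt * ft + yr * (- (B * m / (n * K10)) - a * ft)) + yr * (B * m / (n * K10)) by ring.
    by rewrite E1; field; rewrite K0 n0.
  have e1' : ft = m * ((yr * B / (n * K10) - C) / u) by rewrite mulrA -e1 mulfK.
  split=> //; rewrite e2 {1}e1'; ring.
have [yh0|yh0] := eqVneq yh 0; last first.
  exists ((yr * B / (yh * K10) - (yh + yp * (yp * s ^+ 2 / yh))) / u,
     - (B / (yh * K10)) - a * ((yr * B / (yh * K10) - (yh + yp * (yp * s ^+ 2 / yh))) / u),
     1, yp * s ^+ 2 / yh) => ft fr fh fp E rot E1 E2 _.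
  have efp : fp = fh * (yp * s ^+ 2 / yh) by apply: (mulfI yh0); rewrite -rot; field.
  have [] := solve yh fh ft fr (yh + yp * (yp * s ^+ 2 / yh)) yh0 _ E1.
    by move: E; rewrite efp; lra.
  by exists fh; rewrite mulr1.
have [yp0|yp0] := eqVneq yp 0; last first.
  have n0 : yp * s ^+ 2 != 0 by rewrite mulf_neq0 ?expf_neq0.
  exists ((yr * B / (yp * s ^+ 2 * K10) - yp) / u,
     - (B / (yp * s ^+ 2 * K10)) - a * ((yr * B / (yp * s ^+ 2 * K10) - yp) / u),
     0, 1) => ft fr fh fp E rot E1 E2 _.
  have efh : fh = 0.
    by move/eqP: rot; rewrite yh0 mul0r mulf_eq0 (negbTE n0) => /eqP.
  have [] := solve (yp * s ^+ 2) fp ft fr yp n0 _ E2.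
    by move: E; rewrite efh; lra.
  by exists fp; rewrite mulr0 mulr1.
(* On the axis only Euler's relation in the (t,r)-components remains, and [u0] prevents [yt] and
   [yr] from vanishing together. *)
have [yt0|yt0] := eqVneq yt 0; last first.
  exists (- (yr / yt), 1, 0, 0) => ft fr fh fp E rot E1 E2 /(_ yh0 yp0)[-> ->].
  exists fr; split; rewrite ?mulr0 ?mulr1//.
  apply: (mulfI yt0); move: E; rewrite yh0 yp0 !mul0r !addr0 => E.
  have -> : yt * (fr * - (yr / yt)) = - (yr * fr) by field.
  lra.
have yr0 : yr != 0.
  by apply: contra_neq u0 => e; rewrite /u yt0 e mulr0 subr0.
exists (1, 0, 0, 0) => ft fr fh fp E rot E1 E2 /(_ yh0 yp0)[-> ->].
exists ft; split; rewrite ?mulr0 ?mulr1//.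
move: E; rewrite yt0 yh0 yp0 !mul0r !addr0 add0r => /eqP.
by rewrite mulf_eq0 (negbTE yr0) => /eqP.
Qed.

End Invariants.

(** * Brackets of fibrewise linear fields *)

Section LinearFields.
Variable R : realType.
Implicit Types (p w : TM R) (X Y : TM R -> TM R) (B C : 'rV[R]_4 -> 'M[R]_4)
  (c d : 'rV[R]_4) (N : set 'rV[R]_4).

Lemma is_derive_pair_cst (V U W : normedModType R) (d : U) (g : V -> W) (x v : V) (dg : W) :
  is_derive x v g dg -> is_derive x v (fun y => (d, g y) : U * W) (0, dg).
Proof.
move=> [dgx <-].
have lim : (fun h : R => h^-1 *: (((fun y => (d, g y) : U * W) \o shift x) (h *: v) - (d, g x)))
    @ 0^' --> ((0, 'D_v g x) : U * W).
  have -> : (fun h : R => h^-1 *: (((fun y => (d, g y) : U * W) \o shift x) (h *: v) - (d, g x)))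
     = fun h : R => (0, h^-1 *: ((g \o shift x) (h *: v) - g x)) : U * W.
    by apply/funext => h; congr pair; rewrite /= subrr scaler0.
  apply: (@cvg_pair _ _ _ _ (nbhs (0 : U)) (nbhs ('D_v g x))); first exact: cvg_cst.
  exact: dgx.
apply: DeriveDef; first by apply/cvg_ex; exists (0, 'D_v g x).
exact/cvg_lim.
Qed.

Lemma is_derive_mx (V : normedModType R) m n (g : V -> 'M[R]_(m, n)) (x v : V)
    (dg : 'M[R]_(m, n)) :
  (forall i j, is_derive x v (fun y => g y i j) (dg i j)) -> is_derive x v g dg.
Proof.
move=> h; have dgx : derivable g x v by apply/derivable_mxP => i j; have [] := h i j.
apply: DeriveDef => //; rewrite derive_mx//; apply/matrixP => i j; rewrite mxE.
by have [] := h i j.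
Qed.

Lemma is_derive_base_fun (h : 'rV[R]_4 -> R) p w : differentiable h p.1 ->
  is_derive p w (fun p => h p.1) ('D_(w.1) h p.1).
Proof.
move=> dh; have ll : linear (fun p : TM R => p.1) by [].
pose A : {linear TM R -> 'rV[R]_4} := HB.pack (fun p : TM R => p.1)
  (GRing.isLinear.Build _ _ _ _ (fun p : TM R => p.1) ll).
have cA : continuous A by move=> q; exact: cvg_fst.
have dA : differentiable A p by apply: linear_differentiable; exact: cA.
apply: is_derive_eq (is_derive_comp w dA dh) _.
by congr ('D_ _ _ _); rewrite deriveE// (@diff_lin _ _ _ A p cA).
Qed.

Definition dmx B v x : 'M[R]_4 := \matrix_(i, j) 'D_v (fun x => B x i j) x.

Definition smooth_mx N B := forall i j, smooth_on N (fun x => B x i j).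

(** The base part [c] is a constant vector. Brackets of such fields are of the same kind with base
    part 0, so iterated brackets are followed through their matrices alone. *)
Definition is_linear_field N X c B :=
  smooth_mx N B /\ forall p, N p.1 -> X p = (c, p.2 *m B p.1).

Lemma is_derive_linear_field N X c B p w : open N -> is_linear_field N X c B -> N p.1 ->
  is_derive p w X (0, w.2 *m B p.1 + p.2 *m dmx B w.1 p.1).
Proof.
move=> oN [sB XE] Np.
have h : is_derive p w (fun p : TM R => (c, p.2 *m B p.1) : TM R)
    (0, w.2 *m B p.1 + p.2 *m dmx B w.1 p.1).
  apply: is_derive_pair_cst; apply: is_derive_mx => i j.
  have dB a : differentiable (fun x => B x a j) p.1.
    by have [+ _] := sB a j 1%N; apply.
  have := is_derive_sum_fun (fun a => is_derive_mul (is_derive_fibre p w a) (is_derive_base_fun w (dB a))).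
  rewrite [X in is_derive _ _ X _ -> _](_ : _ = fun y : TM R => (y.2 *m B y.1) i j); last first.
    by apply/funext => y; rewrite [i]ord1 !mxE.
  move=> H; apply: is_derive_eq H _; rewrite [i]ord1 !mxE big_split/=.
  by congr (_ + _); apply: eq_bigr => a _; rewrite !mxE.
apply: near_eq_is_derive h.
have oN' : open [set p : TM R | N p.1].
  by apply: open_comp => // q _; exact: cvg_fst.
have : \forall q \near p, N q.1 by exact: (open_nbhs_nbhs (conj oN' Np)).
by apply: filterS => q Nq; rewrite XE.
Qed.

Lemma smooth_mx_mul N B C : open N -> smooth_mx N B -> smooth_mx N C ->
  smooth_mx N (fun x => B x *m C x).
Proof.
move=> oN sB sC i j n.
have : Cn n N (fun x => \sum_a B x i a * C x a j).
  by apply: Cn_sum => // a; apply: Cn_mul => //; [exact: sB|exact: sC].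
by apply: Cn_eq => // x _; rewrite mxE.
Qed.

Lemma smooth_mx_sub N B C : open N -> smooth_mx N B -> smooth_mx N C ->
  smooth_mx N (fun x => B x - C x).
Proof.
move=> oN sB sC i j n.
have : Cn n N (fun x => B x i j - C x i j).
  by apply: Cn_sub_fun => //; [exact: sB|exact: sC].
by apply: Cn_eq => // x _; rewrite !mxE.
Qed.

Lemma smooth_dmx N B v : open N -> smooth_mx N B -> smooth_mx N (dmx B v).
Proof.
move=> oN sB i j n; have [_ /(_ v)] := sB i j n.+1.
by apply: Cn_eq => // x _; rewrite mxE.
Qed.

(** For the fields [delta_h], whose matrices are minus the connection coefficients, this is the
    curvature matrix. *)
Definition bracket_mx c B d C x : 'M[R]_4 :=
  (B x *m C x - C x *m B x) - (dmx B d x - dmx C c x).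

Lemma linear_field_bracket N X c B Y d C : open N ->
  is_linear_field N X c B -> is_linear_field N Y d C ->
  is_linear_field N (lie_bracket X Y) 0 (bracket_mx c B d C).
Proof.
move=> oN hX hY; have [sB XE] := hX; have [sC YE] := hY; split.
  apply: smooth_mx_sub => //.
    by apply: smooth_mx_sub => //; exact: smooth_mx_mul.
  by apply: smooth_mx_sub => //; exact: smooth_dmx.
move=> p Np; rewrite /lie_bracket.
have [_ ->] := is_derive_linear_field (X p) oN hY Np.
have [_ ->] := is_derive_linear_field (Y p) oN hX Np.
rewrite XE// YE//= /bracket_mx; congr pair; rewrite /= ?subr0//.
by rewrite !mulmxBr !mulmxA opprD addrACA opprB.
Qed.

Lemma bracket_annihilates N f X c B Y d C : open N ->
  is_linear_field N X c B -> is_linear_field N Y d C ->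
  smooth_on [set p : TM R | N p.1] f ->
  (forall p, N p.1 -> 'D_(X p) f p = 0) -> (forall p, N p.1 -> 'D_(Y p) f p = 0) ->
  forall p, N p.1 -> 'D_(lie_bracket X Y p) f p = 0.
Proof.
move=> oN hX hY sf fX fY p Np.
pose S := [set p : TM R | N p.1].
have oS : open S by apply: open_comp => // q _; exact: cvg_fst.
have df q : S q -> differentiable f q by have [+ _] := sf 1%N; apply.
have dDf v q : S q -> differentiable ('D_v f) q by have [_ /(_ v) [+ _]] := sf 2%N; apply.
(* Derivative along [w] of the identity ['D_(Z q) f q = 0]: one term with the direction frozen at
   [Z p], one with the direction differentiated. The two instances, subtracted, give the bracket,
   because second derivatives commute. *)
have key Z e E w : is_linear_field N Z e E -> (forall q, N q.1 -> 'D_(Z q) f q = 0) ->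
    'D_w ('D_(Z p) f) p + 'D_('D_w Z p) f p = 0.
  move=> hZ fZ; have [_ ZE] := hZ.
  have [_ ->] := is_derive_linear_field w oN hZ Np.
  have split_vec (e' z : 'rV[R]_4) q : S q ->
      'D_(e', z) f q = 'D_(e', 0) f q + \sum_i z 0 i * vd i f q.
    move=> Sq; have -> : (e', z) = (e', 0) + (0, z) :> TM R.
      by congr pair; rewrite /= ?addr0 ?add0r.
    by rewrite derive_addv ?derive_vertical//; exact: df.
  set z := p.2 *m E p.1.
  have dz : is_derive p w ('D_(e, z) f)
      ('D_w ('D_(e, 0) f) p + \sum_i z 0 i * 'D_w (vd i f) p).
    have h := is_derive_add (is_derive_diff w (dDf (e, 0) p Np))
      (is_derive_sum_fun (fun i => is_derive_scale (z 0 i) (is_derive_diff w (dDf (0, basis R i) p Np)))).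
    apply: near_eq_is_derive h.
    have : \forall q \near p, S q by apply: open_nbhs_nbhs.
    by apply: filterS => q Sq; rewrite [RHS]split_vec.
  have dB j : is_derive p w (fun q : TM R => (q.2 *m E q.1) 0 j)
      ((w.2 *m E p.1 + p.2 *m dmx E w.1 p.1) 0 j).
    have dE a : differentiable (fun x => E x a j) p.1.
      by have [+ _] := hZ.1 a j 1%N; apply.
    have := is_derive_sum_fun (fun a => is_derive_mul (is_derive_fibre p w a) (is_derive_base_fun w (dE a))).
    rewrite [X in is_derive _ _ X _ -> _](_ : _ = fun y : TM R => (y.2 *m E y.1) 0 j); last first.
      by apply/funext => y; rewrite !mxE.
    move=> H; apply: is_derive_eq H _; rewrite !mxE big_split/=.
    by congr (_ + _); apply: eq_bigr => a _; rewrite !mxE.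
  have H1 := is_derive_add (is_derive_diff w (dDf (e, 0) p Np))
      (is_derive_sum_fun (fun i => is_derive_mul (dB i) (is_derive_diff w (dDf (0, basis R i) p Np)))).
  have H0 : is_derive p w (fun q => 'D_(e, 0) f q + \sum_i (q.2 *m E q.1) 0 i * vd i f q) 0.
    apply: near_eq_is_derive (is_derive_cst (0 : R) p w).
    have : \forall q \near p, S q by apply: open_nbhs_nbhs.
    by apply: filterS => q Sq; rewrite -split_vec// -ZE// fZ.
  have e1 : 'D_(0, w.2 *m E p.1 + p.2 *m dmx E w.1 p.1) f p =
      \sum_i (w.2 *m E p.1 + p.2 *m dmx E w.1 p.1) 0 i * vd i f p.
    by rewrite derive_vertical//; exact: df.
  rewrite ZE// -/z e1; case: dz => _ ->.
  apply: etrans (is_derive_unique H1 H0); rewrite big_split/= -addrA.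
  by congr (_ + _); rewrite addrC.
have kX := key X c B (Y p) hX fX; have kY := key Y d C (X p) hY fY.
have comm := derive_comm (X p) (Y p) oS (sf 2%N) Np.
have -> : lie_bracket X Y p = (- 1) *: 'D_(Y p) X p + 'D_(X p) Y p.
  by rewrite scaleN1r addrC.
rewrite (derive_lin (- 1) ('D_(Y p) X p) ('D_(X p) Y p) (df p Np)).
by rewrite -(addKr ('D_(Y p) ('D_(X p) f) p) ('D_('D_(Y p) X p) f p)) kX addr0 comm mulN1r opprK.
Qed.

Lemma delta_linear_field (Gam : connection R) N a : 
  (forall i j k, smooth_on N (fun x => Gam x i j k)) -> open N ->
  is_linear_field N (delta_h Gam a) (basis R a) (fun x => \matrix_(b, c) - Gam x c a b).
Proof.
move=> sG oN; split.
  move=> b c n; have : Cn n N (fun x => - Gam x c a b) by apply: Cn_opp => //; exact: sG.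
  by apply: Cn_eq => // x _; rewrite mxE.
move=> p Np; congr pair; apply/rowP => c; rewrite !mxE -sumrN.
by apply: eq_bigr => b _; rewrite !mxE mulrN mulrC.
Qed.

End LinearFields.

(** * The metric A *)

Section QuadraticForms.
Variable R : realType.
Implicit Types (p w : TM R) (g : 'rV[R]_4 -> 'M[R]_4).

Definition quadratic g (p : TM R) : R :=
  \sum_(a < 4) \sum_(b < 4) g p.1 a b * p.2 0 a * p.2 0 b.

Lemma vd_quadratic g p d : (forall i j, g p.1 i j = g p.1 j i) ->
  is_derive p (0, basis R d) (quadratic g) (2 * \sum_a g p.1 d a * p.2 0 a).
Proof.
move=> sg; apply: is_derive_eq (is_derive_sum_fun (fun a => is_derive_sum_fun (fun b =>
  is_derive_mul (is_derive_mul (is_derive_vertical (fun x => g x a b) p (basis R d))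
    (is_derive_fibre p (0, basis R d) a)) (is_derive_fibre p (0, basis R d) b)))) _.
rewrite /= (eq_bigr (fun a => basis R d 0 a * (\sum_b g p.1 a b * p.2 0 b)
    + g p.1 a d * p.2 0 a)); last first.
  move=> a _; rewrite (eq_bigr (fun b => basis R d 0 a * (g p.1 a b * p.2 0 b)
     + basis R d 0 b * (g p.1 a b * p.2 0 a))) => [|b _]; last by ring.
  rewrite big_split/= -big_distrr/=; congr (_ + _).
  rewrite (bigD1 d)//= big1 ?addr0 ?basisE ?eqxx ?mul1r// => b bd.
  by rewrite basisE (negbTE bd) mul0r.
rewrite big_split/= (bigD1 d)//= [X in _ + X + _]big1 ?addr0 => [|b bd]; last first.
  by rewrite basisE (negbTE bd) mul0r.
rewrite basisE eqxx mul1r mulr2n mulrDl mul1r; congr (_ + _).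
by apply: eq_bigr => a _; rewrite sg.
Qed.

Lemma derive_vertical_quadratic g p v : (forall i j, g p.1 i j = g p.1 j i) ->
  differentiable (quadratic g) p ->
  'D_(0, v) (quadratic g) p = 2 * (v *m g p.1 *m p.2^T) 0 0.
Proof.
move=> sg dq; rewrite derive_vertical// mxE big_distrr/=.
rewrite (eq_bigr (fun d => \sum_a 2 * (v 0 d * g p.1 d a * p.2 0 a))); last first.
  move=> d _; have [_ e] := vd_quadratic d sg; rewrite [vd d _ p]e big_distrr/= big_distrr/=.
  by apply: eq_bigr => a _; ring.
rewrite exchange_big/=; apply: eq_bigr => a _; rewrite !mxE big_distrl/= big_distrr/=.
by apply: eq_bigr.
Qed.

Lemma hessian_quadratic g p : open [set x | forall i j, g x i j = g x j i] ->
  (forall i j, g p.1 i j = g p.1 j i) -> hessian (quadratic g) p = g p.1.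
Proof.
move=> oS sg; apply/matrixP => a b; rewrite mxE.
have h : is_derive p (0, basis R a) (fun q : TM R => 2 * \sum_c g q.1 b c * q.2 0 c) (2 * g p.1 b a).
  apply: is_derive_scale.
  apply: is_derive_eq (is_derive_sum_fun (fun c =>
    is_derive_mul (is_derive_vertical (fun x => g x b c) p (basis R a))
      (is_derive_fibre p (0, basis R a) c))) _.
  rewrite /= (bigD1 a)//= big1 ?addr0 => [|c ca]; rewrite basisE ?eqxx ?mul0r ?add0r ?mulr1//.
  by rewrite (negbTE ca) mulr0.
have e : vd a (vd b (quadratic g)) p = 2 * g p.1 b a.
  have [_ <-] := h; apply: near_eq_derive.
  pose S := [set q : TM R | forall i j, g q.1 i j = g q.1 j i].
  have oS' : open S.
    by apply: (open_comp (f := fun q : TM R => q.1)) oS => q _; exact: cvg_fst.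
  have : \forall q \near p, S q by apply: open_nbhs_nbhs.
  by apply: filterS => q Sq; have [_ e] := vd_quadratic b Sq; exact: e.
by rewrite e mulrA mulVf// mul1r sg.
Qed.

Definition block_mx4 (A B C D E : R) : 'M[R]_4 := \matrix_(i, j)
  (match nat_of_ord i, nat_of_ord j with
   | 0, 0 => A | 0, 1 | 1, 0 => B | 1, 1 => C | 2, 2 => D | 3, 3 => E
   | _, _ => 0%R
   end)%N.

Lemma block_mx4_sym A B C D E i j : block_mx4 A B C D E i j = block_mx4 A B C D E j i.
Proof. by elim/ord4P: i; elim/ord4P: j; rewrite !mxE. Qed.

Lemma block_mx4_unit A B C D E : A * C - B ^+ 2 != 0 -> D != 0 -> E != 0 ->
  block_mx4 A B C D E \in unitmx.
Proof.
set d := A * C - B ^+ 2 => d0 D0 E0.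
have : block_mx4 A B C D E *m block_mx4 (C / d) (- B / d) (A / d) D^-1 E^-1 = 1%:M.
  apply/matrixP => i j; rewrite mxE sum4 !mxE.
  by elim/ord4P: i; elim/ord4P: j; rewrite /=; rewrite ?mulr0 ?mul0r ?addr0 ?add0r ?mulfV//;
    rewrite /d; field.
by move/mulmx1_unit => [].
Qed.

End QuadraticForms.

Section Metric.
Variable R : realType.
Implicit Types (k : coeffs R) (G K Mf : R * R -> R) (p w : TM R) (x : 'rV[R]_4).

Definition metric_mx k G K Mf x : 'M[R]_4 :=
  let q := tr_proj x in
  let P := expR (G q) * Mf q in let E := expR (2 * K q) in
  block_mx4 P (E * fb k q - fa k q * P) (E * fc k q + fa k q ^+ 2 * P)
    (- E) (- E * sin (x 0 i_th) ^+ 2).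

Lemma Ametric_quadratic k G K Mf : Ametric k G K Mf = quadratic (metric_mx k G K Mf).
Proof.
apply/funext => p; rewrite /quadratic !sum4 !mxE/= /Ametric /v_ /u_ /wsq.
by ring.
Qed.

Lemma metric_mx_sym k G K Mf x i j : metric_mx k G K Mf x i j = metric_mx k G K Mf x j i.
Proof. exact: block_mx4_sym. Qed.

Lemma metric_mx_unit k G K Mf x : tr_det k G K Mf (tr_proj x) != 0 ->
  sin (x 0 i_th) != 0 -> metric_mx k G K Mf x \in unitmx.
Proof.
move=> d0 s0; apply: block_mx4_unit.
- rewrite [X in X != 0](_ : _ = tr_det k G K Mf (tr_proj x))// /tr_det.
  by move: (expR _) (expR _) => *; ring.
- by rewrite oppr_eq0 gt_eqF// expR_gt0.
- by rewrite mulf_neq0 ?oppr_eq0 ?expf_neq0// gt_eqF// expR_gt0.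
Qed.

Lemma hessian_Ametric k G K Mf p :
  hessian (Ametric k G K Mf) p = metric_mx k G K Mf p.1.
Proof.
rewrite Ametric_quadratic hessian_quadratic//; last exact: metric_mx_sym.
rewrite (_ : [set x | _] = setT); first exact: openT.
by apply/seteqP; split=> // x _ i j; exact: metric_mx_sym.
Qed.

End Metric.

(** * Dimension of the span of the brackets *)

Section LinearClosure.
Variables (R : realType) (V : vectType R).

(** Among the subspaces contained in [S], take one of maximal dimension. A point of [S] outside it
    could be adjoined without leaving [S], so it exhausts [S]. *)
Lemma linear_closed_vspace (S : set V) (W0 : {vspace V}) : S 0 ->
  (forall a x y, S x -> S y -> S (a *: x + y)) -> S `<=` [set x | x \in W0] ->
  exists W : {vspace V}, (forall x, S x <-> x \in W) /\ (\dim W <= \dim W0)%N.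
Proof.
move=> S0 Sl SW0.
pose P n := `[< exists W : {vspace V}, (forall x, x \in W -> S x) /\ \dim W = n >].
have exP : exists n, P n.
  by exists 0%N; apply/asboolP; exists 0%VS; split=> [x|]; [rewrite memv0 => /eqP ->|rewrite dimv0].
have ubP n : P n -> (n <= \dim W0)%N.
  by move=> /asboolP[W [WS <-]]; apply: dimvS; apply/subvP => x /WS /SW0.
have [n /asboolP[W [WS Wn]] max] := ex_maxnP exP ubP.
exists W; split; last by rewrite Wn; apply: ubP; apply/asboolP; exists W.
move=> x; split=> [Sx|]; last exact: WS.
apply/negPn/negP => xW.
have : (\dim (<[x]> + W) <= n)%N.
  apply: max; apply/asboolP; exists (<[x]> + W)%VS; split=> // y.
  by move=> /memv_addP[_ /vlineP[a ->] [z zW ->]]; apply: Sl => //; exact: WS.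
rewrite -Wn => dle.
have : (W == <[x]> + W)%VS by rewrite eqEdim addvSr dle.
have xxW : x + 0 \in (<[x]> + W)%VS by rewrite memv_add ?memv_line ?mem0v.
by move=> /eqP eW; move: xxW; rewrite addr0 -eW (negbTE xW).
Qed.

End LinearClosure.

Section BracketSpan.
Variable R : realType.
Implicit Types (p : TM R) (Gam : connection R).

Lemma DH0 Gam p : DH Gam p 0.
Proof.
exists 0%N, (fun _ => delta_h Gam i_t), (fun _ => 0); split; last by rewrite big_ord0.
by case.
Qed.

Lemma DH_lin Gam p a x y : DH Gam p x -> DH Gam p y -> DH Gam p (a *: x + y).
Proof.
move=> [n [Y [c [hY ->]]]] [m [Z [d [hZ ->]]]].
exists (n + m)%N, (fun i => match fintype.split i with inl j => Y j | inr j => Z j end),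
  (fun i => match fintype.split i with inl j => a * c j | inr j => d j end); split.
  by move=> i; case: fintype.split.
rewrite big_split_ord/= scaler_sumr; congr (_ + _); apply: eq_bigr => i _.
  by rewrite (unsplitK (inl i)) scalerA.
by rewrite (unsplitK (inr i)).
Qed.

(** Each bracket is the horizontal lift of its base part plus a vector in the span of [v1] and [v2];
    in a vertical combination the lifts cancel. *)
Lemma VDH_dim_le Gam p (v1 v2 : 'rV[R]_4) :
  (forall Y, horizontal_bracket Gam Y -> exists c1 c2 : R,
     Y p = \sum_a (Y p).1 0 a *: delta_h Gam a p + (0, c1 *: v1 + c2 *: v2)) ->
  dim_le (VDH Gam p) 2.
Proof.
move=> hY; pose e1 : TM R := (0, v1); pose e2 : TM R := (0, v2).
have [||/=|W [SW dW]] := @linear_closed_vspace R (TM R) (VDH Gam p) <<[:: e1; e2]>>%VS.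
- by split=> //; exact: DH0.
- move=> a x y [hx x0] [hy y0]; split; first exact: DH_lin.
  by rewrite /= x0 y0 scaler0 addr0.
- move=> X [[n [Y [c [hb ->]]]] X0].
  have /choice[f hf] : forall i, exists c12 : R * R, Y i p = \sum_a (Y i p).1 0 a *: delta_h Gam a p
      + (c12.1 *: e1 + c12.2 *: e2).
    move=> i; have [c1 [c2 E]] := hY _ (hb i); exists (c1, c2); apply: etrans E _.
    by congr (_ + _); congr pair; rewrite /= !scaler0 addr0.
  have X1 a : \sum_i c i * (Y i p).1 0 a = 0.
    have : base_coord a (\sum_i c i *: Y i p) = 0 by rewrite /base_coord X0 mxE.
    by move=> E; apply: etrans E; rewrite linear_sum; apply: eq_bigr => i _; rewrite linearZ.
  have -> : \sum_i c i *: Y i p = \sum_i c i *: ((f i).1 *: e1 + (f i).2 *: e2).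
    under eq_bigr => i _ do rewrite hf scalerDr scaler_sumr.
    rewrite big_split/= exchange_big/= big1 ?add0r// => a _.
    under eq_bigr => i _ do rewrite scalerA.
    by rewrite -scaler_suml X1 scale0r.
  apply: memv_suml => i _; apply: memvZ; apply: memvD; apply: memvZ; apply: memv_span.
    by rewrite mem_head.
  by rewrite !inE eqxx orbT.
- exists W; split=> //; apply: leq_trans dW _.
  exact: dim_span.
Qed.

End BracketSpan.

(** * Holonomy and the Ricci tensor *)

Section Region.
Variable R : realType.
Implicit Types (p w : TM R) (x : 'rV[R]_4).
Variables (U : set (R * R)) (k : coeffs R) (G K Mf : R * R -> R) (N : set 'rV[R]_4).
Hypotheses (oU : open U) (sk : smooth_coeffs U k) (Uk : forall q, U q -> k10 k q != 0)
  (ft : forall q, U q -> frame_t k q) (fr : forall q, U q -> frame_r k q)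
  (pot : potentials k U G K Mf) (det0 : forall q, U q -> tr_det k G K Mf q != 0)
  (oN : open N) (NU : forall x, N x -> U (tr_proj x))
  (Ns : forall x, N x -> sin (x 0 i_th) != 0)
  (sG : forall i j l, smooth_on N (fun x => sph_conn k x i j l)).

Definition over : set (TM R) := [set p | N p.1].

Lemma over_open : open over.
Proof. by apply: (open_comp (f := fun p : TM R => p.1)) oN => p _; exact: cvg_fst. Qed.

Lemma smooth_over h : smooth_on U h -> smooth_on over (fun p => h (tr_proj p.1)).
Proof. by apply: smooth_tr_base; [exact: over_open|move=> p; exact: NU]. Qed.

Lemma smooth_fibre i : smooth_on over (fun p : TM R => p.2 0 i).
Proof. by move=> n; exact: Cn_fibre. Qed.

Lemma smooth_base i : smooth_on over (fun p : TM R => p.1 0 i).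
Proof. by move=> n; exact: Cn_base. Qed.

Lemma smooth_u : smooth_on over (u_ k).
Proof.
have [sa _ _] := smooth_frame oU sk Uk; have oo := over_open.
apply: smooth_add => //; first exact: smooth_fibre.
by apply: smooth_opp => //; apply: smooth_mul => //; [exact: smooth_over|exact: smooth_fibre].
Qed.

Lemma smooth_v : smooth_on over (v_ k).
Proof.
have [_ sb sc] := smooth_frame oU sk Uk; have oo := over_open.
have sy i := smooth_fibre i.
apply: smooth_add => //; last apply: smooth_opp => //.
  apply: smooth_add => //; first by apply: smooth_mul => //; [exact: smooth_over|exact: smooth_expn].
  apply: smooth_mul => //; apply: smooth_mul => //; apply: smooth_mul => //.
    exact: smooth_cst.
  exact: smooth_over.
apply: smooth_add => //; first exact: smooth_expn.
apply: smooth_mul => //; first exact: smooth_expn.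
by apply: smooth_expn => //; apply: smooth_sin => //; exact: smooth_base.
Qed.

Lemma smooth_uhalf : smooth_on over (uhalf k G).
Proof.
have oo := over_open; have [[sGG _ _] _] := pot.
apply: smooth_mul => //; last exact: smooth_u.
apply: smooth_expR => //; apply: smooth_mul => //; first exact: smooth_cst.
exact: smooth_over.
Qed.

Lemma smooth_Ametric : smooth_on over (Ametric k G K Mf).
Proof.
have oo := over_open; have [[sGG sK sM] _] := pot.
apply: smooth_add => //; apply: smooth_mul => //.
- exact: smooth_v.
- apply: smooth_expR => //; apply: smooth_mul => //; first exact: smooth_cst.
  exact: smooth_over.
- by apply: smooth_mul => //; [apply: smooth_expR => //|]; exact: smooth_over.
- by apply: smooth_expn => //; exact: smooth_u.
Qed.

Lemma uhalf_parallel : horizontally_constant (sph_conn k) over (uhalf k G).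
Proof.
move=> p Np a; have Uq := NU Np.
by have [_ e] := horizontal_uhalf oU sk Uk Uq (ft Uq) (fr Uq) (Ns Np) a pot.
Qed.

Lemma Ametric_parallel : horizontally_constant (sph_conn k) over (Ametric k G K Mf).
Proof.
move=> p Np a; have Uq := NU Np.
by have [_ e] := horizontal_Ametric oU sk Uk Uq (ft Uq) (fr Uq) (Ns Np) a pot.
Qed.

Definition invariant_field (c : 'rV[R]_4) (B : 'rV[R]_4 -> 'M[R]_4) (Y : TM R -> TM R) :=
  [/\ is_linear_field N Y c B, forall p, N p.1 -> 'D_(Y p) (uhalf k G) p = 0 &
      forall p, N p.1 -> 'D_(Y p) (Ametric k G K Mf) p = 0].

Lemma invariant_delta a : invariant_field (basis R a) (fun x => \matrix_(b, c) - sph_conn k x c a b)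
  (delta_h (sph_conn k) a).
Proof.
split; first exact: delta_linear_field.
  by move=> p Np; exact: uhalf_parallel.
by move=> p Np; exact: Ametric_parallel.
Qed.

Lemma invariant_bracket c B X d C Y : invariant_field c B X -> invariant_field d C Y ->
  invariant_field 0 (bracket_mx c B d C) (lie_bracket X Y).
Proof.
move=> [lX uX aX] [lY uY aY]; split; first exact: linear_field_bracket.
  exact: (bracket_annihilates oN lX lY smooth_uhalf).
exact: (bracket_annihilates oN lX lY smooth_Ametric).
Qed.

(** Base parts are constant, so a proper bracket has base part 0: apart from the [delta_h]
    themselves all generators are vertical. *)
Lemma horizontal_bracket_invariant Y : horizontal_bracket (sph_conn k) Y ->
  exists c B, invariant_field c B Y /\ ((exists a, Y = delta_h (sph_conn k) a) \/ c = 0).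
Proof.
elim=> [a|a Z _ [c [B [iZ _]]]].
  by exists (basis R a); eexists; split; [exact: invariant_delta|left; exists a].
exists 0; eexists; split; last by right.
exact: invariant_bracket (invariant_delta a) iZ.
Qed.

Section vertical.
Variables (B : 'rV[R]_4 -> 'M[R]_4) (Y : TM R -> TM R) (x : 'rV[R]_4).
Hypotheses (iY : invariant_field 0 B Y) (Nx : N x).

Let g := metric_mx k G K Mf x.
(** The covector dt - a dr: [y *m l] is the value of [u_ k] at [(x, y)]. *)
Let l : 'cV[R]_4 := \col_i ((i == i_t)%:R - fa k (tr_proj x) * (i == i_r)%:R).

Lemma vertical_kills_l : B x *m l = 0.
Proof.
have [[_ YE] uY _] := iY; have Uq := NU Nx.
have [sa _ _] := smooth_frame oU sk Uk; have da := smooth_differentiable sa Uq.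
have h (y : 'rV[R]_4) : (y *m B x *m l) 0 0 = 0.
  have Nxy : N (x, y).1 by [].
  have := uY (x, y) Nxy; rewrite YE//=; move: (y *m B x) => z.
  have h1 : is_derive (x, y) (0, z) (fun p : TM R => expR (2^-1 * G (tr_proj p.1))) 0.
    exact: (is_derive_vertical (fun x => expR (2^-1 * G (tr_proj x)))).
  have [_ ->] := is_derive_mul h1 (is_derive_u (p := (x, y)) (0, z) da).
  have z0 i : (0 : 'rV[R]_4) 0 i = 0 by rewrite mxE.
  rewrite /= !z0 !mul0r add0r addr0 mul0r add0r => /eqP.
  rewrite mulf_eq0 gt_eqF ?expR_gt0//= => /eqP e.
  by rewrite mxE sum4 !mxE/= -[RHS]e; move: (fa k _) => a; ring.
apply/matrixP => i j; rewrite [j]ord1 [RHS]mxE -(h (delta_mx 0 i)).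
by rewrite -mulmxA -rowE [RHS]mxE.
Qed.

(** Since the vertical vector [y *m B x] annihilates the quadratic form for every [y], the form
    [y *m H *m y^T] vanishes identically; polarisation makes [H] skew. *)
Lemma vertical_antisym : (B x *m g)^T = - (B x *m g).
Proof.
have [[_ YE] _ aY] := iY.
have h (y : 'rV[R]_4) : (y *m (B x *m g) *m y^T) 0 0 = 0.
  have Nxy : N (x, y).1 by [].
  have := aY (x, y) Nxy; rewrite YE//= => e.
  have dA : differentiable (Ametric k G K Mf) (x, y).
    exact: (smooth_differentiable smooth_Ametric Nxy).
  rewrite Ametric_quadratic in e dA.
  move: e; rewrite derive_vertical_quadratic//; last by move=> i j; exact: metric_mx_sym.
  move=> /eqP; rewrite mulf_eq0 pnatr_eq0/= => /eqP; by rewrite !mulmxA.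
set H := B x *m g in h *.
have hp (y z : 'rV[R]_4) : (y *m H *m z^T) 0 0 + (z *m H *m y^T) 0 0 = 0.
  have := h (y + z); rewrite linearD/= !mulmxDl !mulmxDr.
  have -> (a b c d : 'M[R]_1) : (a + b + (c + d)) 0 0 = a 0 0 + d 0 0 + (b 0 0 + c 0 0).
    by rewrite !mxE; ring.
  by rewrite !h !add0r.
apply/matrixP => i j; rewrite [LHS]mxE [RHS]mxE.
have e a b : ((delta_mx 0 a : 'rV[R]_4) *m H *m (delta_mx 0 b)^T) 0 0 = H a b.
  rewrite -rowE mxE (bigD1 b)//= big1 ?addr0 => [|d db]; rewrite !mxE ?eqxx/= ?mulr1//.
  by rewrite (negbTE db) mulr0.
have := hp (delta_mx 0 i) (delta_mx 0 j); rewrite !e.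
by move: (H i j) (H j i) => a b; lra.
Qed.

Lemma vertical_kills_fibre (y : 'rV[R]_4) :
  (y *m B x *m l) 0 0 = 0 /\ (y *m B x *m (g *m y^T)) 0 0 = 0.
Proof.
split; first by rewrite -mulmxA vertical_kills_l mulmx0 mxE.
have := vertical_antisym; rewrite mulmxA -(mulmxA y); set H := B x *m g => aH.
have : (y *m H *m y^T) 0 0 = ((y *m H *m y^T)^T) 0 0 by rewrite [RHS]mxE.
rewrite 2!trmx_mul trmxK aH mulNmx mulmxN [RHS]mxE !mulmxA.
by move: ((y *m H *m y^T) 0 0) => a; lra.
Qed.

(** By skewness [y *m B x *m g] is, up to sign, the transpose of [B x *m (g *m y^T)], a multiple of
    [B x *m l = 0]; then [g] is cancelled. *)
Lemma vertical_degenerate (y : 'rV[R]_4) (c : R) : g *m y^T = c *: l -> y *m B x = 0.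
Proof.
move=> gy; have ug : g \in unitmx by apply: metric_mx_unit; [apply: det0; exact: NU|exact: Ns].
suff : y *m B x *m g = 0.
  by move=> e; rewrite -(mulmxK ug (y *m B x)) e mul0mx.
apply: trmx_inj; rewrite trmx0 -mulmxA trmx_mul vertical_antisym mulNmx -mulmxA gy.
by rewrite -scalemxAr vertical_kills_l scaler0 oppr0.
Qed.

(** [B x] is a skew matrix times the symmetric matrix [invmx g], and transposing shows that its
    trace equals its own opposite. *)
Lemma vertical_trace : \tr (B x) = 0.
Proof.
have ug : g \in unitmx by apply: metric_mx_unit; [apply: det0; exact: NU|exact: Ns].
have sg : g^T = g by apply/matrixP => i j; rewrite mxE metric_mx_sym.
set H := B x *m g; have aH : H^T = - H := vertical_antisym.
have e : B x = H *m invmx g by rewrite mulmxK.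
have : \tr (B x) = - \tr (B x).
  rewrite -[LHS]mxtrace_tr e trmx_mul trmx_inv sg aH mulmxN raddfN/=.
  by congr (- _); rewrite mxtrace_mulC.
by move: (\tr (B x)) => t; lra.
Qed.

End vertical.

Definition row4 (a b c d : R) : 'rV[R]_4 := \row_i
  (match nat_of_ord i with 0 => a | 1 => b | 2 => c | _ => d end)%N.

(** The vectors must serve all [B] at once. Every [z = y *m B x] satisfies [z *m l = 0] and
    [z *m m = 0], two equations depending only on [x] and [y]; they cut out a plane unless [m] is a
    multiple of [l]. *)
Lemma vertical_span x (y : 'rV[R]_4) : N x -> exists v1 v2 : 'rV[R]_4, forall B Y,
  invariant_field 0 B Y -> exists c1 c2 : R, y *m B x = c1 *: v1 + c2 *: v2.
Proof.
move=> Nx; set a := fa k (tr_proj x).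
have [m mE] : exists m, m = metric_mx k G K Mf x *m y^T by exists (metric_mx k G K Mf x *m y^T).
(* Coefficient of [z 0 i_r] in the second equation once [z 0 i_t] is eliminated by the first. *)
pose mu := a * m i_t 0 + m i_r 0.
have eqs B Y (iY : invariant_field 0 B Y) : let z := y *m B x in
    z 0 i_t = a * z 0 i_r /\ z 0 i_r * mu + z 0 i_th * m i_th 0 + z 0 i_ph * m i_ph 0 = 0.
  have [] := vertical_kills_fibre iY Nx y; rewrite -mE.
  rewrite /mu; move: (y *m B x) => z e1 e2.
  rewrite mxE sum4 !mxE/= -/a in e1; rewrite mxE sum4 in e2; move: e1 e2.
  move: (z 0 i_t) (z 0 i_r) (z 0 i_th) (z 0 i_ph) (m i_t 0) (m i_r 0) (m i_th 0) (m i_ph 0).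
  move=> z1 z2 z3 z4 m1 m2 m3 m4 e1 e2.
  have e : z1 = a * z2 by lra.
  by split=> //; rewrite -e2 e; ring.
have [mu0|mu0] := eqVneq mu 0; last first.
  exists (row4 (- (a * (m i_th 0 / mu))) (- (m i_th 0 / mu)) 1 0),
     (row4 (- (a * (m i_ph 0 / mu))) (- (m i_ph 0 / mu)) 0 1) => B Y /eqs/=.
  move: (y *m B x) => z [e1 e2]; exists (z 0 i_th), (z 0 i_ph).
  have er : z 0 i_r = - (z 0 i_th * m i_th 0 + z 0 i_ph * m i_ph 0) / mu.
    by apply: (mulIf mu0); rewrite divfK//; lra.
  apply/rowP => i; rewrite !mxE; elim/ord4P: i => /=; rewrite ?e1 ?er; by field.
have [th0|th0] := eqVneq (m i_th 0) 0; last first.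
  exists (row4 a 1 (- (mu / m i_th 0)) 0), (row4 0 0 (- (m i_ph 0 / m i_th 0)) 1) => B Y /eqs/=.
  move: (y *m B x) => z [e1 e2]; exists (z 0 i_r), (z 0 i_ph).
  have er : z 0 i_th = - (z 0 i_r * mu + z 0 i_ph * m i_ph 0) / m i_th 0.
    by apply: (mulIf th0); rewrite divfK//; lra.
  apply/rowP => i; rewrite !mxE; elim/ord4P: i => /=; rewrite ?e1 ?er; by field.
have [ph0|ph0] := eqVneq (m i_ph 0) 0; last first.
  exists (row4 a 1 0 (- (mu / m i_ph 0))), (row4 0 0 1 (- (m i_th 0 / m i_ph 0))) => B Y /eqs/=.
  move: (y *m B x) => z [e1 e2]; exists (z 0 i_r), (z 0 i_th).
  have er : z 0 i_ph = - (z 0 i_r * mu + z 0 i_th * m i_th 0) / m i_ph 0.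
    by apply: (mulIf ph0); rewrite divfK//; lra.
  apply/rowP => i; rewrite !mxE; elim/ord4P: i => /=; rewrite ?e1 ?er; by field.
(* All remaining coefficients vanish, so [m] is [m i_t 0] times [l]. The equations are then
   dependent, but nondegeneracy forces [y *m B x = 0]. *)
exists 0, 0 => B Y iY; exists 0, 0; rewrite !scale0r addr0.
apply: (@vertical_degenerate B Y x iY Nx y (m i_t 0)); rewrite -mE.
apply/matrixP => i j; rewrite [j]ord1 !mxE.
have mr : m i_r 0 = - a * m i_t 0 by move: mu0; rewrite /mu; lra.
by elim/ord4P: i => /=; rewrite -/a ?th0 ?ph0 ?mr; ring.
Qed.

Lemma VDH_dim_le2 p : N p.1 -> dim_le (VDH (sph_conn k) p) 2.
Proof.
move=> Np; have [v1 [v2 hv]] := vertical_span p.2 Np.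
apply: (@VDH_dim_le _ _ _ v1 v2) => Y /horizontal_bracket_invariant[c [B [iY [[a ->]|c0]]]].
  exists 0, 0; rewrite !scale0r addr0 (bigD1 a)//= big1 => [|b ba]; last first.
    by rewrite basisE (negbTE ba) scale0r.
  rewrite basisE eqxx scale1r addr0 [LHS]surjective_pairing [RHS]surjective_pairing.
  by congr pair; rewrite /= addr0.
rewrite c0 in iY; have [[_ YE] _ _] := iY; have [c1 [c2 e]] := hv _ _ iY.
exists c1, c2; rewrite -e YE//= big1 ?add0r// => a _.
by rewrite mxE scale0r.
Qed.

Let C (c : 'I_4) (x : 'rV[R]_4) : 'M[R]_4 := \matrix_(b, e) - sph_conn k x e c b.
(** The entry [b a] of [F c d x] is the curvature component R_b^a_cd. *)
Let F c d := bracket_mx (basis R c) (C c) (basis R d) (C d).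

Lemma sph_conn_sym x e b c : sph_conn k x e b c = sph_conn k x e c b.
Proof. by elim/ord4P: e; elim/ord4P: b; elim/ord4P: c. Qed.

Lemma curvature_antisym c d x : F c d x = - F d c x.
Proof.
rewrite /F /bracket_mx; move: (C c x *m C d x) (C d x *m C c x) => X Y.
by move: (dmx _ _ _) (dmx _ _ _) => Z W; rewrite !opprB addrC.
Qed.

(** In both the quadratic part [T] and the derivative part [P], symmetry of the connection makes the
    last two indices interchangeable, so the cyclic sum cancels in pairs. *)
Lemma first_bianchi b c d x a : F c d x b a + F d b x c a + F b c x d a = 0.
Proof.
have Cs i j e z : C i z j e = C j z i e by rewrite !mxE sph_conn_sym.
pose T l i j := \sum_e C i x j e * C l x e a.
pose P l i j := 'D_(basis R l) (fun z => C i z j a) x.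
have E i j l : F i j x l a = T j i l - T i j l - (P j i l - P i j l).
  by rewrite /F /bracket_mx !mxE.
have Ts l i j : T l i j = T l j i by apply: eq_bigr => e _; rewrite Cs.
have Ps l i j : P l i j = P l j i.
  rewrite /P; have -> // : (fun z => C i z j a) = (fun z => C j z i a).
  by apply/funext => z; exact: Cs.
suff cyc (H : 'I_4 -> 'I_4 -> 'I_4 -> R) :
    (forall i j l, H i j l = T j i l - T i j l - (P j i l - P i j l)) ->
    H c d b + H d b c + H b c d = 0 by exact (cyc (fun i j l => F i j x l a) E).
move=> {}E; rewrite !E; move: T P Ts Ps {E} => T P Ts Ps.
by rewrite (Ts d c b) (Ts c d b) (Ts b d c) (Ps d c b) (Ps c d b) (Ps b d c); ring.
Qed.

Lemma ricciE b c p : N p.1 -> ricci (sph_conn k) b c p = \sum_a F c a p.1 b a.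
Proof.
move=> Np; apply: eq_bigr => a _.
have [lB _ _] := invariant_bracket (invariant_delta c) (invariant_delta a).
have [_ BE] := lB.
have h : is_derive p (0, basis R b) (fun q : TM R => \sum_e q.2 0 e * F c a q.1 e a) (F c a p.1 b a).
  apply: is_derive_eq (is_derive_sum_fun (fun e => is_derive_mul
    (is_derive_fibre p (0, basis R b) e)
    (is_derive_vertical (fun x => F c a x e a) p (basis R b)))) _.
  rewrite /= (bigD1 b)//= big1 ?addr0 => [|e eb]; rewrite basisE ?eqxx ?mulr0 ?addr0 ?mul1r//.
  by rewrite (negbTE eb) mul0r.
have [_ <-] := h; apply: near_eq_derive.
have : \forall q \near p, over q by apply: open_nbhs_nbhs; split=> //; exact: over_open.
by apply: filterS => q Nq; rewrite /curvature BE//= mxE.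
Qed.

Lemma ricci_sym b c p : N p.1 -> ricci (sph_conn k) b c p = ricci (sph_conn k) c b p.
Proof.
move=> Np; rewrite !ricciE//.
have tr0 : \sum_a F b c p.1 a a = 0.
  exact: (vertical_trace (invariant_bracket (invariant_delta b) (invariant_delta c)) Np).
have cyc : \sum_a F c a p.1 b a + \sum_a F a b p.1 c a + \sum_a F b c p.1 a a = 0.
  by rewrite -!big_split big1// => a _; exact: first_bianchi.
have anti : \sum_a F a b p.1 c a = - \sum_a F b a p.1 c a.
  by rewrite -sumrN; apply: eq_bigr => a _; rewrite (curvature_antisym a b p.1) [LHS]mxE.
have alg (s1 s2 s3 s4 : R) : s3 = 0 -> s2 = - s4 -> s1 + s2 + s3 = 0 -> s1 = s4.
  by move=> -> ->; rewrite addr0 => /eqP; rewrite subr_eq0 => /eqP.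
exact: alg tr0 anti cyc.
Qed.

End Region.

(** * The form of L *)

Section Homogeneous.
Variable R : realType.
Implicit Types (p w : TM R) (f g : TM R -> R) (S : set (TM R)) (k : coeffs R).

(** Homogeneity in infinitesimal form: it survives restriction to open sets that are not stable
    under rescaling, where [Theta] is constructed. *)
Definition euler_weight (n : R) S f :=
  forall p, S p -> \sum_i p.2 0 i * vd i f p = n * f p.

Definition invariant k (n : R) S f :=
  [/\ smooth_on S f, spherically_symmetric S f,
      horizontally_constant (sph_conn k) S f & euler_weight n S f].

Lemma euler_of_homogeneous S f : open S -> smooth_on S f ->
  (forall x y (l : R), 0 < l -> S (x, y) -> f (x, l *: y) = l ^+ 2 * f (x, y)) ->
  euler_weight 2 S f.
Proof.
move=> oS sf hf p Sp; apply: is_derive_homog2; first exact: smooth_differentiable sf Sp.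
near=> s; case: p Sp => x y Sp /=.
have -> : (x, y) + s *: (0, y) = (x, (1 + s) *: y) :> TM R.
  by congr pair; rewrite /= ?scaler0 ?addr0// scalerDl scale1r.
apply: hf => //; have : `|s| < 1 by near: s; exists 1 => //= s; rewrite /= sub0r normrN.
by rewrite ltr_norml => /andP[]; lra.
Unshelve. all: by end_near. Qed.

Lemma invariant_sub k n S T f : T `<=` S -> invariant k n S f -> invariant k n T f.
Proof.
move=> TS [sf [l fl] hf ef]; split.
- exact: smooth_sub TS sf.
- by exists l => p /TS; exact: fl.
- by move=> p /TS; exact: hf.
- by move=> p /TS; exact: ef.
Qed.

Lemma invariant_ratio k S f g : open S -> (forall p, S p -> g p != 0) ->
  invariant k 2 S f -> invariant k 2 S g -> invariant k 0 S (fun p => f p / g p).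
Proof.
move=> oS g0 [sf [l1 fl] hf ef] [sg [l2 gl] hg eg].
have D w p (Sp : S p) := is_derive_div (g0 p Sp)
  (is_derive_diff w (smooth_differentiable sf Sp)) (is_derive_diff w (smooth_differentiable sg Sp)).
split; first exact: smooth_div.
- by exists (fun a b c d e => l1 a b c d e / l2 a b c d e) => p Sp; rewrite fl// gl.
- move=> p Sp a; have [_ ->] := D (delta_h (sph_conn k) a p) p Sp.
  by rewrite hf// hg// mulr0 mul0r subrr mul0r.
move=> p Sp; rewrite mul0r.
have -> : \sum_i p.2 0 i * vd i (fun p => f p / g p) p =
    ((\sum_i p.2 0 i * vd i f p) * g p - f p * \sum_i p.2 0 i * vd i g p) / g p ^+ 2.
  rewrite big_distrl big_distrr/= -sumrB big_distrl/=; apply: eq_bigr => i _.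
  have [_ e] := D (0, basis R i) p Sp; rewrite [vd i _ p]e -/(vd i f p) -/(vd i g p).
  by move: (vd i f p) (vd i g p) (f p) (g p) => a b c d; ring.
rewrite ef// eg//; move: (f p) (g p) => a b.
have -> : 2 * a * b - a * (2 * b) = 0 by ring.
by rewrite mul0r.
Qed.

(** The vertical gradients of both functions are multiples of one vector [e] that depends only on
    [p] and [k], and horizontal constancy expresses every derivative through them. *)
Lemma invariant_gradients k S f g p (w : TM R) (v : 'rV[R]_4) : open S -> S p ->
  invariant k 0 S f -> invariant k 0 S g ->
  k10 k (tr_proj p.1) != 0 -> sin (p.1 0 i_th) != 0 -> u_ k p != 0 ->
  'D_w f p * 'D_(0, v) g p = 'D_(0, v) f p * 'D_w g p.
Proof.
move=> oS Sp If Ig k0 s0 u0.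
have [e he] := @gradient_direction R (p.2 0 i_t) (p.2 0 i_r) (p.2 0 i_th) (p.2 0 i_ph) _
  (k7 k (tr_proj p.1)) (k8 k (tr_proj p.1)) (k9 k (tr_proj p.1)) _ s0 k0 u0.
have grad h : invariant k 0 S h -> exists m, forall z : TM R,
    'D_z h p = m * \sum_i (z.2 0 i - \sum_a z.1 0 a * (delta_h (sph_conn k) a p).2 0 i) *
       (match nat_of_ord i with 0 => e.1.1.1 | 1 => e.1.1.2 | 2 => e.1.2 | _ => e.2 end)%N.
  move=> [sh ssh hh eh]; have dh := smooth_differentiable sh Sp.
  have := eh p Sp; rewrite sum4 mul0r => eul.
  have [m [h1 h2 h3 h4]] := he _ _ _ _ eul (spherical_rotation oS Sp dh ssh s0)
    (polar_invariance oS Sp dh ssh s0 (hh p Sp i_th))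
    (azimuth_invariance oS Sp dh ssh s0 (hh p Sp i_ph)) (spherical_axis oS Sp dh ssh).
  exists m => z; rewrite (vertical_part z dh (hh p Sp)) big_distrr/=.
  apply: eq_bigr => i _; rewrite mulrCA; congr (_ * _).
  by elim/ord4P: i.
have [m hm] := grad f If; have [n hn] := grad g Ig.
rewrite (hm w) (hn w) (hm (0, v)) (hn (0, v)).
by move: (\sum_i _) (\sum_i _) => a b; ring.
Qed.

End Homogeneous.

(** Local constancy is given by ambient open sets. Their unions exhibit the set where [F] takes the
    value [F p] as a relatively open and relatively closed part of [B]. *)
Lemma constant_on_connected (T : topologicalType) (X : Type) (B : set T) (F : T -> X) :
  connected B ->
  (forall p, B p -> exists Q, [/\ open Q, Q p & forall p', Q p' -> B p' -> F p' = F p]) ->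
  forall p p', B p -> B p' -> F p' = F p.
Proof.
move=> cB lc p p' Bp Bp'.
have opn (P : X -> Prop) : open (\bigcup_(Q in [set Q : set T | open Q /\
    forall y, Q y -> B y -> P (F y)]) Q) by apply: bigcup_open => Q [].
have cov (P : X -> Prop) y : B y -> P (F y) -> (\bigcup_(Q in [set Q : set T | open Q /\
    forall y, Q y -> B y -> P (F y)]) Q) y.
  move=> By Py; have [Q [oO Oy h]] := lc y By.
  by exists Q => //; split=> // y' Oy' By'; rewrite h.
suff : [set y | B y /\ F y = F p] = B by move=> E; move: Bp'; rewrite -E => -[].
apply: cB; first by exists p.
- exists (\bigcup_(Q in [set Q : set T | open Q /\
    forall y, Q y -> B y -> F y = F p]) Q); first exact: (opn (fun z => z = F p)).
  apply/seteqP; split=> y [By].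
    by move=> e; split=> //; exact: (cov (fun z => z = F p)).
  by move=> [Q [oO h] Oy]; split=> //; exact: h.
- exists (~` \bigcup_(Q in [set Q : set T | open Q /\
    forall y, Q y -> B y -> F y <> F p]) Q).
    by apply: open_closedC; exact: (opn (fun z => z <> F p)).
  apply/seteqP; split=> y [By].
    by move=> e; split=> // -[Q [oO h] Oy]; exact: h e.
  by move=> h; split=> //; apply: contrapT => ne; apply: h; exact: (cov (fun z => z <> F p)).
Qed.

Lemma invariant_eq (R : realType) (k : coeffs R) n (S : set (TM R)) f g : open S ->
  (forall p, S p -> f p = g p) -> invariant k n S f -> invariant k n S g.
Proof.
move=> oS fg [sf [l fl] hf ef].
have D p w (Sp : S p) : 'D_w g p = 'D_w f p.
  apply: near_eq_derive; apply: filterS (open_nbhs_nbhs (conj oS Sp)) => y Sy; by rewrite fg.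
split; first by move=> m; exact: Cn_eq fg (sf m).
- by exists l => p Sp; rewrite -fg// fl.
- by move=> p Sp a; rewrite D// hf.
- move=> p Sp; rewrite -fg// -ef//; apply: eq_bigr => i _.
  by congr (_ * _); exact: D.
Qed.

(** * Factorisation of L through the argument of Theta *)

Section Form.
Variable R : realType.
Implicit Types (p w : TM R) (x : 'rV[R]_4).
Variables (U : set (R * R)) (k : coeffs R) (G K Mf : R * R -> R) (N : set 'rV[R]_4).
Hypotheses (oU : open U) (sk : smooth_coeffs U k) (Uk : forall q, U q -> k10 k q != 0)
  (ft : forall q, U q -> frame_t k q) (fr : forall q, U q -> frame_r k q)
  (pot : potentials k U G K Mf) (det0 : forall q, U q -> tr_det k G K Mf q != 0)
  (oN : open N) (NU : forall x, N x -> U (tr_proj x))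
  (Ns : forall x, N x -> sin (x 0 i_th) != 0)
  (sG : forall i j l, smooth_on N (fun x => sph_conn k x i j l)).

Lemma wsq_ge0 p : 0 <= wsq p.
Proof. by rewrite addr_ge0// ?sqr_ge0// mulr_ge0// sqr_ge0. Qed.

Lemma uhalf_sqr p : uhalf k G p ^+ 2 = expR (G (tr_proj p.1)) * u_ k p ^+ 2.
Proof.
rewrite exprMn; congr (_ * _); rewrite expr2 -expRD; congr expR.
by move: (G _) => g; lra.
Qed.

Lemma uhalf_neq0 p : u_ k p != 0 -> uhalf k G p ^+ 2 != 0.
Proof. by move=> u0; rewrite uhalf_sqr mulf_neq0 ?expf_neq0// gt_eqF// expR_gt0. Qed.

Lemma invariant_uhalf_sqr : invariant k 2 (over N) (fun p => uhalf k G p ^+ 2).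
Proof.
have oo := over_open oN; have su := smooth_uhalf oU sk Uk pot oN NU.
have su2 : smooth_on (over N) (fun p => uhalf k G p ^+ 2) by apply: smooth_expn.
split=> //.
- exists (fun t r yt yr _ => expR (G (t, r)) * (yt - fa k (t, r) * yr) ^+ 2) => p Np.
  exact: uhalf_sqr.
- move=> p Np a; set w := delta_h _ _ _.
  have [_ e] := is_derive_expn 2 (is_derive_diff w (smooth_differentiable su Np)).
  apply: etrans e _; rewrite (_ : 'D_w (uhalf k G) p = 0) ?mulr0//.
  exact: (uhalf_parallel oU sk Uk ft fr pot NU Ns).
- apply: euler_of_homogeneous => // x y l l0 Nx.
  rewrite !uhalf_sqr /u_/= !mxE.
  by move: (expR _) (fa _ _) (y 0 i_t) (y 0 i_r) => *; ring.
Qed.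

Lemma Ametric_homogeneous x (y : 'rV[R]_4) (l : R) :
  Ametric k G K Mf (x, l *: y) = l ^+ 2 * Ametric k G K Mf (x, y).
Proof.
rewrite /Ametric /u_ /v_ /wsq /= !mxE.
by move: (expR _) (expR _) (Mf _) (fa _ _) (fb _ _) (fc _ _) (sin _) => *; ring.
Qed.

Lemma spherical_Ametric (S : set (TM R)) : spherically_symmetric S (Ametric k G K Mf).
Proof.
exists (fun t r yt yr m => (fc k (t, r) * yr ^+ 2 + 2 * fb k (t, r) * yt * yr - m ^+ 2)
   * expR (2 * K (t, r)) + (expR (G (t, r)) * Mf (t, r)) * (yt - fa k (t, r) * yr) ^+ 2).
by move=> p _; rewrite sqr_sqrtr ?wsq_ge0.
Qed.

Lemma invariant_Ametric : invariant k 2 (over N) (Ametric k G K Mf).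
Proof.
have sA := smooth_Ametric oU sk Uk pot oN NU.
split=> //; first exact: spherical_Ametric.
- exact: (Ametric_parallel oU sk Uk ft fr pot NU Ns).
- by apply: euler_of_homogeneous => //; [exact: over_open|move=> *; exact: Ametric_homogeneous].
Qed.

(** Reason for the shape of the argument of [Theta]: off [u = 0] it is the quotient of two parallel
    functions of weight 2, so it is itself parallel of weight 0. *)
Lemma sargE p : u_ k p != 0 -> sarg k G K Mf p = Ametric k G K Mf p / uhalf k G p ^+ 2.
Proof.
move=> u0; rewrite uhalf_sqr /sarg /z_ /Ametric opprB expRD expRN.
have := expR_gt0 (G (tr_proj p.1)).
move: (expR _) (expR _) (v_ k p) (u_ k p) u0 (Mf _) => a b v u u0 m /lt0r_neq0 b0.
by field; rewrite u0.
Qed.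

Definition transverse (A : set (TM R)) : set (TM R) := [set p | A p /\ u_ k p != 0].

Lemma transverse_open A : A `<=` over N -> open A -> open (transverse A).
Proof.
move=> AN oA; rewrite openE => p [Ap u0].
have cu : {for p, continuous (u_ k)}.
  by apply: differentiable_continuous; apply: (smooth_differentiable (smooth_u oU sk Uk oN NU)); exact: AN.
by near=> p'; split; near: p'; [exact: open_nbhs_nbhs|exact: cvgr_neq0 cu u0].
Unshelve. all: by end_near. Qed.

Lemma invariant_sarg A : A `<=` over N -> open A -> invariant k 0 (transverse A) (sarg k G K Mf).
Proof.
move=> AN oA; have oS := transverse_open AN oA.
have SN : transverse A `<=` over N by move=> p [/AN].
apply: (invariant_eq oS (f := fun p => Ametric k G K Mf p / uhalf k G p ^+ 2)).
  by move=> p [_ u0]; rewrite sargE.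
apply: invariant_ratio oS _ (invariant_sub SN invariant_Ametric)
  (invariant_sub SN invariant_uhalf_sqr).
by move=> p [_]; exact: uhalf_neq0.
Qed.

(** The exponential and [Mf] are constant on fibres, so [sarg] and [z_] have the same fibrewise
    critical points. *)
Lemma derive_sarg A p v : A `<=` over N -> open A -> transverse A p ->
  'D_(0, v) (sarg k G K Mf) p =
  expR (- (G (tr_proj p.1) - 2 * K (tr_proj p.1))) * 'D_(0, v) (z_ k) p.
Proof.
move=> AN oA Tp; have oS := transverse_open AN oA.
have SN : transverse A `<=` over N by move=> p' [/AN].
have sz : smooth_on (transverse A) (z_ k).
  apply: (smooth_div oS _ (smooth_sub SN (smooth_v oU sk Uk oN NU))).
    by move=> p' [_ u0]; rewrite expf_neq0.
  exact: smooth_expn 2 oS (smooth_sub SN (smooth_u oU sk Uk oN NU)).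
have dE := is_derive_vertical (fun x => expR (- (G (tr_proj x) - 2 * K (tr_proj x)))) p v.
have dM := is_derive_vertical (fun x => Mf (tr_proj x)) p v.
have [_ e] := is_derive_add (is_derive_mul (is_derive_diff (0, v) (smooth_differentiable sz Tp)) dE) dM.
by apply: etrans e _; rewrite mulr0 !addr0 mulrC.
Qed.

Variables (A : set (TM R)) (L : TM R -> R).
Hypotheses (AN : A `<=` over N) (oA : open A) (IL : invariant k 2 A L).

Let F p := L p / uhalf k G p ^+ 2.

Let oS : open (transverse A). Proof. exact: transverse_open. Qed.
Let Is : invariant k 0 (transverse A) (sarg k G K Mf). Proof. exact: invariant_sarg. Qed.

Let SA : transverse A `<=` A. Proof. by move=> p []. Qed.
Let SN : transverse A `<=` over N. Proof. by move=> p []/AN. Qed.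

Let IF : invariant k 0 (transverse A) F.
Proof.
apply: invariant_ratio oS _ (invariant_sub SA IL) (invariant_sub SN invariant_uhalf_sqr).
by move=> p [_]; exact: uhalf_neq0.
Qed.

Let regular_transverse : regular_part k A `<=` transverse A.
Proof. by move=> p []. Qed.

Let regular_derive p : regular_part k A p -> exists v, 'D_(0, v) (sarg k G K Mf) p != 0.
Proof.
move=> Rp; have [_ _ [v v0]] := Rp; exists v.
rewrite (derive_sarg v AN oA (regular_transverse Rp)) mulf_neq0//.
by rewrite gt_eqF// expR_gt0.
Qed.

Let open_noncritical v : open [set p | transverse A p /\ 'D_(0, v) (sarg k G K Mf) p != 0].
Proof.
have [ss _ _ _] := Is.
rewrite openE => p [Tp d0].
have cd : {for p, continuous (fun p => 'D_(0, v) (sarg k G K Mf) p)}.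
  exact: ((ss 1%N).2 (0, v) p Tp).
by near=> p'; split; near: p'; [exact: open_nbhs_nbhs|exact: cvgr_neq0 cd d0].
Unshelve. all: by end_near. Qed.

Lemma has_form_of_levels W : open W -> W `<=` regular_part k A ->
  (forall p p', W p -> W p' -> sarg k G K Mf p = sarg k G K Mf p' -> F p = F p') ->
  has_form k G K Mf L W.
Proof.
move=> oW WR lev; have WT p (Wp : W p) := regular_transverse (WR p Wp).
have [ss _ _ _] := Is; have [sF _ _ _] := IF.
(* The value of [F] at any point of the level; [lev] makes the choice immaterial. Off the image of
   [W] the point 0 is a default. *)
pose Theta s := F (xget 0 [set p | W p /\ sarg k G K Mf p = s]).
have ThE p : W p -> Theta (sarg k G K Mf p) = F p.
  move=> Wp; rewrite /Theta; case: xgetP => [p' -> [Wp' e]|/(_ p)[]//].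
  exact: lev.
exists Theta; split.
  move=> n; apply: factor_Cn oW (smooth_sub WT sF) (smooth_sub WT ss) _ ThE.
  by move=> p /WR/regular_derive[v v0]; exists (0, v).
move=> p Wp; rewrite /Lform ThE// /F -uhalf_sqr mulrC divfK//.
by apply: uhalf_neq0; case: (WT p Wp).
Qed.

(** The proportionality of differentials needs one direction in which [sarg] is noncritical. The
    work is done on the open set where the direction [v] found at [p] still serves. *)
Lemma levels_locally p : regular_part k A p -> exists W, [/\ open W, W p,
  W `<=` regular_part k A &
  forall p1 p2, W p1 -> W p2 -> sarg k G K Mf p1 = sarg k G K Mf p2 -> F p1 = F p2].
Proof.
move=> Rp; have [v v0] := regular_derive Rp; have Tp := regular_transverse Rp.
have [ss _ _ _] := Is; have [sF _ _ _] := IF.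
set S1 := [set p | transverse A p /\ 'D_(0, v) (sarg k G K Mf) p != 0].
have S1T : S1 `<=` transverse A by move=> p' [].
have [W [oW Wp WS lev]] : exists W, [/\ open W, W p, W `<=` S1 &
    forall p1 p2, W p1 -> W p2 -> sarg k G K Mf p1 = sarg k G K Mf p2 -> F p1 = F p2].
  have c2 : Cn 1 S1 F by move: (smooth_sub S1T sF); apply.
  have c3 : Cn 1 S1 (sarg k G K Mf) by move: (smooth_sub S1T ss); apply.
  have c5 p' w : S1 p' -> 'D_w F p' * 'D_(0, v) (sarg k G K Mf) p' =
      'D_(0, v) F p' * 'D_w (sarg k G K Mf) p'.
    move=> [Tp' _]; apply: (invariant_gradients w v oS Tp' IF Is).
    + by apply: Uk; apply: NU; exact: SN.
    + by apply: Ns; exact: SN.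
    + by case: Tp'.
  exact (locally_constant_on_levels (@open_noncritical v) c2 c3 (conj Tp v0) v0 c5).
exists W; split=> // p' /WS[Tp' d0]; have [Ap' u0] := Tp'; split=> //.
exists v; apply: contra_neq d0 => z0.
by rewrite (derive_sarg v AN oA Tp') z0 mulr0.
Qed.

Lemma has_form_local p : regular_part k A p -> exists W : set (TM R),
  [/\ open W, W p, W `<=` regular_part k A & has_form k G K Mf L W].
Proof.
move=> /levels_locally[W [oW Wp WR lev]]; exists W; split=> //.
exact: has_form_of_levels.
Qed.

(** [F] is locally constant on each level set by [levels_locally]; connected levels remove the
    ambiguity between their pieces, so one [Theta] serves all of [W]. *)
Lemma has_form_connected W : open W -> W `<=` regular_part k A ->
  level_connected (sarg k G K Mf) W -> has_form k G K Mf L W.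
Proof.
move=> oW WR lc; apply: has_form_of_levels => // p p' Wp Wp' e.
apply: (@constant_on_connected _ _ _ F (lc (sarg k G K Mf p'))) => //.
move=> y [Wy sy]; have [Q [oO Oy _ lev]] := levels_locally (WR _ Wy).
exists Q; split=> // y' Oy' [_ sy']; apply: lev => //; by rewrite sy sy'.
Qed.

End Form.

(** * Class 3 metrics *)

Section Berwald.
Variable R : realType.
Implicit Types (p w : TM R) (x : 'rV[R]_4).
Variables (U : set (R * R)) (k : coeffs R) (G K Mf : R * R -> R) (N : set 'rV[R]_4).
Hypotheses (oU : open U) (sk : smooth_coeffs U k) (Uk : forall q, U q -> k10 k q != 0)
  (ft : forall q, U q -> frame_t k q) (fr : forall q, U q -> frame_r k q)
  (pot : potentials k U G K Mf) (det0 : forall q, U q -> tr_det k G K Mf q != 0)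
  (oN : open N) (NU : forall x, N x -> U (tr_proj x))
  (Ns : forall x, N x -> sin (x 0 i_th) != 0)
  (sG : forall i j l, smooth_on N (fun x => sph_conn k x i j l)).

Lemma berwald_of_invariant (B : set (TM R)) f : conic_subbundle N B ->
  (forall x y (l : R), 0 < l -> B (x, y) -> f (x, l *: y) = l ^+ 2 * f (x, y)) ->
  smooth_on B f -> horizontally_constant (sph_conn k) B f ->
  (forall p, B p -> hessian f p \in unitmx) -> berwald_with N B f (sph_conn k).
Proof.
move=> cB hf sf hc uH; split=> //.
  by split=> [c a b|x c a b _]; [exact: sG|exact: sph_conn_sym].
move=> p c Bp; rewrite Gq_E; have [oB _ _ _] := cB.
have sym p' d a b : B p' -> sph_conn k p'.1 d a b = sph_conn k p'.1 d b a.
  by move=> _; exact: sph_conn_sym.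
exact: (spray_of_horizontal oB sf sym hc Bp (uH p Bp)).
Qed.

Section Free.
Variables (B : set (TM R)) (Theta : R -> R).
Hypotheses (cB : conic_subbundle N B) (u0 : forall p, B p -> u_ k p != 0)
  (sTh : smooth_on (sarg k G K Mf @` B) Theta).

Let oB : open B. Proof. by case: cB. Qed.
Let BN : B `<=` over N. Proof. by move=> p Bp; case: cB => _ /(_ p Bp)[]. Qed.
Let BT : B `<=` transverse k B. Proof. by move=> p Bp; split=> //; exact: u0. Qed.

Let Isarg : invariant k 0 B (sarg k G K Mf).
Proof. by apply: (invariant_sub BT); exact: (invariant_sarg oU sk Uk ft fr pot oN NU Ns). Qed.
Let Iuhalf : invariant k 2 B (fun p => uhalf k G p ^+ 2).
Proof. by apply: (invariant_sub BN); exact: (invariant_uhalf_sqr oU sk Uk ft fr pot oN NU Ns). Qed.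

Let LformE p : Lform k G K Mf Theta p = uhalf k G p ^+ 2 * Theta (sarg k G K Mf p).
Proof. by rewrite uhalf_sqr. Qed.

Let LformEf : Lform k G K Mf Theta = fun p => uhalf k G p ^+ 2 * Theta (sarg k G K Mf p).
Proof. by apply/funext => p; exact: LformE. Qed.

Lemma smooth_Lform : smooth_on B (Lform k G K Mf Theta).
Proof.
have [ss _ _ _] := Isarg; have [su _ _ _] := Iuhalf.
rewrite LformEf; apply: smooth_mul => // n; apply: Cn_comp => //; exact: sTh.
Qed.

Lemma Lform_parallel : horizontally_constant (sph_conn k) B (Lform k G K Mf Theta).
Proof.
have [ss _ hs _] := Isarg; have [su _ hu _] := Iuhalf.
move=> p Bp a; rewrite LformEf; set w := delta_h _ _ _.
have dT : differentiable Theta (sarg k G K Mf p).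
  by apply: (smooth_differentiable sTh); exists p.
have d1 := is_derive_diff w (smooth_differentiable su Bp).
have d2 := is_derive_comp1 (is_derive_diff (1 : R^o) dT) (is_derive_diff w (smooth_differentiable ss Bp)).
have [_ e] := is_derive_mul d1 d2.
by apply: etrans e _; rewrite (hu p Bp) (hs p Bp) mulr0 mul0r mulr0 addr0.
Qed.

Lemma sarg_homogeneous x (y : 'rV[R]_4) (l : R) : 0 < l ->
  sarg k G K Mf (x, l *: y) = sarg k G K Mf (x, y).
Proof.
move=> l0; rewrite /sarg/=; congr (_ * _ + _).
have uE : u_ k (x, l *: y) = l * u_ k (x, y).
  by rewrite /u_/= !mxE; move: (fa _ _) => a; ring.
have vE : v_ k (x, l *: y) = l ^+ 2 * v_ k (x, y).
  by rewrite /v_ /wsq/= !mxE; move: (fb _ _) (fc _ _) (sin _) => *; ring.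
by rewrite /z_ uE vE exprMn -mulf_div divff ?mul1r// expf_neq0// gt_eqF.
Qed.

Lemma spherical_Lform : spherically_symmetric B (Lform k G K Mf Theta).
Proof.
exists (fun t r yt yr m => (expR (G (t, r)) * (yt - fa k (t, r) * yr) ^+ 2) *
  Theta ((fc k (t, r) * yr ^+ 2 + 2 * fb k (t, r) * yt * yr - m ^+ 2) /
    (yt - fa k (t, r) * yr) ^+ 2 * expR (- (G (t, r) - 2 * K (t, r))) + Mf (t, r))).
by move=> p _; rewrite sqr_sqrtr ?wsq_ge0.
Qed.

(** A parallel function of weight 2 times any smooth function of a parallel function of weight 0 is
    again parallel of weight 2; nondegeneracy of the Hessian is the condition that remains on
    [Theta]. *)
Lemma berwald_Lform : (forall p, B p -> hessian (Lform k G K Mf Theta) p \in unitmx) ->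
  berwald_with N B (Lform k G K Mf Theta) (sph_conn k).
Proof.
apply: berwald_of_invariant => //; last 2 first.
- exact: smooth_Lform.
- exact: Lform_parallel.
move=> x y l l0 _; rewrite /Lform sarg_homogeneous// mulrA; congr (_ * _).
by rewrite /u_/= !mxE; move: (expR _) (fa _ _) => *; ring.
Qed.

End Free.

Lemma slit_conic : conic_subbundle N (slit_tangent N).
Proof.
split=> [|p []//|x Nx|x y l l0 [Nx y0]].
- rewrite openE => p [Np y0].
  have c : {for p, continuous (fun p : TM R => p.2)} by exact: cvg_snd.
  near=> p'; split; near: p'; last exact: cvgr_neq0 c y0.
  by apply: open_nbhs_nbhs; split; [exact: over_open oN|].
- exists (basis R i_t); split=> //=; apply/eqP => /matrixP/(_ 0 i_t).
  by rewrite basisE eqxx mxE => /eqP; rewrite oner_eq0.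
- by split=> //=; rewrite scaler_eq0 negb_or y0 gt_eqF.
Unshelve. all: by end_near. Qed.

Lemma riemannian_Ametric (S : set (TM R)) : riemannian S (Ametric k G K Mf).
Proof. by exists (metric_mx k G K Mf) => p _; rewrite Ametric_quadratic. Qed.

Lemma berwald_Ametric : berwald_with N (slit_tangent N) (Ametric k G K Mf) (sph_conn k).
Proof.
have SN : slit_tangent N `<=` over N by move=> p [].
have [sA _ hA _] := invariant_sub SN (invariant_Ametric oU sk Uk ft fr pot oN NU Ns).
apply: berwald_of_invariant => //.
- exact: slit_conic.
- by move=> *; exact: Ametric_homogeneous.
- move=> p [Np _]; rewrite hessian_Ametric; apply: metric_mx_unit; last exact: Ns.
  by apply: det0; exact: NU.
Qed.

End Berwald.

Section Restriction.
Variable R : realType.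
Implicit Types (M N : set 'rV[R]_4) (A : set (TM R)) (L : TM R -> R) (k : coeffs R).

Lemma invariant_of_berwald M A L k : berwald_with M A L (sph_conn k) ->
  spherically_symmetric A L -> invariant k 2 A L.
Proof.
move=> [[[oA AM _ _] sL hL uH] _ spr] ss.
have eul := euler_of_homogeneous oA sL hL.
split=> //; apply: (horizontal_of_spray oA sL) => //.
- by move=> *; exact: sph_conn_sym.
- by move=> p c Ap; rewrite -Gq_E; exact: spr.
Qed.

Lemma restr_over_open M A : open M -> open A -> open (restr_over M A).
Proof. by move=> oM oA; apply: openI => //; exact: over_open oM. Qed.

Lemma berwald_restr M N A L (Gam : connection R) : open N -> N `<=` M ->
  berwald_with M A L Gam -> berwald_with N (restr_over N A) L Gam.
Proof.
move=> oN NM [[[oA AM xA cA] sL hL uH] [sG sy] spr].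
have SA : restr_over N A `<=` A by move=> p [].
split.
- split.
  + split.
    * exact: restr_over_open.
    * by move=> p [Ap Np]; split=> //; case: (AM p Ap).
    * by move=> x Nx; have [y Axy] := xA x (NM x Nx); exists y.
    * by move=> x y l l0 [Axy Nx]; split=> //; exact: cA.
  + exact: smooth_sub SA sL.
  + by move=> x y l l0 [Axy _]; exact: hL.
  + by move=> p [Ap _]; exact: uH.
- split=> [c a b|x c a b Nx]; first exact: smooth_sub NM (sG c a b).
  by apply: sy; exact: NM.
- by move=> p c [Ap _]; exact: spr.
Qed.

End Restriction.

Section Class3.
Variable R : realType.
Variables (M : set 'rV[R]_4) (A : set (TM R)) (L : TM R -> R) (k : coeffs R).
Hypothesis hL : class3 M A L k.

Lemma class3_domain : open M /\ forall x, M x -> sin (x 0 i_th) != 0.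
Proof.
have [[[oM dM] _ _ _] _] := hL; split=> // x /dM[_ h1 h2].
by rewrite gt_eqF// sin_gt0_pi// h1 h2.
Qed.

Lemma class3_connection i j l : smooth_on M (fun x => sph_conn k x i j l).
Proof. by have [[_ [_ [sG _] _] _ _] _] := hL; exact: sG. Qed.

Lemma class3_frame q : (@tr_proj R @` M) q ->
  [/\ k10 k q != 0, frame_t k q, frame_r k q, flat_tr k q &
    (fb k q != 0) || (fc k q != 0)].
Proof.
move=> Vq; have [[dom bw ss _] rel] := hL; have [k0 cr def] := rel q Vq.
have [oM _] := class3_domain.
have sk := smooth_coeffs_of_connection oM class3_connection.
have [ft fr] := frame_of_relations sk Vq k0 cr.
have bc : (fb k q != 0) || (fc k q != 0).
  have [x Mx xq] := Vq; rewrite -xq.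
  have [pf _ _] := bw; have [_ _ hc _] := invariant_of_berwald bw ss.
  by apply: (frame_nonzero dom pf ss hc Mx); rewrite xq.
by split=> //; exact: flat_of_relations cr def bc.
Qed.

Section Rectangle.
Variables I J : set R.
Hypotheses (oI : open I) (iI : is_interval I) (oJ : open J) (iJ : is_interval J)
  (UM : I `*` J `<=` @tr_proj R @` M).
Let U := I `*` J.

Lemma class3_smooth : smooth_coeffs U k.
Proof.
have [oM _] := class3_domain.
have := smooth_coeffs_of_connection oM class3_connection.
by move=> [[h1 h2 h3 h4 h5] [h6 h7 h8 h9 h10]]; split; split; exact: smooth_sub UM _.
Qed.

Let oU : open U. Proof. exact: open_rectangle. Qed.
Let Uk q : U q -> k10 k q != 0. Proof. by move=> /UM/class3_frame[]. Qed.
Let ft q : U q -> frame_t k q. Proof. by move=> /UM/class3_frame[]. Qed.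
Let fr q : U q -> frame_r k q. Proof. by move=> /UM/class3_frame[]. Qed.

Lemma class3_potentials : exists G K Mf : R * R -> R, potentials k U G K Mf /\
  forall q, U q -> tr_det k G K Mf q != 0.
Proof.
apply: potentials_exist oI iI oJ iJ class3_smooth Uk ft fr _ _.
- by move=> q /UM/class3_frame[].
- by move=> q /UM/class3_frame[].
Qed.

Let N := M `&` @tr_proj R @^-1` U.

Let NU x : N x -> U (tr_proj x). Proof. by case. Qed.
Let NM : N `<=` M. Proof. by move=> x []. Qed.
Let Ns x : N x -> sin (x 0 i_th) != 0.
Proof. by have [_ h] := class3_domain; move=> [/h]. Qed.
Let sG i j l : smooth_on N (fun x => sph_conn k x i j l).
Proof. exact: smooth_sub NM (class3_connection i j l). Qed.
Let oN : open N.
Proof.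
have [oM _] := class3_domain; apply: openI => //.
by apply: open_comp oU => x _; exact: tr_proj_continuous.
Qed.

Section Forms.
Variables G K Mf : R * R -> R.
Hypotheses (pot : potentials k U G K Mf) (det0 : forall q, U q -> tr_det k G K Mf q != 0).

Let AN : restr_over N A `<=` over N. Proof. by move=> p []. Qed.
Let oA : open (restr_over N A).
Proof. by have [[_ [[[oA _ _ _] _ _ _] _ _] _ _] _] := hL; exact: restr_over_open. Qed.
Let IL : invariant k 2 (restr_over N A) L.
Proof.
have [[_ bw ss _] _] := hL.
by apply: invariant_sub (invariant_of_berwald bw ss) => p [].
Qed.

Lemma class3_local_form p : regular_part k (restr_over N A) p -> exists W : set (TM R),
  [/\ open W, W p, W `<=` regular_part k (restr_over N A) & has_form k G K Mf L W].
Proof. exact: (has_form_local oU class3_smooth Uk ft fr pot oN NU Ns AN oA IL). Qed.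

Lemma class3_connected_form W : open W -> W `<=` regular_part k (restr_over N A) ->
  level_connected (sarg k G K Mf) W -> has_form k G K Mf L W.
Proof. exact: (has_form_connected oU class3_smooth Uk ft fr pot oN NU Ns AN oA IL). Qed.

Lemma class3_free (B : set (TM R)) (Theta : R -> R) : conic_subbundle N B ->
  (forall p, B p -> u_ k p != 0) -> smooth_on (sarg k G K Mf @` B) Theta ->
  (forall p, B p -> hessian (Lform k G K Mf Theta) p \in unitmx) ->
  spherically_symmetric B (Lform k G K Mf Theta) /\
  berwald_with N B (Lform k G K Mf Theta) (sph_conn k).
Proof.
move=> cB u0 sT uH; split; first exact: spherical_Lform.
exact: (berwald_Lform oU class3_smooth Uk ft fr pot oN NU Ns sG cB u0 sT uH).
Qed.

Lemma class3_affinely_equivalent :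
  affinely_equivalent N (restr_over N A) L (slit_tangent N) (Ametric k G K Mf).
Proof.
exists (sph_conn k); split.
  by have [[_ bw _ _] _] := hL; exact: berwald_restr oN NM bw.
exact: (berwald_Ametric oU class3_smooth Uk ft fr pot det0 oN NU Ns sG).
Qed.

Lemma class3_VDH_dim p : N p.1 -> dim_le (VDH (sph_conn k) p) 2.
Proof. exact: (VDH_dim_le2 oU class3_smooth Uk ft fr pot det0 oN NU Ns sG). Qed.

Lemma class3_ricci p b c : N p.1 -> ricci (sph_conn k) b c p = ricci (sph_conn k) c b p.
Proof. exact: (ricci_sym oU class3_smooth Uk ft fr pot det0 oN NU Ns sG). Qed.

End Forms.
End Rectangle.

(** The bound on the vertical part and the symmetry of the Ricci tensor are pointwise and do not
    mention the potentials, so potentials on a small square around the base point suffice. *)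
Lemma rectangle_around p : A p -> exists I J : set R,
  [/\ open I, is_interval I, open J & is_interval J] /\
  [/\ I `*` J `<=` @tr_proj R @` M & (I `*` J) (tr_proj p.1)].
Proof.
move=> Ap; have [oM _] := class3_domain.
have Mp : M p.1 by have [[_ [[[_ AM _ _] _ _ _] _ _] _ _] _] := hL; case: (AM p Ap).
have : nbhs (tr_proj p.1) (@tr_proj R @` M).
  by apply: open_nbhs_nbhs; split; [exact: tr_proj_open|exists p.1].
move=> /nbhs_ballP[e /= e0 he].
exists (ball (tr_proj p.1).1 e), (ball (tr_proj p.1).2 e); split.
  by split; [exact: ball_open|rewrite ball_itv; exact: interval_is_interval|
    exact: ball_open|rewrite ball_itv; exact: interval_is_interval].
by split; [move=> q [h1 h2]; exact: he|split; exact: ballxx].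
Qed.

End Class3.

Theorem lemma12 (R : realType) (M : set 'rV[R]_4) (A : set (TM R))
    (L : TM R -> R) (k : coeffs R) (hL : class3 M A L k) :
  (* the (t,r)-functions exist over every open rectangle, bounded or not *)
  (forall I J : set R,
     open I -> is_interval I -> open J -> is_interval J ->
     I `*` J `<=` @tr_proj R @` M ->
     let U := I `*` J in
     let MU := M `&` @tr_proj R @^-1` U in
     exists G K Mf : R * R -> R,
       [/\ potentials k U G K Mf,
           (* 1: local form of L; one Theta whenever level sets are connected *)
           (forall p, regular_part k (restr_over MU A) p ->
              exists W : set (TM R),
                [/\ open W, W p, W `<=` regular_part k (restr_over MU A) &
                    has_form k G K Mf L W]) /\
           (forall W : set (TM R),
              open W -> W `<=` regular_part k (restr_over MU A) ->
              level_connected (sarg k G K Mf) W -> has_form k G K Mf L W),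
           (* 1: Theta is free *)
           (forall (N : set (TM R)) (Theta : R -> R),
              conic_subbundle MU N ->
              (forall p, N p -> u_ k p != 0) ->
              smooth_on (sarg k G K Mf @` N) Theta ->
              (forall p, N p -> hessian (Lform k G K Mf Theta) p \in unitmx) ->
              spherically_symmetric N (Lform k G K Mf Theta) /\
              berwald_with MU N (Lform k G K Mf Theta) (sph_conn k)) &
           (* 2 *)
           [/\ riemannian (slit_tangent MU) (Ametric k G K Mf),
               spherically_symmetric (slit_tangent MU) (Ametric k G K Mf) &
               affinely_equivalent MU (restr_over MU A) L
                 (slit_tangent MU) (Ametric k G K Mf)]]) /\
  (* 3 *)
  (forall p, A p -> dim_le (VDH (sph_conn k) p) 2) /\
  (forall p, A p -> forall b c : 'I_4,
     ricci (sph_conn k) b c p = ricci (sph_conn k) c b p).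
Proof.
have [[_ [[[oA AM _ _] _ _ _] _ _] _ _] _] := hL; split; last first.
  split=> p Ap; have [I [J [[oI iI oJ iJ] [UM Up]]]] := rectangle_around hL Ap;
    have [G [K [Mf [pot det0]]]] := class3_potentials hL oI iI oJ iJ UM;
    have [Mp _] := AM p Ap.
  - exact: (class3_VDH_dim hL oI oJ UM pot det0 (conj Mp Up)).
  - by move=> b c; exact: (class3_ricci hL oI oJ UM pot det0 b c (conj Mp Up)).
move=> I J oI iI oJ iJ UM U MU.
have [G [K [Mf [pot det0]]]] := class3_potentials hL oI iI oJ iJ UM.
exists G, K, Mf; split=> //.
- split; first exact: (class3_local_form hL oI oJ UM pot).
  exact: (class3_connected_form hL oI oJ UM pot).
- exact: (class3_free hL oI oJ UM pot).
- split; [exact: riemannian_Ametric|exact: spherical_Ametric|].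
  exact: (class3_affinely_equivalent hL oI oJ UM pot det0).
Qed.
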